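(* Let $\gamma\subset\mathbb{R}^2$ be a bounded strictly convex curve. For each positive integer $n$ let $L_n=\left(\frac1n\mathbb{Z}\right)^2$ and $k(\gamma,n)=\#(\gamma\cap L_n)$. Then $k(\gamma,n)=o(n^{2/3})$ as $n\to\infty$.
   Context: A strictly convex curve in the plane is a convex curve (a connected part of the boundary of a convex planar set) that contains no nondegenerate straight segment. $L_n$ is the lattice of points both of whose coordinates are integer multiples of $1/n$. *)

(* Defs.v *)
From HB Require Import structures.
From mathcomp Require Import all_boot all_order all_algebra finmap.
From mathcomp Require Import zify.
From mathcomp Require Import all_classical all_reals all_analysis.
Import Order.TTheory GRing.Theory Num.Theory.
Import numFieldNormedType.Exports.

Set Implicit Arguments.
Unset Strict Implicit.
Unset Printing Implicit Defensive.

Local Open Scope classical_set_scope.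
Local Open Scope ring_scope.

Definition boundary (T : topologicalType) (A : set T) : set T :=
  closure A `\` interior A.

(* The plane is ['rV[R]_2]; its sup norm has the same topology and the same
   bounded sets as the Euclidean norm. *)
Definition segment (R : realType) (a b : 'rV[R]_2) : set 'rV[R]_2 :=
  [set (1 - t) *: a + t *: b | t in `[0, 1]].

Definition convex_curve (R : realType) (gamma : set 'rV[R]_2) : Prop :=
  connected gamma /\
  exists2 K : set 'rV[R]_2, convex_set K & gamma `<=` boundary K.

Definition strictly_convex_curve (R : realType) (gamma : set 'rV[R]_2) : Prop :=
  convex_curve gamma /\
  forall a b : 'rV[R]_2, a != b -> ~ (segment a b `<=` gamma).

Definition lattice (R : realType) (n : nat) : set 'rV[R]_2 :=
  [set p | forall i, exists m : int, p ord0 i = m%:~R / n%:R].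

Arguments lattice : clear implicits.

(* [fset_set] is empty by convention on infinite sets; for bounded [gamma] and
   [0 < n] the set counted is finite, see [finite_bounded_lattice]. *)
Definition lattice_count (R : realType) (gamma : set 'rV[R]_2) (n : nat) : nat :=
  #|` fset_set (gamma `&` lattice R n)|.

Lemma finite_bounded_lattice (R : realType) (gamma : set 'rV[R]_2) (n : nat) :
  (0 < n)%N -> bounded_set gamma -> finite_set (gamma `&` lattice R n).
Proof.
move=> n0 gammaB; have [M hM] : exists M : R, forall p, gamma p -> `|p| <= M.
  by case: gammaB => M [_ hM]; exists (M + 1); apply: hM; rewrite ltrDl.
have n0' : (0 : R) < n%:R by rewrite ltr0n.
have [N hN] : exists N : nat, M * n%:R < N%:R.
  by exists (Num.bound (M * n%:R)); exact: unstable.ltr_bound.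
pose f (q : 'I_2 -> 'I_(N + N).+1) : 'rV[R]_2 :=
  \row_i (((q i)%:Z - N%:Z)%:~R / n%:R).
apply: (@sub_finite_set _ _ [set f (g : {ffun 'I_2 -> 'I_(N + N).+1}) | g in setT]);
  last exact/finite_image/finite_finset.
move=> p [/hM hp /= pL].
have /fin_all_exists[m hm] : forall i, exists m : 'I_(N + N).+1,
    p ord0 i = ((m : nat)%:Z - N%:Z)%:~R / n%:R.
  move=> i; have [m hm] := pL i.
  have mN : `|m| <= N%:Z.
    rewrite -(ler_int R) intr_norm.
    have -> : m%:~R = p ord0 i * n%:R by rewrite hm divfK// gt_eqF.
    rewrite normrM (ger0_norm (ltW n0')) (le_trans _ (ltW hN))// ler_pM2r//.
    apply: le_trans hp; rewrite /Num.norm/= mx_normrE.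
    exact: (le_bigmax _ (fun ij => `|p ij.1 ij.2|) (ord0, i)).
  have mN0 : 0 <= m + N%:Z by move: mN; rewrite ler_norml => /andP[]; lia.
  have mlt : (absz (m + N%:Z)%R < (N + N).+1)%N.
    by move: mN; rewrite ler_norml => /andP[]; lia.
  exists (Ordinal mlt); rewrite hm /= gez0_abs// addrK//.
exists [ffun i => m i] => //.
by apply/rowP => i; rewrite mxE ffunE hm.
Qed.

(* Main.v *)
Require Import Defs.
From mathcomp Require Import all_boot all_order all_algebra finmap.
From mathcomp Require Import all_classical all_reals all_analysis.
From mathcomp Require Import ring lra zify.
Import Order.TTheory GRing.Theory Num.Theory.
Import numFieldNormedType.Exports.

Set Implicit Arguments.
Unset Strict Implicit.
Local Open Scope ring_scope.

(** A chord of a convex curve and the tangents at its two ends bound a triangle.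
    The cube root of its area, the affine length [alen] of the chord, is
    superadditive under subdivision of the arc ([alen_superadd]), and a division
    point that loses almost nothing is almost on the parabola that touches both
    tangents at the ends of the chord ([small_drop_near_parabola]).  Two
    consecutive edges of a chain of points of [((1/n) Z)^2] span an affine length
    of at least [n^(-2/3)] ([lc_alen_lb]); together with superadditivity this is
    Jarnik's bound [O(n^(2/3))].

    To replace [O] by [o], suppose that for arbitrarily large [n] the curve
    carries at least [eps n^(2/3)] lattice points.  The sum of the affine lengths
    over a chain of points of the curve decreases under refinement; fix a finite
    chain for which it is almost minimal ([small_defect_chain]).  For large [n],
    most windows of [M] consecutive lattice points then lose almost nothing when
    they are divided at their points ([many_good_windows]), so that their points
    nearly lie on a parabola.  On a parabola the cross product of two edges is
    [H_i H_j (T_j + T_(j+1) - T_i - T_(i+1))], where [T] is the affine parameter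
    and [H] its increments.  In lattice units these cross products are integers,
    bounded for most edges, and the three cross products of three consecutive
    edges determine the increments ([edge_lengths_stable_lt]).  By the pigeonhole
    principle most edges [v] have a nearby partner [v'] of the same increment
    ([many_partners]).  Then [w = v' - v] is nearly parallel to the axis of the
    parabola: it is an integer vector of length [O(n^(1/3) / M)] whose cross
    product with [v] is a bounded nonzero integer ([parabolic_window]).  Only
    [O(n^(2/3) / M)] integer vectors [v] of length [O(n^(1/3))] admit such a [w]
    ([card_companions]), whereas the edges of a strictly convex chain are
    pairwise different.  With [M] large in terms of [eps] this is a contradiction
    ([lattice_chain_small]).

    The curve enters through two facts: it has a supporting line at each point
    ([boundary_support]), and no three of its points are collinear
    ([no_three_collinear]).  Splitting it according to the quadrant of the normal
    and turning the axes by 45 degrees makes each of the four parts the graph of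
    a concave function with slopes in [[-1, 1]] ([quadrant_small]). *)

(** * Counting pairs of lattice vectors *)

Definition box_index (K : nat) (v : int) : 'I_(2 * K).+1 := inord (absz (v + K%:Z)).

Lemma box_index_inj (K : nat) (v v' : int) :
  `|v| <= K%:Z -> `|v'| <= K%:Z -> box_index K v = box_index K v' -> v = v'.
Proof.
move=> hv hv' /(congr1 val); rewrite /= !inordK; lia.
Qed.

(** For fixed [v1], [w1] and cross product [d], the residue of [d * w2] modulo
    [w1] is determined, whatever [v2] is: this replaces any discussion of the
    greatest common divisor of [v1] and [w1]. *)
Lemma dvdz_cross (v1 v2 w1 w2 v2' w2' d : int) :
  v1 * w2 - v2 * w1 = d -> v1 * w2' - v2' * w1 = d ->
  (d * w2 = d * w2' %[mod w1])%Z.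
Proof.
move=> h h'; apply/eqP; rewrite eqz_mod_dvd; apply/dvdzP.
exists (v2 * w2' - v2' * w2).
have -> : d * w2 - d * w2' = (v1 * w2' - v2' * w1) * w2 - (v1 * w2 - v2 * w1) * w2'.
  by rewrite h h'; ring.
ring.
Qed.

Lemma divz_bound (d w1 w2 : int) (D : nat) :
  `|d| <= D%:Z -> `|w2| <= `|w1| -> w1 != 0 -> `|((d * w2) %/ w1)%Z| <= D%:Z.
Proof.
move=> hd hw w0.
have hq := divz_eq (d * w2) w1.
have r0 := modz_ge0 (d * w2) w0.
have r1 := ltz_mod (d * w2) w0.
set q := (_ %/ _)%Z in hq *; set r := (_ %% _)%Z in hq r0 r1.
have hdw : `|d * w2| <= D%:Z * `|w1|.
  by rewrite normrM; apply: ler_pM.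
rewrite leNgt; apply/negP => hlt.
have qw : (D%:Z + 1) * `|w1| <= `|q * w1|.
  by rewrite normrM ler_wpM2r //; lia.
have hqr : `|q * w1| <= `|d * w2| + r by rewrite hq; lia.
lia.
Qed.

(** The pair [(v, w)] is recovered from [v1], [w1], the cross product [d] and the
    quotient of [d * w2] by [w1], which is at most [D] in absolute value because
    [`|w2| <= `|w1|]. *)
Lemma card_pairs_half (T : finType) (A : {set T}) (v1 v2 w1 w2 : T -> int)
    (K rho D : nat) :
  {in A &, injective (fun t => (v1 t, v2 t))} ->
  {in A, forall t, [/\ `|v1 t| <= K%:Z, `|w1 t| <= rho%:Z, `|w2 t| <= `|w1 t|
    & 0 < `|v1 t * w2 t - v2 t * w1 t| <= D%:Z]} ->
  (#|A| <= (2 * K).+1 * (2 * rho).+1 * ((2 * D).+1 * (2 * D).+1))%N.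
Proof.
move=> vinj hA.
pose d t := v1 t * w2 t - v2 t * w1 t.
pose g t := (box_index K (v1 t), box_index rho (w1 t),
             (box_index D (d t), box_index D ((d t * w2 t) %/ w1 t)%Z)).
have ginj : {in A &, injective g}.
  move=> t t' tA t'A; have [a1 a2 a3 /andP[a4 a5]] := hA _ tA.
  have [b1 b2 b3 /andP[b4 b5]] := hA _ t'A.
  have w0 : w1 t != 0.
    apply: contraTneq a4 => w0; rewrite w0 normr0 normr_le0 in a3.
    by rewrite (eqP a3) w0 !mulr0 subrr normr0 ltxx.
  have w0' : w1 t' != 0.
    apply: contraTneq b4 => w0'; rewrite w0' normr0 normr_le0 in b3.
    by rewrite (eqP b3) w0' !mulr0 subrr normr0 ltxx.
  have h1 := divz_bound a5 a3 w0; have h2 := divz_bound b5 b3 w0'.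
  move=> [/(box_index_inj a1 b1) ev1 /(box_index_inj a2 b2) ew1].
  move=> /(box_index_inj a5 b5) ed' /(box_index_inj h1 h2) em; have {ed'} ed : d t = d t' := ed'.
  have {em} em : (d t * w2 t %/ w1 t)%Z = (d t' * w2 t' %/ w1 t')%Z := em.
  have ed0 : d t != 0 by rewrite -normr_gt0.
  have ew2 : w2 t = w2 t'.
    apply: (mulfI ed0).
    have hm : (d t * w2 t = d t * w2 t' %[mod w1 t])%Z.
      apply: (@dvdz_cross (v1 t) (v2 t) _ _ (v2 t')) => //.
      by rewrite -[RHS]/(d t) ed ev1 ew1.
    rewrite (divz_eq (d t * w2 t) (w1 t)) (divz_eq (d t * w2 t') (w1 t)) hm.
    by rewrite {1}em ed ew1.
  apply: vinj => //; congr (_, _) => //; apply: (mulIf w0').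
  by move: ed; rewrite /d ev1 ew1 ew2 => /addrI/oppr_inj.
have := max_card (mem (g @: A)); rewrite card_in_imset // => /leq_trans -> //.
by rewrite !card_prod !card_ord.
Qed.

Lemma card_pairs (T : finType) (A : {set T}) (v1 v2 w1 w2 : T -> int)
    (K rho D : nat) :
  {in A &, injective (fun t => (v1 t, v2 t))} ->
  {in A, forall t, [/\ `|v1 t| <= K%:Z, `|v2 t| <= K%:Z,
    `|w1 t| <= rho%:Z, `|w2 t| <= rho%:Z
    & 0 < `|v1 t * w2 t - v2 t * w1 t| <= D%:Z]} ->
  (#|A| <= 2 * ((2 * K).+1 * (2 * rho).+1 * ((2 * D).+1 * (2 * D).+1)))%N.
Proof.
move=> vinj hA; pose B := [set t | `|w2 t| <= `|w1 t|].
rewrite -(cardsID B A) mul2n -addnn leq_add //.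
  apply: (@card_pairs_half _ _ v1 v2 w1 w2).
    by move=> t t' /setIP[tA _] /setIP[t'A _]; apply: vinj.
  by move=> t /setIP[/hA[]]; rewrite inE.
apply: (@card_pairs_half _ _ v2 v1 w2 w1).
  move=> t t' /setDP[tA _] /setDP[t'A _] [e1 e2]; apply: vinj => //.
  by rewrite e1 e2.
move=> t /setDP[/hA[h1 h2 h3 h4 h5]]; rewrite inE -ltNge => /ltW h6.
by split => //; rewrite distrC.
Qed.

(** * Lattice chains close to a parabola *)

(** Three consecutive edges of parameter lengths [u], [v], [w] on a parabola have
    cross products [a = u v (u + v)], [b = v w (v + w)] and
    [g = u w (u + 2 v + w)].  If [u] grows while the three values stay, then [v]
    shrinks because of [a], hence [w] grows because of [b], and [g v = a w + b u]
    is violated.  The statement is the quantitative version of this, with an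
    error [xi] in the three values and a resulting error [k] in [u]. *)
Lemma edge_lengths_stable_lt (R : realFieldType) (C c k xi u v w u' v' w' : R) :
  0 < c -> c <= u <= C -> c <= v <= C -> c <= w <= C ->
  c <= u' <= C -> c <= v' <= C -> c <= w' <= C ->
  `|u' * v' * (u' + v') - u * v * (u + v)| <= xi ->
  `|v' * w' * (v' + w') - v * w * (v + w)| <= xi ->
  `|u' * w' * (u' + 2 * v' + w') - u * w * (u + 2 * v + w)| <= xi ->
  1 / 2 <= u * v * (u + v) -> 1 / 2 <= v * w * (v + w) ->
  0 < xi -> xi <= 1 / 2 ->
  xi * (6 * C * c ^+ 2 + 4 * C ^+ 3) < k * c ^+ 2 ->
  c <= 1 -> 1 <= C ->
  u' < u + k.
Proof.
move=> c0 /andP[u0 uC] /andP[v0 vC] /andP[w0 wC] /andP[u0' uC'] /andP[v0' vC']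
  /andP[w0' wC'] ha hb hg a2 b2 xip xi2 hk c1 C1.
have xi0 := ltW xip; have Cp : 0 < C := lt_le_trans ltr01 C1.
rewrite ltNge; apply/negP => hu.
have up := lt_le_trans c0 u0; have vp := lt_le_trans c0 v0; have wp := lt_le_trans c0 w0.
have up' := lt_le_trans c0 u0'; have vp' := lt_le_trans c0 v0'.
have wp' := lt_le_trans c0 w0'; have Cge := ltW Cp; have cge := ltW c0.
have uge := ltW up; have vge := ltW vp; have wge := ltW wp.
have uge' := ltW up'; have vge' := ltW vp'; have wge' := ltW wp'.
have c2 : 0 < c ^+ 2 by rewrite exprn_gt0.
have C3 : 1 <= C ^+ 3 by apply: exprn_ege1.
have xik : 4 * xi < k * c ^+ 2.
  apply: le_lt_trans hk; rewrite mulrC ler_wpM2l //.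
  have : 0 <= 6 * C * c ^+ 2 by apply: mulr_ge0 (ltW c2); exact: mulr_ge0.
  by clear -C3; lra.
have k0 : 0 <= k.
  have : 0 < k * c ^+ 2 by apply: le_lt_trans xik; exact: mulr_ge0.
  by rewrite pmulr_lgt0 // => /ltW.
have uk0 : 0 <= u + k by exact: addr_ge0.
(* the first cross product forces v' < v *)
have vv : v' < v.
  rewrite ltNge; apply/negP => hv.
  have h1 : (u + k) * v <= u' * v' by exact: ler_pM.
  have h2 : (u + k) * v * (u + v) <= u' * v' * (u' + v').
    apply: ler_pM => //; [exact: mulr_ge0 | exact: addr_ge0|].
    by apply: lerD => //; apply: le_trans hu; rewrite lerDl.
  have h3 : c * c <= v * (u + v).
    by apply: ler_pM => //; apply: (le_trans u0); rewrite lerDl.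
  have h4 : k * (c * c) <= k * (v * (u + v)) by rewrite ler_wpM2l.
  have h5 : u' * v' * (u' + v') - u * v * (u + v) <= xi by apply: le_trans ha; exact: ler_norm.
  have h6 : (u + k) * v * (u + v) = u * v * (u + v) + k * (v * (u + v)) by ring.
  rewrite expr2 in xik; clear -xik h2 h4 h5 h6 xip; lra.
pose k2 := xi / c ^+ 2.
have k2E : k2 * c ^+ 2 = xi by rewrite /k2 divfK // gt_eqF.
have k20 : 0 <= k2 by rewrite /k2 divr_ge0 // ltW.
(* the second one forces w' to be at least w up to a small error *)
have ww : w - k2 <= w'.
  rewrite leNgt; apply/negP => hw.
  have h1 : v' * w' <= v * (w - k2) by apply: ler_pM => //; exact: ltW.
  have h2 : v' * w' * (v' + w') <= v * (w - k2) * (v + w).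
    apply: ler_pM => //; [exact: mulr_ge0 | exact: addr_ge0|].
    apply: lerD; [exact: ltW | apply: (le_trans (ltW hw)); by rewrite gerBl].
  have h3 : c * (2 * c) <= v * (v + w).
    apply: ler_pM => //; first exact: mulr_ge0.
    by rewrite mulr2n mulrDl mul1r lerD.
  have h4 : k2 * (c * (2 * c)) <= k2 * (v * (v + w)) by rewrite ler_wpM2l.
  have h5 : - xi <= v' * w' * (v' + w') - v * w * (v + w).
    by rewrite lerNl; apply: le_trans hb; rewrite -normrN; exact: ler_norm.
  have h6 : v * (w - k2) * (v + w) = v * w * (v + w) - k2 * (v * (v + w)) by ring.
  have h7 : k2 * (c * (2 * c)) = 2 * xi by rewrite -k2E; ring.
  by clear -h2 h4 h5 h6 h7 xip; lra.
set a := u * v * (u + v) in ha a2; set b := v * w * (v + w) in hb b2.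
set a' := u' * v' * (u' + v') in ha; set b' := v' * w' * (v' + w') in hb.
set g := u * w * _ in hg; set g' := u' * w' * _ in hg.
have gE : g * v = a * w + b * u by rewrite /g /a /b; ring.
have gE' : g' * v' = a' * w' + b' * u' by rewrite /g' /a' /b'; ring.
have g0' : 0 <= g'.
  rewrite /g'; apply: mulr_ge0; first exact: mulr_ge0.
  by apply: addr_ge0 => //; apply: addr_ge0 => //; exact: mulr_ge0.
have gg : g' * v' <= (g + xi) * v.
  apply: ler_pM => //; last exact: ltW.
  have : g' - g <= xi by apply: le_trans hg; exact: ler_norm.
  by clear; lra.
have aa : a - xi <= a'.
  have : - xi <= a' - a by rewrite lerNl; apply: le_trans ha; rewrite -normrN; exact: ler_norm.
  by clear; lra.
have bb : b - xi <= b'.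
  have : - xi <= b' - b by rewrite lerNl; apply: le_trans hb; rewrite -normrN; exact: ler_norm.
  by clear; lra.
have axi : 0 <= a - xi by clear -a2 xi2; lra.
have bxi : 0 <= b - xi by clear -b2 xi2; lra.
have h1 : (a - xi) * (w - k2) <= a' * w'.
  apply: (@le_trans _ _ ((a - xi) * w')); first by rewrite ler_wpM2l.
  by rewrite ler_wpM2r.
have h2 : (b - xi) * (u + k) <= b' * u' by exact: ler_pM.
have aC : a <= 2 * C ^+ 3.
  have -> : 2 * C ^+ 3 = C * C * (C + C) by ring.
  apply: ler_pM; [exact: mulr_ge0 | exact: addr_ge0 | exact: ler_pM | exact: lerD].
have h3 : b * k <= xi * v + a * k2 + xi * w + xi * (u + k).
  have p0 : 0 <= xi * k2 by rewrite mulr_ge0.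
  have e1 : (a - xi) * (w - k2) = a * w - a * k2 - xi * w + xi * k2 by ring.
  have e2 : (b - xi) * (u + k) = b * u + b * k - xi * (u + k) by ring.
  rewrite e1 in h1; rewrite e2 in h2.
  rewrite gE' mulrDl gE in gg; clear -h1 h2 gg p0; lra.
have h4 : k / 2 <= b * k.
  by rewrite [b * k]mulrC ler_wpM2l //; clear -b2; lra.
have h5 : a * k2 <= 2 * C ^+ 3 * k2 by rewrite ler_wpM2r.
have h6 : xi * v + xi * w + xi * (u + k) <= 3 * C * xi.
  rewrite -!mulrDr [3 * C * xi]mulrC ler_wpM2l //.
  by have := le_trans hu uC'; clear -vC wC; lra.
have h7 : k / 2 * c ^+ 2 <= (3 * C * xi + 2 * C ^+ 3 * k2) * c ^+ 2.
  by rewrite ler_wpM2r ?(ltW c2) //; clear -h3 h4 h5 h6; lra.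
have h8 : (3 * C * xi + 2 * C ^+ 3 * k2) * c ^+ 2 = 3 * C * xi * c ^+ 2 + 2 * C ^+ 3 * (k2 * c ^+ 2) by ring.
rewrite k2E in h8; clear -h7 h8 hk; lra.
Qed.

(** Pigeonhole: two elements of [G] in the same cell cannot both be the last one
    of that cell. *)
Lemma card_last_in_cell (T : finType) (M : nat) (G : {set 'I_M})
    (cell : 'I_M -> T) :
  (#|[set i in G | ~~ [exists j in G, (i < j)%N && (cell i == cell j)]]|
   <= #|T|)%N.
Proof.
set B := [set _ | _].
have cinj : {in B &, injective cell}.
  move=> i j; rewrite !inE => /andP[iG /existsPn hi] /andP[jG /existsPn hj] e.
  apply/val_inj; case: (ltngtP i j) => // ij.
    by have := hi j; rewrite jG e eqxx ij.
  by have := hj i; rewrite iG e eqxx ij.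
by have := max_card (mem (cell @: B)); rewrite card_in_imset.
Qed.

Lemma sum_shift3 (R : realFieldType) (T : nat -> R) (m : nat) :
  \sum_(i < m) (T i.+3 - T i) = T m + T m.+1 + T m.+2 - (T 0%N + T 1%N + T 2%N).
Proof.
elim: m => [|m IH]; first by rewrite big_ord0 subrr.
by rewrite big_ord_recr /= IH; ring.
Qed.

Lemma markov_card (R : realFieldType) (I : finType) (f : I -> R) (t s : R) :
  (forall i, 0 <= f i) -> \sum_i f i <= s ->
  t * #|[set i | t < f i]|%:R <= s.
Proof.
move=> f0 hs; apply: le_trans hs.
rewrite (bigID (mem [set i | t < f i])) /= ler_wpDr ?sumr_ge0 //.
rewrite mulr_natr -sumr_const; apply: ler_sum => i; rewrite inE => /ltW //.
Qed.


Lemma truncn_eq_close (R : archiRealFieldType) (x y : R) :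
  0 <= x -> 0 <= y -> Num.truncn x = Num.truncn y -> y - x <= 1.
Proof.
move=> x0 y0 e; have /andP[h1 _] := truncn_itv x0.
have /andP[_] := truncn_itv y0; rewrite -e mulrS => h2; lra.
Qed.

Lemma inord_absz_inj (Z : nat) (x y : int) :
  0 <= x <= Z%:Z -> 0 <= y <= Z%:Z ->
  (inord (absz x) : 'I_Z.+1) = inord (absz y) -> x = y.
Proof.
move=> /andP[x0 xZ] /andP[y0 yZ] /(congr1 val); rewrite /= !inordK; lia.
Qed.

(** [i] and [j] are partners if the triples of edges starting there have the same
    cross products and the parameters [T i], [T j] are within [c].  The cells of
    the pigeonhole consist of the three cross products and of an interval of
    length [c] for the parameter; there are at most [M / 8] of them, since the
    total parameter length is at most [C3 * M].  The three cross products are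
    bounded by [Z] unless [T i.+3 - T i] exceeds [C5], which by Markov's
    inequality happens for at most [M / 8] indices. *)
Lemma many_partners (R : archiRealFieldType) (C3 C5 c : R) (Z M : nat)
    (cr : nat -> nat -> int) (T : nat -> R) (good : nat -> bool) :
  1 <= C3 -> 24 * C3 <= C5 -> 16 * C3 * (Z.+1 ^ 3)%:R <= c ->
  (16 * Z.+1 ^ 3 <= M)%N ->
  (forall i, (i < M)%N -> T i <= T i.+1) -> T 0%N = 0 -> T M <= C3 * M%:R ->
  (forall i, (i.+2 < M)%N -> T i.+3 - T i <= C5 ->
    [/\ 0 <= cr i i.+1 <= Z%:Z, 0 <= cr i.+1 i.+2 <= Z%:Z
     & 0 <= cr i i.+2 <= Z%:Z]) ->
  (forall i, good i = (i.+2 < M)%N && (T i.+3 - T i <= C5)) ->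
  M%:R / 2 <= #|[set i : 'I_M | good i && [exists j : 'I_M,
    [&& good j, (i < j)%N, T j - T i <= c, cr i i.+1 == cr j j.+1,
        cr i.+1 i.+2 == cr j.+1 j.+2 & cr i i.+2 == cr j j.+2]]]|%:R :> R.
Proof.
move=> C31 hC5 hc hM.
have M2 : (2 <= M)%N.
  by apply: leq_trans hM; apply: (@leq_trans 16) => //; rewrite leq_pmulr // expn_gt0.
case: M M2 hM => [|[|m]] // _; set M := m.+2 => hM Tinc T0 TM hcr goodE.
have Tle i j : (i <= j <= M)%N -> T i <= T j.
  elim: j => [|j IH]; first by case/andP; rewrite leqn0 => /eqP ->.
  case/andP; rewrite leq_eqVlt => /orP[/eqP -> //|]; rewrite ltnS => ij jM.
  by apply: (le_trans (IH _)); [rewrite ij ltnW | exact: Tinc].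
have Z0 : 1 <= (Z.+1 ^ 3)%:R :> R by rewrite ler1n expn_gt0.
have c0 : 0 < c.
  apply: lt_le_trans hc; rewrite mulr_gt0 ?mulr_gt0 //; lra.
have Tge0 i : (i <= M)%N -> 0 <= T i by move=> iM; rewrite -T0 Tle.
pose Q := Num.truncn (T M / c).
pose cell (i : 'I_M) : 'I_Z.+1 * 'I_Z.+1 * 'I_Z.+1 * 'I_Q.+1 :=
  (inord (absz (cr i i.+1)), inord (absz (cr i.+1 i.+2)),
   inord (absz (cr i i.+2)), inord (Num.truncn (T i / c))).
pose G := [set i : 'I_M | good i].
have hB := card_last_in_cell G cell; set B := [set _ | _] in hB.
set A := [set _ | _].
pose N := [set i : 'I_M | ~~ (i.+2 < M)%N].
pose H := [set i : 'I_M | (i.+2 < M)%N && (C5 < T i.+3 - T i)].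
have cover i : i \in A :|: (B :|: (N :|: H)).
  rewrite !inE.
  case: (boolP (i.+2 < M)%N) => iM; last by rewrite ?orbT.
  case: (lerP (T i.+3 - T i) C5) => hi; last by rewrite ?orbT.
  have gi : good i by rewrite goodE iM hi.
  rewrite gi /=; case: existsP => [//|h].
  apply/orP; right; apply/orP; left; apply/existsPn => j; apply/negP.
  move=> /andP[]; rewrite inE => gj /andP[ij /eqP[]].
  have := gj; rewrite goodE => /andP[jM hj].
  have [a1 a2 a3] := hcr _ iM hi; have [b1 b2 b3] := hcr _ jM hj.
  have TQ (k : 'I_M) : (Num.truncn (T k / c) < Q.+1)%N.
    rewrite ltnS; apply: le_truncn; rewrite ler_pM2r ?invr_gt0 //.
    by rewrite Tle // leqnn ltnW.
  move=> /(inord_absz_inj a1 b1) e1 /(inord_absz_inj a2 b2) e2.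
  move=> /(inord_absz_inj a3 b3) e3 /(congr1 val); rewrite /= !inordK // => e4.
  apply: h; exists j; rewrite gj ij e1 e2 e3 !eqxx !andbT /=.
  have := truncn_eq_close _ _ e4; rewrite -mulrBl ler_pdivrMr // mul1r.
  by apply; rewrite divr_ge0 ?(ltW c0) // Tge0 // ltnW.
have hcard : (M <= #|A :|: (B :|: (N :|: H))|)%N.
  by rewrite -[leqLHS]card_ord; apply: subset_leq_card; apply/fintype.subsetP.
have hU : (M <= #|A| + (#|B| + (#|N| + #|H|)))%N.
  apply: (leq_trans hcard); rewrite !cardsU.
  apply: (leq_trans (leq_subr _ _)); rewrite leq_add2l.
  apply: (leq_trans (leq_subr _ _)); rewrite leq_add2l.
  exact: leq_subr.
have hN : (#|N| <= 2)%N.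
  have ninj : {in N &, injective (fun i : 'I_M => (inord (i - m) : 'I_2))}.
    move=> i j; rewrite !inE -!leqNgt !ltnS => hi hj /(congr1 val) /=.
    have hlt (k : 'I_M) : (m <= k)%N -> (k - m < 2)%N.
      by move=> mk; rewrite ltn_subLR // addn2 ltn_ord.
    rewrite !inordK ?hlt // => e.
    by apply/val_inj => /=; rewrite -(subnK hi) e subnK.
  have := max_card (mem ((fun i : 'I_M => (inord (i - m) : 'I_2)) @: N)).
  by rewrite card_in_imset // card_ord.
have M16 : 16 * (Z.+1 ^ 3)%:R <= M%:R :> R by rewrite -natrM ler_nat.
have hH : #|H|%:R <= M%:R / 8 :> R.
  pose H' := [set i : 'I_m | C5 < T i.+3 - T i].
  have mM : (m <= M)%N by rewrite /M leqW // leqW.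
  have HH : (#|H| <= #|H'|)%N.
    have -> : H = [set widen_ord mM i | i in H'].
      apply/setP => i; rewrite inE; apply/andP/imsetP => [[iM hi]|[j]].
        by exists (Ordinal (iM : (i < m)%N)); [rewrite inE | apply: val_inj].
      by rewrite inE => hj -> /=; split => //; exact: ltn_ord.
    exact: leq_imset_card.
  have f0 (i : 'I_m) : 0 <= T i.+3 - T i.
    rewrite subr_ge0 Tle // (leq_trans (leqnSn i)) /=; last by rewrite ltnW // ltnW.
    by rewrite /M !ltnS.
  have hsum : \sum_(i < m) (T i.+3 - T i) <= 3 * T M.
    rewrite sum_shift3.
    have t1 : T m <= T M by rewrite Tle // mM leqnn.
    have t2 : T m.+1 <= T M by rewrite Tle // /M leqnSn leqnn.
    have t3 : T m.+2 <= T M by [].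
    have s1 := Tge0 0%N isT; have s2 := Tge0 1%N isT; have s3 := Tge0 2%N isT.
    by clear -t1 t2 t3 s1 s2 s3; lra.
  have := markov_card C5 f0 hsum.
  rewrite -/H' => hm.
  have h1 : 24 * C3 * #|H|%:R <= C5 * #|H'|%:R :> R.
    by apply: ler_pM => //; rewrite ?ler_nat //; lra.
  have h2 : 24 * C3 * #|H|%:R <= 24 * C3 * (M%:R / 8) by lra.
  by move: h2; rewrite ler_pM2l //; lra.
have hB' : #|B|%:R <= M%:R / 8 :> R.
  have h1 : #|B|%:R <= ((Z.+1 ^ 3) * Q.+1)%:R :> R.
    by rewrite ler_nat; apply: (leq_trans hB); rewrite !card_prod !card_ord !expnS expn0 muln1 !mulnA.
  apply: (le_trans h1); rewrite natrM [Q.+1%:R]mulrS mulrDr mulr1.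
  have h2 : Q%:R <= T M / c by rewrite truncn_le divr_ge0 ?(ltW c0) // Tge0.
  have h3 : (Z.+1 ^ 3)%:R * Q%:R <= M%:R / 16 :> R.
    apply: (@le_trans _ _ ((Z.+1 ^ 3)%:R * (T M / c))); first by rewrite ler_wpM2l // ltW // ltr0n expn_gt0.
    rewrite mulrA ler_pdivrMr //.
    apply: (@le_trans _ _ (M%:R / 16 * (16 * C3 * (Z.+1 ^ 3)%:R))); last first.
      by rewrite ler_wpM2l // divr_ge0.
    apply: (@le_trans _ _ ((Z.+1 ^ 3)%:R * (C3 * M%:R))).
      by rewrite ler_wpM2l //; lra.
    by rewrite le_eqVlt; apply/orP; left; apply/eqP; field.
  lra.
have : M%:R <= #|A|%:R + (#|B|%:R + (#|N|%:R + #|H|%:R)) :> R.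
  by rewrite -!natrD ler_nat.
have : #|N|%:R <= 2 :> R by rewrite (ler_nat _ _ 2).
move=> n1 n2; lra.
Qed.

Lemma norm_le_hi (R : realType) (x z : R) : `|x| <= z -> x <= z.
Proof. by apply: le_trans; exact: ler_norm. Qed.

Lemma norm_le_lo (R : realType) (x z : R) : `|x| <= z -> - z <= x.
Proof. by rewrite lerNl => h; apply: le_trans h; rewrite -normrN ler_norm. Qed.

(** An edge of a pair of bounded total length cannot be short, because the cross
    product of the pair is not small. *)
Lemma edge_length_lb (R : realType) (C u v : R) :
  0 < C -> 0 <= u -> 0 <= v -> u + v <= C ->
  1 / 2 <= u * v * (u + v) ->
  (2 * C ^+ 2)^-1 <= u /\ (2 * C ^+ 2)^-1 <= v.
Proof.
move=> C0 u0 v0 uvC h; have C2 : 0 < 2 * C ^+ 2 by rewrite mulr_gt0 ?exprn_gt0.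
have uC : u <= C by lra. have vC : v <= C by lra.
have s0 : 0 <= u + v by rewrite addr_ge0.
have h1 : u * v * (u + v) <= u * C ^+ 2.
  by rewrite -mulrA expr2 ler_wpM2l // ler_pM.
have h2 : u * v * (u + v) <= v * C ^+ 2.
  by rewrite [u * v]mulrC -mulrA expr2 ler_wpM2l // ler_pM.
by split; rewrite -[_^-1]mul1r ler_pdivrMr // mulrCA; lra.
Qed.

Lemma edge_pair_lb (R : realType) (u v : R) :
  0 <= u -> 0 <= v -> 1 / 2 <= u * v * (u + v) -> 1 <= u + v.
Proof.
move=> u0 v0 h; rewrite leNgt; apply/negP => s1.
have s0 : 0 <= u + v by rewrite addr_ge0.
have uv : u * v <= 1 / 4.
  have : 0 <= (u - v) ^+ 2 by rewrite sqr_ge0.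
  have : (u + v) * (u + v) <= 1 by rewrite mulr_ile1 // ltW.
  rewrite expr2; lra.
have : u * v * (u + v) <= 1 / 4 * 1 by apply: ler_pM; rewrite ?mulr_ge0 // ltW.
lra.
Qed.

Lemma sum_pairs (R : realType) (T : nat -> R) (m : nat) :
  \sum_(i < m) (T i.+2 - T i) = T m + T m.+1 - (T 0%N + T 1%N).
Proof.
elim: m => [|m IH]; first by rewrite big_ord0 subrr.
by rewrite big_ord_recr /= IH; ring.
Qed.

Definition gap (R : realType) (T : nat -> R) (i : nat) : R := T i.+1 - T i.

(** [cr i j] is the cross product of the edges [i] and [j] of a chain of integer
    points.  The product of gaps is the value that it would have if the chain were
    inscribed in the parabola of unit affine speed at the parameters [T]. *)
Definition near_parabolic (R : realType) (M : nat) (T : nat -> R)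
    (cr : nat -> nat -> int) (zeta : R) :=
  [/\ T 0%N = 0, (forall i, (i < M)%N -> T i <= T i.+1) &
   forall i j, (i < j)%N -> (j < M)%N -> 1 <= cr i j /\
   `|(cr i j)%:~R - (T i.+1 - T i) * (T j.+1 - T j) * (T j + T j.+1 - T i - T i.+1)|
     <= zeta].

Section NearParabolic.
Variables (R : realType) (M : nat) (T : nat -> R).
Variables (cr : nat -> nat -> int) (zeta : R).
Hypothesis hp : near_parabolic M T cr zeta.
Hypothesis z2 : zeta <= 1 / 2.

Local Notation H := (gap T).

Lemma npar_H_ge0 i : (i < M)%N -> 0 <= H i.
Proof. by case: hp => _ h _ /h; rewrite subr_ge0. Qed.

Lemma npar_le i j : (i <= j <= M)%N -> T i <= T j.
Proof.
case: hp => _ h _.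
elim: j => [|j IH]; first by case/andP; rewrite leqn0 => /eqP ->.
case/andP; rewrite leq_eqVlt => /orP[/eqP -> //|]; rewrite ltnS => ij jM.
by apply: (le_trans (IH _)); [rewrite ij ltnW | exact: h].
Qed.

Lemma npar_next i : (i.+1 < M)%N ->
  `|(cr i i.+1)%:~R - H i * H i.+1 * (H i + H i.+1)| <= zeta /\
  1 / 2 <= H i * H i.+1 * (H i + H i.+1).
Proof.
move=> iM; case: hp => _ _ /(_ i i.+1 (ltnSn i) iM)[c1].
have -> : T i.+1 + T i.+2 - T i - T i.+1 = H i + H i.+1 by rewrite /gap; ring.
rewrite -/(H i) -/(H i.+1) => hz; split => //.
have c1' : 1 <= (cr i i.+1)%:~R :> R by rewrite (ler_int R 1).
have h1 := norm_le_hi hz; have := z2; lra.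
Qed.

(** Each pair of consecutive edges takes a parameter length of at least 1. *)
Lemma npar_length : (2 <= M)%N -> M%:R / 4 <= T M.
Proof.
move=> M2; have Tge0 i : (i <= M)%N -> 0 <= T i.
  by move=> iM; case: hp => T0 _ _; rewrite -T0 npar_le.
case: M M2 Tge0 npar_next npar_H_ge0 npar_le => [|m] // m1 Tge0 hn hH hle.
have hs : \sum_(i < m) (1 : R) <= \sum_(i < m) (T i.+2 - T i).
  apply: ler_sum => i _.
  have im : (i.+1 < m.+1)%N by rewrite ltnS.
  have [_ h] := hn _ im; have := edge_pair_lb (hH _ (ltnW im)) (hH _ im) h.
  by rewrite /gap; lra.
rewrite sumr_const card_ord sum_pairs in hs.
have t1 := hle m m.+1; rewrite leqnSn leqnn in t1; have {t1} t1 := t1 isT.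
have t2 := Tge0 0%N isT; have t3 := Tge0 1%N isT.
have m1' : 1 <= m%:R :> R by rewrite ler1n.
by rewrite mulrS; lra.
Qed.

Lemma npar_good C i : (i.+2 < M)%N -> T i.+3 - T i <= C ->
  let c := (2 * C ^+ 2)^-1 in
  [/\ c <= H i <= C, c <= H i.+1 <= C, c <= H i.+2 <= C & 0 < C].
Proof.
move=> iM hC c.
have [_ h1] := npar_next (ltnW iM); have [_ h2] := npar_next iM.
have H0 := npar_H_ge0 (ltnW (ltnW iM)); have H1 := npar_H_ge0 (ltnW iM).
have H2 := npar_H_ge0 iM.
have hs : H i + H i.+1 + H i.+2 <= C by rewrite /gap; lra.
have C0 : 0 < C by have := edge_pair_lb H0 H1 h1; lra.
have l1 : H i + H i.+1 <= C by lra.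
have l2 : H i.+1 + H i.+2 <= C by lra.
have [c1 c2] := edge_length_lb C0 H0 H1 l1 h1.
have [_ c3] := edge_length_lb C0 H1 H2 l2 h2.
by split; rewrite ?c1 ?c2 ?c3 //=; lra.
Qed.

Lemma npar_skip i : (i.+2 < M)%N ->
  `|(cr i i.+2)%:~R - H i * H i.+2 * (H i + 2 * H i.+1 + H i.+2)| <= zeta.
Proof.
move=> iM; case: hp => _ _ /(_ i i.+2 (ltnW (ltnSn i.+1)) iM)[_].
have -> : T i.+2 + T i.+3 - T i - T i.+1 = H i + 2 * H i.+1 + H i.+2.
  by rewrite /gap; ring.
by rewrite -/(H i) -/(H i.+2).
Qed.

Lemma npar_cross_le (C D : R) i j : (i < j)%N -> (j < M)%N ->
  H i <= C -> H j <= C -> T j + T j.+1 - T i - T i.+1 <= D ->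
  (cr i j)%:~R <= C * C * D + 1.
Proof.
move=> ij jM hi hj hD; case: hp => _ _ /(_ i j ij jM)[_ hz].
have H0 := npar_H_ge0 (ltn_trans ij jM); have H1 := npar_H_ge0 jM.
have t1 : T i <= T j by rewrite npar_le // (ltnW ij) (ltnW jM).
have t2 : T i.+1 <= T j.+1 by rewrite npar_le // ltnS (ltnW ij) jM.
have h1 : H i * H j * (T j + T j.+1 - T i - T i.+1) <= C * C * D.
  have s0 : 0 <= T j + T j.+1 - T i - T i.+1 by lra.
  by apply: ler_pM => //; [exact: mulr_ge0 | exact: ler_pM].
have := norm_le_hi hz; have := z2; rewrite -/(H i) -/(H j); lra.
Qed.

(** Partners have nearly equal gaps, by stability of the edge lengths under
    errors in the cross products. *)
Lemma npar_same (C k : R) i j :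
  (i.+2 < M)%N -> (j.+2 < M)%N -> T i.+3 - T i <= C -> T j.+3 - T j <= C ->
  cr i i.+1 = cr j j.+1 -> cr i.+1 i.+2 = cr j.+1 j.+2 ->
  cr i i.+2 = cr j j.+2 ->
  1 <= C -> 0 < zeta -> zeta <= 1 / 4 ->
  2 * zeta * (6 * C * (2 * C ^+ 2)^-1 ^+ 2 + 4 * C ^+ 3) < k * (2 * C ^+ 2)^-1 ^+ 2 ->
  `|H i - H j| <= k.
Proof.
move=> iM jM hi hj e1 e2 e3 C1 z0 z4 hk.
have [i1 i2 i3 C0] := npar_good iM hi; have [j1 j2 j3 _] := npar_good jM hj.
have [a1 b1] := npar_next (ltnW iM); have [a2 b2] := npar_next iM.
have a3 := npar_skip iM.
have [a1' b1'] := npar_next (ltnW jM); have [a2' b2'] := npar_next jM.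
have a3' := npar_skip jM.
rewrite -e1 in a1'; rewrite -e2 in a2'; rewrite -e3 in a3'.
have tri (x y z : R) : `|z - x| <= zeta -> `|z - y| <= zeta -> `|x - y| <= 2 * zeta.
  move=> h1 h2; rewrite (_ : x - y = (z - y) - (z - x)); last by ring.
  apply: (le_trans (ler_normB _ _)); lra.
have c0 : 0 < (2 * C ^+ 2)^-1 by rewrite invr_gt0 mulr_gt0 ?exprn_gt0.
have c1 : (2 * C ^+ 2)^-1 <= 1.
  rewrite invf_le1 ?mulr_gt0 ?exprn_gt0 //.
  have : 1 <= C ^+ 2 by apply: exprn_ege1. lra.
have z20 : 0 < 2 * zeta by rewrite mulr_gt0.
have z21 : 2 * zeta <= 1 / 2 by lra.
have s1 : H j < H i + k := @edge_lengths_stable_lt R C _ k (2 * zeta) (H i) (H i.+1) (H i.+2)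
  (H j) (H j.+1) (H j.+2) c0 i1 i2 i3 j1 j2 j3 (tri _ _ _ a1' a1) (tri _ _ _ a2' a2)
  (tri _ _ _ a3' a3) b1 b2 z20 z21 hk c1 C1.
have s2 : H i < H j + k := @edge_lengths_stable_lt R C _ k (2 * zeta) (H j) (H j.+1) (H j.+2)
  (H i) (H i.+1) (H i.+2) c0 j1 j2 j3 i1 i2 i3 (tri _ _ _ a1 a1') (tri _ _ _ a2 a2')
  (tri _ _ _ a3 a3') b1' b2' z20 z21 hk c1 C1.
by rewrite ler_norml; apply/andP; split; clear -s1 s2; lra.
Qed.

End NearParabolic.

Lemma norm_lincomb (R : realType) (a b p q A B Lam : R) :
  `|a| <= A -> `|b| <= B -> `|p| <= Lam -> `|q| <= Lam ->
  `|a * p + b * q| <= (A + B) * Lam.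
Proof.
move=> ha hb hp hq; apply: (le_trans (ler_normD _ _)); rewrite !normrM mulrDl.
by apply: lerD; apply: ler_pM.
Qed.

(** The vertices of the window are [g i *: p + tau i ^+ 2 *: q] up to a
    translation; for [g = 2 * tau] this is a parabola with axis [q], and [L] is its
    affine length.  The cross product of two edges is [p2 * q1 - p1 * q2 = L^3 / 2]
    times a polynomial in [tau], so that an error [delta] in [g] costs at most
    [2 * L^3 * delta]. *)
Lemma window_near_parabolic (R : realType) (M : nat) (C3 delta zeta : R)
  (V1 V2 : nat -> int) (tau g : nat -> R) (p1 p2 q1 q2 L : R) :
  (forall i, (i < M)%N -> tau i <= tau i.+1) -> tau 0%N = 0 -> tau M = 1 ->
  (forall i, (i <= M)%N -> `|g i - 2 * tau i| <= delta) ->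
  0 <= L -> L ^+ 3 = 2 * (p2 * q1 - p1 * q2) -> L <= C3 * M%:R ->
  (forall i, (i < M)%N ->
    (V1 i)%:~R = (g i.+1 - g i) * p1 + (tau i.+1 ^+ 2 - tau i ^+ 2) * q1 /\
    (V2 i)%:~R = (g i.+1 - g i) * p2 + (tau i.+1 ^+ 2 - tau i ^+ 2) * q2) ->
  (forall i j, (i < j)%N -> (j < M)%N -> 1 <= V2 i * V1 j - V1 i * V2 j) ->
  2 * (C3 * M%:R) ^+ 3 * delta <= zeta ->
  near_parabolic M (fun i => L * tau i) (fun i j => V2 i * V1 j - V1 i * V2 j) zeta.
Proof.
move=> tinc t0 t1 hg L0 LE LM hV hcr hz.
have tle i j : (i <= j <= M)%N -> tau i <= tau j.
  elim: j => [|j IH]; first by case/andP; rewrite leqn0 => /eqP ->.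
  case/andP; rewrite leq_eqVlt => /orP[/eqP -> //|]; rewrite ltnS => ij jM.
  by apply: (le_trans (IH _)); [rewrite ij ltnW | exact: tinc].
have tge0 i : (i <= M)%N -> 0 <= tau i by move=> iM; rewrite -t0 tle.
have tle1 i : (i <= M)%N -> tau i <= 1 by move=> iM; rewrite -t1 tle // iM leqnn.
split; first by rewrite t0 mulr0.
  by move=> i iM; rewrite ler_wpM2l ?tinc.
move=> i j ij jM; split; first exact: hcr.
have iM := ltn_trans ij jM.
have [v1i v2i] := hV i iM; have [v1j v2j] := hV j jM.
rewrite rmorphB !rmorphM /= v1i v2i v1j v2j.
set ai := g i.+1 - g i; set aj := g j.+1 - g j.
set bi := _ - tau i ^+ 2; set bj := _ - tau j ^+ 2.
have b01 k : (k < M)%N -> `|tau k.+1 ^+ 2 - tau k ^+ 2| <= 1.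
  move=> kM; have h0 := tge0 k (ltnW kM); have h1 := tle1 k.+1 kM.
  have h2 := tinc k kM.
  have h3 : tau k ^+ 2 <= tau k.+1 ^+ 2.
    by rewrite ler_pXn2r // nnegrE // (le_trans h0).
  have h4 : tau k.+1 ^+ 2 <= 1 by apply: exprn_ile1 => //; apply: le_trans h2.
  rewrite ger0_norm ?subr_ge0 //; have := sqr_ge0 (tau k).
  by clear -h4; lra.
have aerr k : (k < M)%N -> `|g k.+1 - g k - 2 * (tau k.+1 - tau k)| <= 2 * delta.
  move=> kM; have h1 := hg k (ltnW kM); have h2 := hg k.+1 kM.
  rewrite (_ : _ - _ = (g k.+1 - 2 * tau k.+1) - (g k - 2 * tau k)); last by ring.
  by apply: (le_trans (ler_normB _ _)); clear -h1 h2; lra.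
have -> : (ai * p2 + bi * q2) * (aj * p1 + bj * q1) -
   (ai * p1 + bi * q1) * (aj * p2 + bj * q2) -
   (L * tau i.+1 - L * tau i) * (L * tau j.+1 - L * tau j) *
   (L * tau j + L * tau j.+1 - L * tau i - L * tau i.+1) =
   L ^+ 3 / 2 * ((ai - 2 * (tau i.+1 - tau i)) * bj
      + (- (aj - 2 * (tau j.+1 - tau j))) * bi).
  rewrite (_ : L ^+ 3 / 2 = p2 * q1 - p1 * q2); last by rewrite LE; field.
  have -> : (L * tau i.+1 - L * tau i) * (L * tau j.+1 - L * tau j) *
   (L * tau j + L * tau j.+1 - L * tau i - L * tau i.+1) =
   L ^+ 3 * ((tau i.+1 - tau i) * (tau j.+1 - tau j) * (tau j + tau j.+1 - tau i - tau i.+1)).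
    by ring.
  by rewrite LE /bi /bj; ring.
rewrite normrM ger0_norm ?divr_ge0 ?exprn_ge0 //.
apply: (le_trans _ hz).
have h := @norm_lincomb R (ai - 2 * (tau i.+1 - tau i)) (- (aj - 2 * (tau j.+1 - tau j))) bj bi (2 * delta) (2 * delta) 1.
rewrite normrN in h.
have {}h := h (aerr i iM) (aerr j jM) (b01 j jM) (b01 i iM).
apply: (@le_trans _ _ ((C3 * M%:R) ^+ 3 / 2 * ((2 * delta + 2 * delta) * 1))).
  apply: ler_pM => //; first by rewrite divr_ge0 // exprn_ge0.
  rewrite ler_wpM2r ?invr_ge0 //.
  by apply: lerXn2r => //; rewrite nnegrE // (le_trans L0).
by rewrite le_eqVlt; apply/orP; left; apply/eqP; field.
Qed.

(** In the applications [r] is much smaller than [K], so that [(w1, w2)] is short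
    compared to [(v1, v2)]. *)
Definition companion (R : realType) (D r K : R) (v1 v2 : int) : Prop :=
  exists w1 w2 : int, [/\ 0 < `|v1 * w2 - v2 * w1|,
    (`|v1 * w2 - v2 * w1|)%:~R <= D,
    (`|w1|)%:~R <= r /\ (`|w2|)%:~R <= r & (`|v1|)%:~R <= K /\ (`|v2|)%:~R <= K].

(** The property required of [M] and [delta]: in every window of [M] edges that is
    [delta]-close to a parabola, half of the edges have companions.  [Lam] is the
    size of the window, hence the edges have size of order [Lam / M], but the
    companions only [Lam / M ^+ 2]. *)
Definition window_rich (R : realType) (C3 C D : R) (M : nat) (delta : R) : Prop :=
  forall (V1 V2 : nat -> int) (tau g : nat -> R) (p1 p2 q1 q2 L Lam : R),
  (forall i, (i < M)%N -> tau i <= tau i.+1) -> tau 0%N = 0 -> tau M = 1 ->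
  (forall i, (i <= M)%N -> `|g i - 2 * tau i| <= delta) ->
  0 <= L -> L ^+ 3 = 2 * (p2 * q1 - p1 * q2) -> L <= C3 * M%:R ->
  [/\ `|p1| <= Lam, `|p2| <= Lam, `|q1| <= Lam & `|q2| <= Lam] ->
  (forall i, (i < M)%N ->
    (V1 i)%:~R = (g i.+1 - g i) * p1 + (tau i.+1 ^+ 2 - tau i ^+ 2) * q1 /\
    (V2 i)%:~R = (g i.+1 - g i) * p2 + (tau i.+1 ^+ 2 - tau i ^+ 2) * q2) ->
  (forall i j, (i < j)%N -> (j < M)%N -> 1 <= V2 i * V1 j - V1 i * V2 j) ->
  M%:R / 2 <= #|[set i : 'I_M | `[< companion D (C * Lam / M%:R ^+ 2)
     (C * Lam / M%:R) (V1 i) (V2 i) >]]|%:R :> R.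

(** The companion of the edge [i] is [V j - V i] for a partner [j] of [i].  On the
    parabola an edge is the product of a gap [O(1 / M)] and the velocity at the
    middle of the edge, and the velocity changes by [O(Lam / M)] between partners;
    the differences of the gaps and the deviation from the parabola are made
    negligible by the choice of [zeta] and [delta] in terms of [M].  The constants
    [C] and [D] depend on [C3] alone. *)
Lemma parabolic_window (R : realType) (C3 : R) : 1 <= C3 ->
  exists C D : R, [/\ 1 <= C, 1 <= D & exists M0 : nat, (0 < M0)%N /\
  forall M, (M0 <= M)%N -> exists2 delta : R, 0 < delta &
  window_rich C3 C D M delta].
Proof.
move=> C31.
pose C5 : R := 24 * C3.
have C51 : 1 <= C5 by rewrite /C5; lra.
have C5p : 0 < C5 by apply: lt_le_trans C51.
pose Z := (Num.truncn (2 * C5 ^+ 3 + 1)).+1.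
pose c : R := 16 * C3 * (Z.+1 ^ 3)%:R.
have c0 : 0 < c.
  by rewrite /c !mulr_gt0 // ?ltr0n ?expn_gt0 //; apply: lt_le_trans C31.
pose E := 2 * C3 + C5 * (2 * c + C5).
have cC : 1 <= 2 * c + C5 by lra.
have E1 : 1 <= E.
  have : 0 <= C5 * (2 * c + C5) by rewrite mulr_ge0; lra.
  by rewrite /E; lra.
exists (16 * E + 16 * C5 + 10), (C5 * C5 * (2 * c + C5) + 1); split.
- by lra.
- by rewrite lerDr mulr_ge0 // ?mulr_ge0 //; lra.
exists (16 * Z.+1 ^ 3)%N; split; first by rewrite muln_gt0 expn_gt0.
move=> M hM.
have M2 : (2 <= M)%N.
  by apply: leq_trans hM; apply: (@leq_trans 16) => //; rewrite leq_pmulr // expn_gt0.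
have M1 : 1 <= M%:R :> R by rewrite ler1n; exact: ltnW.
have Mp : 0 < M%:R :> R by apply: lt_le_trans M1.
pose c5 := (2 * C5 ^+ 2)^-1.
have c50 : 0 < c5 by rewrite invr_gt0 mulr_gt0 // exprn_gt0.
pose G := 6 * C5 * c5 ^+ 2 + 4 * C5 ^+ 3.
have G0 : 0 < G.
  have c52 : 0 < c5 ^+ 2 by rewrite exprn_gt0.
  have C53 : 0 < C5 ^+ 3 by rewrite exprn_gt0.
  have h6 : 0 < 6 * C5 by rewrite mulr_gt0.
  by apply: addr_gt0; apply: mulr_gt0.
have u0 : 0 < 1 / M%:R * c5 ^+ 2 by apply: mulr_gt0; [exact: divr_gt0 | exact: exprn_gt0].
have G40 : 0 < 4 * G by exact: mulr_gt0.
pose zeta := Num.min (1 / 4) (1 / M%:R * c5 ^+ 2 / (4 * G)).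
have z0 : 0 < zeta.
  by rewrite lt_min; apply/andP; split; exact: divr_gt0.
have z4 : zeta <= 1 / 4 by rewrite ge_min lexx.
have zG : 2 * zeta * G < 1 / M%:R * c5 ^+ 2.
  have h : zeta <= 1 / M%:R * c5 ^+ 2 / (4 * G) by rewrite ge_min lexx orbT.
  have h2 : zeta * (4 * G) <= 1 / M%:R * c5 ^+ 2 by rewrite -ler_pdivlMr.
  have h3 : 0 < zeta * G by rewrite mulr_gt0.
  clear -h2 h3; lra.
pose CM := 2 * (C3 * M%:R) ^+ 3.
have CM0 : 0 < CM.
  by rewrite mulr_gt0 // exprn_gt0 // mulr_gt0 //; apply: lt_le_trans C31.
pose delta := Num.min (1 / (4 * M%:R ^+ 2)) (zeta / CM).
have d0 : 0 < delta.
  rewrite lt_min; apply/andP; split; apply: divr_gt0 => //.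
  by apply: mulr_gt0 => //; apply: exprn_gt0.
exists delta => // V1 V2 tau g p1 p2 q1 q2 L Lam tinc t0 t1 hg L0 LE LM [hp1 hp2 hq1 hq2] hV hcr.
have hz : CM * delta <= zeta.
  by rewrite mulrC -ler_pdivlMr // ge_min lexx orbT.
have np := window_near_parabolic tinc t0 t1 hg L0 LE LM hV hcr hz.
set T := (fun i => L * tau i) in np; set cr := (fun i j => _) in np.
have z2 : zeta <= 1 / 2 by clear -z4; lra.
have TM : T M = L by rewrite /T t1 mulr1.
have LM4 : M%:R / 4 <= L by rewrite -TM; exact: (npar_length np z2 M2).
have Lp : 0 < L by apply: lt_le_trans LM4; rewrite divr_gt0.
pose good i := (i.+2 < M)%N && (T i.+3 - T i <= C5).
have bounds i : good i -> [/\ 0 <= gap T i <= C5, 0 <= gap T i.+1 <= C5 & 0 <= gap T i.+2 <= C5].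
  move=> /andP[iM hi]; have [/andP[a1 a2] /andP[a3 a4] /andP[a5 a6] _] := npar_good np z2 iM hi.
  by split; apply/andP; split => //; apply: ltW; apply: lt_le_trans c50 _.
have hcell i : (i.+2 < M)%N -> T i.+3 - T i <= C5 ->
  [/\ 0 <= cr i i.+1 <= Z%:Z, 0 <= cr i.+1 i.+2 <= Z%:Z & 0 <= cr i i.+2 <= Z%:Z].
  move=> iM hi; have gi : good i by apply/andP.
  have [/andP[a1 a2] /andP[a3 a4] /andP[a5 a6]] := bounds i gi.
  have key a b : (a < b)%N -> (b < M)%N -> gap T a <= C5 -> gap T b <= C5 ->
     T b + T b.+1 - T a - T a.+1 <= 2 * C5 -> 0 <= cr a b <= Z%:Z.
    move=> ab bM ha hb hd; apply/andP; split.
      by apply: le_trans (hcr _ _ ab bM).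
    have := npar_cross_le np z2 ab bM ha hb hd.
    have -> : C5 * C5 * (2 * C5) + 1 = 2 * C5 ^+ 3 + 1 by ring.
    move=> h; rewrite -(ler_int R); apply: (le_trans h); apply: ltW.
    exact: truncnS_gt.
  have e1 : gap T i + gap T i.+1 + gap T i.+2 <= C5 by rewrite /gap; clear -hi; lra.
  split; apply: key => //; try exact: ltnW.
  - by rewrite /gap in e1 a1 a3 a5 *; clear -e1 a1 a3 a5; lra.
  - by rewrite /gap in e1 a1 a3 a5 *; clear -e1 a1 a3 a5; lra.
  - by rewrite /gap in e1 a1 a3 a5 *; clear -e1 a1 a3 a5; lra.
have Tinc i : (i < M)%N -> T i <= T i.+1 by move=> iM; rewrite /T ler_wpM2l ?tinc.
have T0 : T 0%N = 0 by rewrite /T t0 mulr0.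
have TMle : T M <= C3 * M%:R by rewrite TM.
have hpart := @many_partners R C3 C5 c Z M cr T good C31 (lexx _) (lexx _) hM Tinc T0 TMle hcell (fun=> erefl).
apply: (le_trans hpart); rewrite ler_nat; apply: subset_leq_card; apply/fintype.subsetP => i.
rewrite !inE => /andP[gi /existsP[j /and5P[gj ij Tij e1 /andP[/eqP e2 /eqP e3]]]].
move/eqP: e1 => e1.
exists (V1 j - V1 i), (V2 j - V2 i).
have [/andP[iM hi] /andP[jM hj]] := (gi, gj).
have hk := npar_same np z2 iM jM hi hj e1 e2 e3 C51 z0 z4 zG.
have [/andP[hi0 hi1] _ _] := bounds i gi; have [/andP[hj0 hj1] _ _] := bounds j gj.
have [v1i v2i] := hV i (ltn_ord i); have [v1j v2j] := hV j (ltn_ord j).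
have crossE : V1 i * (V2 j - V2 i) - V2 i * (V1 j - V1 i) = - cr i j.
  by rewrite /cr; ring.
have cr1 : 1 <= cr i j by apply: hcr.
have crD : (cr i j)%:~R <= C5 * C5 * (2 * c + C5) + 1 :> R.
  apply: (npar_cross_le np z2 ij (ltn_ord j)) => //.
  by rewrite /gap in hi0 hj1; clear -hi0 hj1 Tij; lra.
have Tj0 k : (k <= M)%N -> 0 <= T k by move=> kM; rewrite -T0 (npar_le np) // kM.
have Tj1 k : (k <= M)%N -> T k <= L by move=> kM; rewrite -TM (npar_le np) // kM leqnn.
have gapE k : tau k.+1 - tau k = gap T k / L.
  by rewrite /gap /T; field; rewrite gt_eqF.
have sqE k : tau k.+1 ^+ 2 - tau k ^+ 2 = gap T k * (T k + T k.+1) / L ^+ 2.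
  by rewrite /gap /T; field; rewrite gt_eqF.
have Linv : 1 / L <= 4 / M%:R.
  by rewrite ler_pdivrMr // mulrAC ler_pdivlMr //; clear -LM4; lra.
have Li0 : 0 <= 1 / L by rewrite divr_ge0 // ltW.
have Linv2 : 1 / L ^+ 2 <= 16 / M%:R ^+ 2.
  have -> : 1 / L ^+ 2 = (1 / L) * (1 / L) by field; rewrite gt_eqF.
  have -> : 16 / M%:R ^+ 2 = (4 / M%:R) * (4 / M%:R) :> R by field; rewrite gt_eqF.
  exact: ler_pM.
have dM : 4 * delta <= 1 / M%:R ^+ 2.
  have : delta <= 1 / (4 * M%:R ^+ 2) by rewrite ge_min lexx.
  rewrite ler_pdivlMr ?mulr_gt0 ?exprn_gt0 // => h.
  by rewrite ler_pdivlMr ?exprn_gt0 //; clear -h; lra.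
have aerr k : (k < M)%N -> `|g k.+1 - g k - 2 * (tau k.+1 - tau k)| <= 2 * delta.
  move=> kM; have h1 := hg k (ltnW kM); have h2 := hg k.+1 kM.
  rewrite (_ : _ - _ = (g k.+1 - 2 * tau k.+1) - (g k - 2 * tau k)); last by ring.
  by apply: (le_trans (ler_normB _ _)); clear -h1 h2; lra.
have ai := aerr i (ltn_ord i); have aj := aerr j (ltn_ord j).
have M2p : 0 < M%:R ^+ 2 :> R by rewrite exprn_gt0.
have diffa : `|g j.+1 - g j - (g i.+1 - g i)| <= 9 / M%:R ^+ 2.
  rewrite (_ : _ - _ = (g j.+1 - g j - 2 * (tau j.+1 - tau j))
     - (g i.+1 - g i - 2 * (tau i.+1 - tau i)) + 2 * ((gap T j - gap T i) * (1 / L))); last first.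
    by rewrite !gapE; field; rewrite gt_eqF.
  have h : `|(gap T j - gap T i) * (1 / L)| <= 1 / M%:R * (4 / M%:R).
    by rewrite normrM distrC (ger0_norm Li0); apply: ler_pM.
  have e : 1 / M%:R * (4 / M%:R) = 4 * (1 / M%:R ^+ 2) :> R by field; rewrite gt_eqF.
  rewrite e in h.
  apply: (le_trans (ler_normD _ _)); rewrite normrM (ger0_norm (ler0n _ 2)).
  have h' := ler_normB (g j.+1 - g j - 2 * (tau j.+1 - tau j)) (g i.+1 - g i - 2 * (tau i.+1 - tau i)).
  have -> : 9 / M%:R ^+ 2 = 9 * (1 / M%:R ^+ 2) :> R by rewrite mul1r.
  move: h' h ai aj dM; set A0 := `|_ - _ - _|; set B0 := `|(_ - _) * _|.
  set A1 := `|_ - _ - _|; set A2 := `|_ - _ - _|; set u := 1 / _.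
  by clear; move=> *; lra.
have diffb : `|tau j.+1 ^+ 2 - tau j ^+ 2 - (tau i.+1 ^+ 2 - tau i ^+ 2)| <= 16 * E / M%:R ^+ 2.
  rewrite !sqE.
  have -> : gap T j * (T j + T j.+1) / L ^+ 2 - gap T i * (T i + T i.+1) / L ^+ 2 =
     ((gap T j - gap T i) * (T j + T j.+1)
      + gap T i * (T j + T j.+1 - T i - T i.+1)) * (1 / L ^+ 2).
    by field; rewrite gt_eqF.
  have s0 : 0 <= T j + T j.+1 by rewrite addr_ge0 ?Tj0 // ltnW.
  have s1 : T j + T j.+1 <= 2 * (C3 * M%:R).
    have a1 := Tj1 j (ltnW (ltn_ord j)); have a2 := Tj1 j.+1 (ltn_ord j).
    by clear -a1 a2 LM; lra.
  have b1 : `|(gap T j - gap T i) * (T j + T j.+1)| <= 2 * C3.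
    rewrite normrM distrC (ger0_norm s0).
    have -> : 2 * C3 = 1 / M%:R * (2 * (C3 * M%:R)) by field; rewrite gt_eqF.
    exact: ler_pM.
  have d0' : 0 <= T j + T j.+1 - T i - T i.+1.
    have m1 : T i <= T j by rewrite (npar_le np) // (ltnW ij) (ltnW (ltn_ord j)).
    have m2 : T i.+1 <= T j.+1 by rewrite (npar_le np) // ltnS (ltnW ij) (ltn_ord j).
    by clear -m1 m2; lra.
  have d1' : T j + T j.+1 - T i - T i.+1 <= 2 * c + C5.
    by rewrite /gap in hi0 hj1; clear -hi0 hj1 Tij; lra.
  have b2 : `|gap T i * (T j + T j.+1 - T i - T i.+1)| <= C5 * (2 * c + C5).
    by rewrite normrM !ger0_norm //; apply: ler_pM.
  have b3 : `|(gap T j - gap T i) * (T j + T j.+1) +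
      gap T i * (T j + T j.+1 - T i - T i.+1)| <= E.
    by apply: (le_trans (ler_normD _ _)); apply: lerD.
  rewrite normrM [16 * E]mulrC -mulrA; apply: ler_pM => //.
  by rewrite ger0_norm // divr_ge0 // exprn_ge0.
have Lam0 : 0 <= Lam by apply: le_trans hp1.
have bigw p q : `|p| <= Lam -> `|q| <= Lam ->
   `|(g j.+1 - g j - (g i.+1 - g i)) * p +
     (tau j.+1 ^+ 2 - tau j ^+ 2 - (tau i.+1 ^+ 2 - tau i ^+ 2)) * q| <=
   (16 * E + 16 * C5 + 10) * Lam / M%:R ^+ 2.
  move=> hp hq; apply: (le_trans (norm_lincomb diffa diffb hp hq)).
  have -> : (9 / M%:R ^+ 2 + 16 * E / M%:R ^+ 2) * Lam = (9 + 16 * E) * Lam / M%:R ^+ 2.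
    by field; rewrite gt_eqF.
  rewrite ler_wpM2r ?invr_ge0 ?(ltW M2p) // ler_wpM2r //.
  by clear -C51; lra.
have bigv p q : `|p| <= Lam -> `|q| <= Lam ->
   `|(g i.+1 - g i) * p + (tau i.+1 ^+ 2 - tau i ^+ 2) * q| <=
   (16 * E + 16 * C5 + 10) * Lam / M%:R.
  move=> hp hq.
  have kC : gap T i / L <= 4 * C5 / M%:R.
    rewrite (_ : gap T i / L = gap T i * (1 / L)); last by rewrite mul1r.
    rewrite (_ : 4 * C5 / M%:R = C5 * (4 / M%:R)); last by field; rewrite gt_eqF.
    by apply: ler_pM.
  have k0 : 0 <= gap T i / L by rewrite divr_ge0.
  have b1 : `|g i.+1 - g i| <= (8 * C5 + 1) / M%:R.
    rewrite (_ : g i.+1 - g i = (g i.+1 - g i - 2 * (tau i.+1 - tau i)) + 2 * (gap T i / L)); last first.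
      by rewrite gapE; ring.
    apply: (le_trans (ler_normD _ _)); rewrite [X in _ + X]ger0_norm; last exact: mulr_ge0.
    have dM1 : 2 * delta <= 1 / M%:R.
      have : 1 / M%:R ^+ 2 <= 1 / M%:R :> R.
        by rewrite ler_pM2l // lef_pV2 ?posrE // expr2 ler_peMl // ltW.
      by move: dM; move: (1 / _) (1 / _); clear -d0; move=> a b; lra.
    have -> : (8 * C5 + 1) / M%:R = 1 / M%:R + 2 * (4 * C5 / M%:R) by field; rewrite gt_eqF.
    by apply: lerD; [exact: le_trans dM1 | rewrite ler_pM2l].
  have b2 : `|tau i.+1 ^+ 2 - tau i ^+ 2| <= 8 * C5 / M%:R.
    rewrite (_ : _ - _ = (gap T i / L) * (tau i + tau i.+1)); last by rewrite -gapE; ring.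
    have u0' : 0 <= tau i + tau i.+1.
      have := Tj0 i (ltnW (ltn_ord i)); have := Tj0 i.+1 (ltn_ord i).
      by rewrite /T !pmulr_rge0 // => x y; exact: addr_ge0.
    have u1 : tau i + tau i.+1 <= 2.
      have := Tj1 i (ltnW (ltn_ord i)); have := Tj1 i.+1 (ltn_ord i).
      by rewrite /T !ger_pMr // => x y; clear -x y; lra.
    rewrite (ger0_norm (mulr_ge0 k0 u0')).
    rewrite (_ : 8 * C5 / M%:R = 4 * C5 / M%:R * 2); last by field; rewrite gt_eqF.
    exact: ler_pM.
  apply: (le_trans (norm_lincomb b1 b2 hp hq)).
  have -> : ((8 * C5 + 1) / M%:R + 8 * C5 / M%:R) * Lam = (16 * C5 + 1) * Lam / M%:R.
    by field; rewrite gt_eqF.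
  rewrite ler_wpM2r ?invr_ge0 ?(ltW Mp) // ler_wpM2r //.
  by clear -E1; lra.
have cr0 : 0 < cr i j by exact: lt_le_trans cr1.
split.
- by rewrite crossE normrN (gtr0_norm cr0).
- by rewrite crossE normrN (gtr0_norm cr0).
- split.
  have h := bigw _ _ hp1 hq1; rewrite intr_norm rmorphB /= v1i v1j.
  by apply: le_trans h; rewrite le_eqVlt; apply/orP; left; apply/eqP; congr (`|_|); ring.
  have h := bigw _ _ hp2 hq2; rewrite intr_norm rmorphB /= v2i v2j.
  by apply: le_trans h; rewrite le_eqVlt; apply/orP; left; apply/eqP; congr (`|_|); ring.
- split; first by rewrite intr_norm v1i; exact: bigv.
  by rewrite intr_norm v2i; exact: bigv.
Qed.

(** * Tangent triangles and affine length *)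

(** The defect in the inequality between the arithmetic and geometric means of
    three numbers controls the differences of the numbers. *)
Lemma amgm3_gap (R : realFieldType) (x y z : R) :
  0 <= x -> 0 <= y -> 0 <= z ->
  0 <= x ^+ 3 + y ^+ 3 + z ^+ 3 - 3 * (x * y * z) /\
  (x ^+ 3 - y ^+ 3) ^+ 2 <=
    2 * (x + y) ^+ 3 * (x ^+ 3 + y ^+ 3 + z ^+ 3 - 3 * (x * y * z)).
Proof.
move=> x0 y0 z0.
set g := _ - 3 * _.
have gE : g = (x + y + z) / 2 * ((x - y) ^+ 2 + (y - z) ^+ 2 + (z - x) ^+ 2).
  by rewrite /g; field.
have g1 : (x + y) / 2 * (x - y) ^+ 2 <= g.
  rewrite gE; apply: ler_pM; rewrite ?sqr_ge0 //; last by rewrite -addrA lerDl addr_ge0 ?sqr_ge0.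
  - lra.
  - lra.
split; first by apply: le_trans g1; rewrite mulr_ge0 ?sqr_ge0 //; lra.
have xy0 : 0 <= x + y by lra.
have -> : (x ^+ 3 - y ^+ 3) ^+ 2 = (x - y) ^+ 2 * (x ^+ 2 + x * y + y ^+ 2) ^+ 2 by ring.
have h1 : x ^+ 2 + x * y + y ^+ 2 <= (x + y) ^+ 2 by nra.
have h2 : (x ^+ 2 + x * y + y ^+ 2) ^+ 2 <= (x + y) ^+ 4.
  rewrite (_ : 4 = 2 * 2)%N // exprM ler_pXn2r ?nnegrE //; nra.
apply: (@le_trans _ _ ((x - y) ^+ 2 * (x + y) ^+ 4)).
  by rewrite ler_wpM2l ?sqr_ge0.
have -> : (x - y) ^+ 2 * (x + y) ^+ 4 = 2 * (x + y) ^+ 3 * ((x + y) / 2 * (x - y) ^+ 2).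
  by field.
by apply: ler_wpM2l => //; rewrite mulr_ge0 ?exprn_ge0.
Qed.

(** Equality in this form of Hoelder's inequality forces the three weights
    [x ^+ 3], [y ^+ 3], [z ^+ 3] to coincide. *)
Lemma holder3 (R : realFieldType) (x y z x' y' z' : R) :
  0 <= x -> 0 <= y -> 0 <= z -> 0 <= x' -> 0 <= y' -> 0 <= z' ->
  x ^+ 3 + x' ^+ 3 = 1 -> y ^+ 3 + y' ^+ 3 = 1 -> z ^+ 3 + z' ^+ 3 = 1 ->
  x * y * z + x' * y' * z' <= 1 /\
  (x ^+ 3 - y ^+ 3) ^+ 2 <= 48 * (1 - (x * y * z + x' * y' * z')).
Proof.
move=> x0 y0 z0 x0' y0' z0' ex ey ez.
have [g0 g1] := amgm3_gap x0 y0 z0; have [g0' _] := amgm3_gap x0' y0' z0'.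
split; first by lra.
set g := _ - _ in g0 g1; set g' := _ - _ in g0'.
have gg : g <= 3 * (1 - (x * y * z + x' * y' * z')) by rewrite /g /g' in g0' *; lra.
have le1 (t t' : R) : 0 <= t -> 0 <= t' -> t ^+ 3 + t' ^+ 3 = 1 -> t <= 1.
  move=> t0 t0' e; rewrite -(@ler_pXn2r _ 3) ?nnegrE // expr1n.
  by rewrite -e lerDl exprn_ge0.
have x1 := le1 _ _ x0 x0' ex; have y1 := le1 _ _ y0 y0' ey.
have : (x + y) ^+ 3 <= 2 ^+ 3 by rewrite ler_pXn2r ?nnegrE //; lra.
move=> c8.
apply: (le_trans g1).
apply: (@le_trans _ _ (2 * 2 ^+ 3 * g)).
  by rewrite ler_wpM2r // ler_wpM2l.
by rewrite (_ : 2 * 2 ^+ 3 = 16 :> R); [lra | ring].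
Qed.

(** The tangent at a point Q of an arc from P to R cuts the tangents at P and R,
    which meet in C, in the points [P + s (C - P)] and [C + t (R - C)]; [r] is the
    position of Q between them.  The doubled areas of the three tangent triangles
    are [a b / d], [s t r a b / d] and [(1 - s) (1 - t) (1 - r) a b / d].  Here [a1]
    is the height of the tangent at P above Q, [b1] that of the tangent at Q above
    P, [d1] the decrease of the slope and [h1] the width, and likewise [a2, b2, d2,
    h2] for Q and R.  The cases [d1 = 0], [d2 = 0] and [w = 0] are those in which Q
    lies on the tangent at P or R, or is C. *)
Lemma triangle_split (R : realFieldType) (a1 b1 a2 b2 d1 d2 h1 h2 : R) :
  0 <= a1 -> 0 <= b1 -> 0 <= a2 -> 0 <= b2 -> 0 <= d1 -> 0 <= d2 ->
  0 <= h1 -> 0 <= h2 ->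
  a1 + b1 = d1 * h1 -> a2 + b2 = d2 * h2 ->
  let d := d1 + d2 in let a := a1 + d1 * h2 + a2 in
  let b := b1 + b2 + d2 * h1 in
  0 < d -> 0 < a -> 0 < b ->
  exists s t r : R, [/\ 0 <= s <= 1, 0 <= t <= 1 & 0 <= r <= 1] /\
  [/\ a1 * b1 / d1 = s * t * r * (a * b / d),
      a2 * b2 / d2 = (1 - s) * (1 - t) * (1 - r) * (a * b / d),
      a1 = r * t * a
    & h1 = ((1 - r) * s + r * (1 - t)) * (b / d) + r * t * (h1 + h2)].
Proof.
move=> a10 b10 a20 b20 d10 d20 h10 h20 e1 e2 d a b d0 a0 b0.
have [d1z|d1n] := eqVneq d1 0.
  rewrite {}/a {}/b {}/d d1z ?(mul0r, addr0, add0r) in e1 a0 b0 d0 *.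
  have [a1z b1z] : a1 = 0 /\ b1 = 0 by split; lra.
  rewrite a1z b1z ?(mul0r, addr0, add0r) in a0 b0 *.
  have d2n : d2 != 0 by rewrite gt_eqF.
  have bn : b2 + d2 * h1 != 0 by rewrite gt_eqF.
  have dh : 0 <= d2 * h1 by rewrite mulr_ge0 // ltW.
  exists 0, 0, (d2 * h1 / (b2 + d2 * h1)); split; split; rewrite ?lexx ?ler01 //.
  - rewrite divr_ge0 ?(ltW b0) //= ler_pdivrMr // mul1r; lra.
  - by rewrite !mul0r.
  - by field; rewrite bn d2n.
  - by rewrite !(mulr0, mul0r).
  - by field; rewrite bn d2n.
have d1p : 0 < d1 by rewrite lt0r d1n.
have [d2z|d2n] := eqVneq d2 0.
  rewrite {}/a {}/b {}/d d2z ?(mul0r, addr0, add0r) in e2 a0 b0 d0 *.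
  have [a2z b2z] : a2 = 0 /\ b2 = 0 by split; lra.
  rewrite a2z b2z ?(mul0r, addr0, add0r) in a0 b0 *.
  have an : a1 + d1 * h2 != 0 by rewrite gt_eqF.
  have dh : 0 <= d1 * h2 by rewrite mulr_ge0.
  have b1n : b1 != 0 by rewrite gt_eqF.
  exists 1, 1, (a1 / (a1 + d1 * h2)); split; split; rewrite ?lexx ?ler01 //.
  - rewrite divr_ge0 ?(ltW a0) //= ler_pdivrMr // mul1r; lra.
  - by field; rewrite d1n an.
  - by rewrite subrr !mul0r.
  - by field.
  - have -> : h1 = (a1 + b1) / d1 by rewrite e1 mulrC mulKf.
    by field; rewrite an d1n.
have d2p : 0 < d2 by rewrite lt0r d2n.
have dn : d1 + d2 != 0 by rewrite gt_eqF.
pose w := (b2 * d1 + a1 * d2) / d.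
have wE : b2 = (w * d - a1 * d2) / d1.
  by rewrite /w /d; field; rewrite dn d1n.
have w0 : 0 <= w by rewrite /w divr_ge0 ?(ltW d0) // addr_ge0 // mulr_ge0.
have h1E : h1 = (a1 + b1) / d1 by rewrite e1 mulrC mulKf.
have h2E : h2 = (a2 + b2) / d2 by rewrite e2 mulrC mulKf.
have [wz|wn] := eqVneq w 0.
  have : b2 * d1 + a1 * d2 = 0.
    by move/eqP: wz; rewrite /w mulf_eq0 invr_eq0 (gt_eqF d0) orbF => /eqP.
  move=> z; have p1 : 0 <= b2 * d1 by rewrite mulr_ge0.
  have p2 : 0 <= a1 * d2 by rewrite mulr_ge0.
  have a1z : a1 = 0 by apply: (mulIf d2n); rewrite mul0r; lra.
  have b2z : b2 = 0 by apply: (mulIf d1n); rewrite mul0r; lra.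
  exists 1, 0, 0; split; split; rewrite ?lexx ?ler01 //.
  - by rewrite a1z !(mul0r, mulr0).
  - by rewrite b2z !(mulr0, subrr, mul0r).
  - by rewrite a1z !mul0r.
  - by rewrite /b /d h1E a1z b2z; field; rewrite d1n dn.
have wp : 0 < w by rewrite lt0r wn.
have bw : b1 + w != 0 by rewrite gt_eqF // ltr_wpDl.
have aw : a2 + w != 0 by rewrite gt_eqF // ltr_wpDl.
have rd : 0 <= b2 * d1 by rewrite mulr_ge0.
have rd' : b2 * d1 = w * d - a1 * d2 by rewrite wE mulfVK.
have wd : 0 < w * d by rewrite mulr_gt0.
have ad : 0 <= a1 * d2 by rewrite mulr_ge0.
exists (b1 / (b1 + w)), (w / (a2 + w)), (a1 * d2 / (w * d)); split; split.
- rewrite divr_ge0 ?addr_ge0 //= ler_pdivrMr ?ltr_wpDl // mul1r; lra.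
- rewrite divr_ge0 ?addr_ge0 //= ler_pdivrMr ?ltr_wpDl // mul1r; lra.
- rewrite divr_ge0 ?(ltW wd) //= ler_pdivrMr // mul1r; lra.
- rewrite /a /b h1E h2E wE /d; field; by rewrite ?d1n ?d2n ?dn ?bw ?aw ?wn.
- rewrite /a /b h1E h2E wE /d; field; by rewrite ?d1n ?d2n ?dn ?bw ?aw ?wn.
- rewrite /a h2E wE /d; field; by rewrite ?d1n ?d2n ?dn ?bw ?aw ?wn.
- rewrite /b h2E h1E wE /d; field; by rewrite ?d1n ?d2n ?dn ?bw ?aw ?wn.
Qed.

Section CubeRoot.
Variable R : realType.
Implicit Types x y : R.

Definition cbrt x : R := x `^ 3^-1.

Lemma cbrt_ge0 x : 0 <= cbrt x. Proof. exact: powR_ge0. Qed.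

Lemma cbrtK x : 0 <= x -> cbrt x ^+ 3 = x.
Proof.
move=> x0; rewrite /cbrt -powR_mulrn ?powR_ge0 // -powRrM.
by have -> : 3^-1 * 3%:R = 1 :> R; [rewrite mulVf ?pnatr_eq0 | rewrite powRr1].
Qed.

Lemma cube_inj x y : 0 <= x -> 0 <= y -> x ^+ 3 = y ^+ 3 -> x = y.
Proof. by move=> x0 y0 /eqP; rewrite eqrXn2 // => /eqP. Qed.

Lemma cube_le x y : 0 <= x -> 0 <= y -> x ^+ 3 <= y ^+ 3 -> x <= y.
Proof. by move=> x0 y0; rewrite ler_pXn2r. Qed.

End CubeRoot.

(** The affine lengths of the two parts of an arc are
    [cbrt (s t r)] and [cbrt ((1 - s) (1 - t) (1 - r))] times that of the arc; if
    their sum is almost that of the arc, then [s], [t] and [r] nearly agree. *)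
Lemma cbrt_split (R : realType) (s t r F F1 F2 : R) :
  0 <= s <= 1 -> 0 <= t <= 1 -> 0 <= r <= 1 ->
  0 <= F -> 0 <= F1 -> 0 <= F2 ->
  F1 ^+ 3 = s * t * r * F ^+ 3 -> F2 ^+ 3 = (1 - s) * (1 - t) * (1 - r) * F ^+ 3 ->
  F1 + F2 <= F /\
  forall eta D, 0 < F -> F - F1 - F2 <= eta * F -> 48 * eta <= D ^+ 2 -> 0 <= D ->
    [/\ `|s - t| <= D, `|t - r| <= D & `|s - r| <= D].
Proof.
move=> /andP[s0 s1] /andP[t0 t1] /andP[r0 r1] F0 F10 F20 e1 e2.
have os : 0 <= 1 - s by rewrite subr_ge0.
have ot : 0 <= 1 - t by rewrite subr_ge0.
have or : 0 <= 1 - r by rewrite subr_ge0.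
have E1 : F1 = cbrt s * cbrt t * cbrt r * F.
  by apply: cube_inj; rewrite ?mulr_ge0 ?cbrt_ge0 // !exprMn !cbrtK.
have E2 : F2 = cbrt (1 - s) * cbrt (1 - t) * cbrt (1 - r) * F.
  by apply: cube_inj; rewrite ?mulr_ge0 ?cbrt_ge0 // !exprMn !cbrtK.
have e (u : R) : u + (1 - u) = 1 by ring.
have H (x y z : R) : 0 <= x -> 0 <= y -> 0 <= z -> 0 <= 1 - x -> 0 <= 1 - y -> 0 <= 1 - z ->
  cbrt x * cbrt y * cbrt z + cbrt (1 - x) * cbrt (1 - y) * cbrt (1 - z) <= 1 /\
  (x - y) ^+ 2 <= 48 * (1 - (cbrt x * cbrt y * cbrt z + cbrt (1 - x) * cbrt (1 - y) * cbrt (1 - z))).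
  move=> x0 y0 z0 x1 y1 z1.
  have := @holder3 R (cbrt x) (cbrt y) (cbrt z) (cbrt (1 - x)) (cbrt (1 - y)) (cbrt (1 - z)).
  by rewrite !cbrt_ge0 !cbrtK // !e => /(_ isT isT isT isT isT isT erefl erefl erefl).
have [h1 h2] := H s t r s0 t0 r0 os ot or.
set Q := _ + _ in h1 h2.
have FE : F1 + F2 = Q * F by rewrite E1 E2 /Q -mulrDl.
split; first by rewrite FE ler_piMl.
move=> eta D Fp hF hD D0.
have Qe : 1 - Q <= eta.
  by rewrite -(ler_pM2r Fp) mulrBl mul1r -FE opprD addrA.
have [_ h3] := H t r s t0 r0 s0 ot or os.
have [_ h4] := H s r t s0 r0 t0 os or ot.
have key x y : (x - y) ^+ 2 <= 48 * (1 - Q) -> `|x - y| <= D.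
  move=> h; rewrite -(@ler_pXn2r _ 2) ?nnegrE // real_normK ?num_real //.
  apply: (le_trans h); apply: le_trans hD; by rewrite ler_pM2l.
split; apply: key => //.
- by move: h3; congr (_ <= 48 * (1 - _)); rewrite /Q; ring.
- by move: h4; congr (_ <= 48 * (1 - _)); rewrite /Q; ring.
Qed.

Lemma sqrt_between (R : realType) (r t : R) : 0 <= r -> 0 <= t -> r <= t ->
  r <= Num.sqrt (r * t) <= t.
Proof.
move=> r0 t0 rt; have sq0 := sqrtr_ge0 (r * t).
have sqK : Num.sqrt (r * t) ^+ 2 = r * t by rewrite sqr_sqrtr ?mulr_ge0.
apply/andP; split; rewrite -(@ler_pXn2r _ 2) ?nnegrE // sqK expr2.
  exact: ler_wpM2l.
exact: ler_wpM2r.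
Qed.

(** In the basis [(C - P, R - P)] of the tangent triangle the division point has
    coordinates [((1 - r) s + r (1 - t), r t)].  For [s = t = r] these are
    [(2 s (1 - s), s ^+ 2)], a point of the parabola tangent to the two sides. *)
Lemma near_parabola_param (R : realType) (s t r D : R) :
  0 <= s -> 0 <= t -> 0 <= r <= 1 ->
  `|s - t| <= D -> `|t - r| <= D -> `|s - r| <= D ->
  `|((1 - r) * s + r * (1 - t)) + 2 * (r * t) - 2 * Num.sqrt (r * t)| <= 3 * D.
Proof.
move=> s0 t0 /andP[r0 r1] hst htr hsr.
set tau := Num.sqrt _.
have [h1 h2] : `|r - tau| <= D /\ `|s - tau| <= D.
  move: hst htr hsr; rewrite !ler_norml => /andP[a1 a2] /andP[a3 a4] /andP[a5 a6].
  case: (lerP r t) => [rt|/ltW tr].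
    have /andP[b1 b2] := sqrt_between r0 t0 rt; rewrite -/tau in b1 b2.
    by split; apply/andP; split; lra.
  have := sqrt_between t0 r0 tr; rewrite mulrC -/tau => /andP[b1 b2].
  by split; apply/andP; split; lra.
have h3 : `|r * (t - s)| <= D.
  rewrite normrM distrC (ger0_norm r0); apply: le_trans hst.
  by rewrite ler_piMl.
have -> : (1 - r) * s + r * (1 - t) + 2 * (r * t) - 2 * tau =
  (s - tau) + (r - tau) + r * (t - s) by ring.
apply: (le_trans (ler_normD _ _)).
have := ler_normD (s - tau) (r - tau); move: h1 h2 h3; clear.
set A := `|_ - _|; set B := `|_ - _|; set C := `|_ * _|; set E := `|_ + _|.
move=> *; lra.
Qed.

(** A point of a curve together with the slope of a supporting line. *)
Record contact (R : realType) := Contact { cx : R; cy : R; cs : R }.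

Section Contacts.
Variable R : realType.
Notation C := (contact R).
Implicit Types p q r : C.

(** The height at which the supporting line of [p] passes above [q]. *)
Definition above p q : R := cy p + cs p * (cx q - cx p) - cy q.

(** Contact elements of the graph of a concave function, at most one per abscissa. *)
Definition concave (G : set C) : Prop :=
  (forall p q, G p -> G q -> 0 <= above p q) /\
  (forall p q, G p -> G q -> cx p = cx q -> p = q).

(** The doubled area of the triangle bounded by the chord and the two supporting
    lines; it is 0 when the lines are parallel, because they then coincide. *)
Definition tri p q : R := above p q * above q p / (cs p - cs q).

(** Affine length. *)
Definition alen p q : R := cbrt (tri p q).

Lemma above_sum p q : above p q + above q p = (cs p - cs q) * (cx q - cx p).
Proof. by rewrite /above; ring. Qed.

Lemma above_xx p : above p p = 0.
Proof. by rewrite /above; ring. Qed.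

Lemma alen_ge0 p q : 0 <= alen p q. Proof. exact: cbrt_ge0. Qed.

Lemma alen_xx p : alen p p = 0.
Proof.
by rewrite /alen /tri above_xx !mul0r /cbrt powR0 // invr_eq0 pnatr_eq0.
Qed.

Variable G : set C.
Hypothesis Gc : concave G.

Lemma slope_le p q : G p -> G q -> cx p < cx q -> cs q <= cs p.
Proof.
move=> Gp Gq pq; have [h _] := Gc.
have : 0 <= (cs p - cs q) * (cx q - cx p) by rewrite -above_sum addr_ge0 ?h.
by rewrite pmulr_lge0 ?subr_gt0 // subr_ge0.
Qed.

Lemma tri_ge0 p q : G p -> G q -> cx p <= cx q -> 0 <= tri p q.
Proof.
move=> Gp Gq; rewrite le_eqVlt => /orP[/eqP e|pq].
  by have [_ /(_ _ _ Gp Gq e) <-] := Gc; rewrite /tri above_xx !mul0r.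
have [h _] := Gc.
by rewrite /tri divr_ge0 ?mulr_ge0 ?h // subr_ge0 slope_le.
Qed.

Lemma alenK p q : G p -> G q -> cx p <= cx q -> alen p q ^+ 3 = tri p q.
Proof. by move=> Gp Gq pq; rewrite cbrtK // tri_ge0. Qed.

Lemma above_le p q r : G p -> G q -> G r -> cx p <= cx q -> cx q <= cx r ->
  above p q <= above p r.
Proof.
move=> Gp Gq Gr; rewrite le_eqVlt => /orP[/eqP e qr|pq qr].
  have [h /(_ _ _ Gp Gq e) <-] := Gc; rewrite above_xx; exact: h.
have hs := slope_le Gp Gq pq; have [h _] := Gc; have hq := h q r Gq Gr.
have e : above p r - above p q = (cs p - cs q) * (cx r - cx q) + above q r.
  by rewrite /above; ring.
by rewrite -subr_ge0 e addr_ge0 // mulr_ge0 ?subr_ge0.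
Qed.

Lemma tri_split p q r : G p -> G q -> G r -> cx p < cx q -> cx q < cx r ->
  0 < cs p - cs r -> 0 < above p r -> 0 < above r p ->
  exists s t k : R, [/\ 0 <= s <= 1, 0 <= t <= 1 & 0 <= k <= 1] /\
  [/\ tri p q = s * t * k * tri p r,
      tri q r = (1 - s) * (1 - t) * (1 - k) * tri p r,
      above p q = k * t * above p r
    & cx q - cx p = ((1 - k) * s + k * (1 - t)) * (above r p / (cs p - cs r))
        + k * t * (cx r - cx p)].
Proof.
move=> Gp Gq Gr pq qr d0 a0 b0; have [h _] := Gc.
have s1 := slope_le Gp Gq pq; have s2 := slope_le Gq Gr qr.
have := @triangle_split R (above p q) (above q p) (above q r) (above r q)
  (cs p - cs q) (cs q - cs r) (cx q - cx p) (cx r - cx q)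
  (h _ _ Gp Gq) (h _ _ Gq Gp) (h _ _ Gq Gr) (h _ _ Gr Gq).
rewrite !subr_ge0 => /(_ s1 s2 (ltW pq) (ltW qr) (above_sum p q) (above_sum q r)).
have e1 : cs p - cs q + (cs q - cs r) = cs p - cs r by ring.
have e2 : above p q + (cs p - cs q) * (cx r - cx q) + above q r = above p r.
  by rewrite /above; ring.
have e3 : above q p + above r q + (cs q - cs r) * (cx q - cx p) = above r p.
  by rewrite /above; ring.
have e4 : cx q - cx p + (cx r - cx q) = cx r - cx p by ring.
by rewrite /= e1 e2 e3 e4 => /(_ d0 a0 b0).
Qed.

Lemma alen_superadd p q r : G p -> G q -> G r -> cx p <= cx q -> cx q <= cx r ->
  alen p q + alen q r <= alen p r.
Proof.
move=> Gp Gq Gr; have [h inj] := Gc.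
rewrite le_eqVlt => /orP[/eqP /(inj _ _ Gp Gq) ->|pq]; first by rewrite alen_xx add0r.
rewrite le_eqVlt => /orP[/eqP /(inj _ _ Gq Gr) ->|qr]; first by rewrite alen_xx addr0.
have pr := lt_trans pq qr.
have s1 := slope_le Gp Gq pq; have s2 := slope_le Gq Gr qr.
have z u v : tri u v = 0 -> alen u v = 0.
  by move=> e; rewrite /alen e /cbrt powR0 // invr_eq0 pnatr_eq0.
have g1 := h _ _ Gp Gq; have g2 := h _ _ Gq Gp; have g3 := h _ _ Gq Gr.
have g4 := h _ _ Gr Gq.
have e2 : above p q + (cs p - cs q) * (cx r - cx q) + above q r = above p r.
  by rewrite /above; ring.
have e3 : above q p + above r q + (cs q - cs r) * (cx q - cx p) = above r p.
  by rewrite /above; ring.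
have m1 : 0 <= (cs p - cs q) * (cx r - cx q) by rewrite mulr_ge0 // subr_ge0 // ltW.
have m2 : 0 <= (cs q - cs r) * (cx q - cx p) by rewrite mulr_ge0 // subr_ge0 // ltW.
have [d0|d0] := ltrP 0 (cs p - cs r); last first.
  have w1 : cs p - cs q = 0 by lra. have w2 : cs q - cs r = 0 by lra.
  by rewrite (z p q) ?(z q r) ?addr0 ?alen_ge0 // /tri ?w1 ?w2 invr0 mulr0.
have [a0|a0] := ltrP 0 (above p r); last first.
  have w1 : above p q = 0 by lra. have w2 : above q r = 0 by lra.
  by rewrite (z p q) ?(z q r) ?addr0 ?alen_ge0 // /tri ?w1 ?w2 !mul0r.
have [b0|b0] := ltrP 0 (above r p); last first.
  have w1 : above q p = 0 by lra. have w2 : above r q = 0 by lra.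
  by rewrite (z p q) ?(z q r) ?addr0 ?alen_ge0 // /tri ?w1 ?w2 !(mulr0, mul0r).
have [s [t [k [[hs ht hk] [f1 f2 _ _]]]]] := tri_split Gp Gq Gr pq qr d0 a0 b0.
rewrite -!alenK ?(ltW pq) ?(ltW qr) ?(ltW pr) // in f1 f2.
by have [] := cbrt_split hs ht hk (alen_ge0 p r) (alen_ge0 p q) (alen_ge0 q r) f1 f2.
Qed.

(** [gam] and the quotient by [u] are the coordinates of [q] in the tangent triangle
    of [p] and [r]; in the notation of the parabola, [gam] is the square of the
    parameter and the sum of the first coordinate and [2 * gam] is twice the
    parameter. *)
Lemma small_drop_near_parabola p q r (eta D : R) :
  G p -> G q -> G r -> cx p < cx q -> cx q < cx r ->
  0 < cs p - cs r -> 0 < above p r -> 0 < above r p ->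
  alen p r - alen p q - alen q r <= eta * alen p r -> 48 * eta <= D ^+ 2 -> 0 <= D ->
  forall gam u, gam = above p q / above p r -> u = above r p / (cs p - cs r) ->
  `|(cx q - cx p - gam * (cx r - cx p)) / u + 2 * gam - 2 * Num.sqrt gam| <= 3 * D.
Proof.
move=> Gp Gq Gr pq qr d0 a0 b0 hd hD D0 gam u gamE uE.
have [s [t [k [[hs ht hk] [f1 f2 f3 f4]]]]] := tri_split Gp Gq Gr pq qr d0 a0 b0.
have pr := lt_trans pq qr.
have T0 : 0 < tri p r by rewrite /tri divr_gt0 ?mulr_gt0.
have F0 : 0 < alen p r by rewrite /alen powR_gt0.
rewrite -!alenK ?(ltW pq) ?(ltW qr) ?(ltW pr) // in f1 f2.
have [_ /(_ eta D F0 hd hD D0)[c1 c2 c3]] :=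
  cbrt_split hs ht hk (alen_ge0 p r) (alen_ge0 p q) (alen_ge0 q r) f1 f2.
have gE : gam = k * t by rewrite gamE f3 mulfK // gt_eqF.
have u0 : u != 0 by rewrite uE gt_eqF // divr_gt0.
have -> : (cx q - cx p - gam * (cx r - cx p)) / u = (1 - k) * s + k * (1 - t).
  by rewrite f4 gE -uE addrK mulfK.
rewrite gE; have /andP[s0 _] := hs; have /andP[t0 _] := ht.
exact: near_parabola_param.
Qed.

Fixpoint chain p (s : seq C) : Prop :=
  if s is q :: s' then [/\ G q, cx p <= cx q & chain q s'] else True.

Fixpoint chain_sum (e : C -> C -> R) p (s : seq C) : R :=
  if s is q :: s' then e p q + chain_sum e q s' else 0.

Lemma chain_last p s : G p -> chain p s -> G (last p s) /\ cx p <= cx (last p s).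
Proof.
elim: s p => [|q s IH] p Gp /=; first by split.
by case=> Gq pq /(IH _ Gq)[h1 h2]; split => //; apply: le_trans h2.
Qed.

Lemma chain_cat p s s' : chain p s -> chain (last p s) s' -> chain p (s ++ s').
Proof. by elim: s p => //= q s IH p [? ? /IH h] /h. Qed.

Lemma chain_sum_cat e p s s' :
  chain_sum e p (s ++ s') = chain_sum e p s + chain_sum e (last p s) s'.
Proof. by elim: s p => [|q s IH] p /=; rewrite ?add0r // IH addrA. Qed.

Lemma chain_sum_ge0 p s : 0 <= chain_sum alen p s.
Proof. by elim: s p => //= q s IH p; rewrite addr_ge0 ?alen_ge0. Qed.

Definition refinements p q : set R :=
  [set v | exists s, [/\ chain p s, last p s = q & v = chain_sum alen p s]]%classic.

Definition ilen p q : R := inf (refinements p q).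

Lemma refinements_lb p q : has_lbound (refinements p q).
Proof. by exists 0 => v [s [_ _ ->]]; exact: chain_sum_ge0. Qed.

Lemma refinements_has_inf p q : G q -> cx p <= cx q -> has_inf (refinements p q).
Proof.
move=> Gq pq; split; last exact: refinements_lb.
by exists (chain_sum alen p [:: q]), [:: q].
Qed.

Lemma ilen_le_sum p s : chain p s -> ilen p (last p s) <= chain_sum alen p s.
Proof. by move=> h; apply: ge_inf; [exact: refinements_lb | exists s]. Qed.

Lemma ilen_le p q : G q -> cx p <= cx q -> ilen p q <= alen p q.
Proof.
by move=> Gq pq; have := @ilen_le_sum p [:: q]; rewrite /= addr0; apply.
Qed.

Lemma ilen_approx p q (e : R) : G q -> cx p <= cx q -> 0 < e ->
  exists s, [/\ chain p s, last p s = q & chain_sum alen p s <= ilen p q + e].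
Proof.
move=> Gq pq e0.
have [v [s [h1 h2 ->]] hv] := inf_adherent e0 (refinements_has_inf Gq pq).
by exists s; split => //; exact: ltW.
Qed.

Lemma ilen_subadd p q r : G q -> G r -> cx p <= cx q -> cx q <= cx r ->
  ilen p r <= ilen p q + ilen q r.
Proof.
move=> Gq Gr pq qr; apply/ler_addgt0Pl => e e0.
have e2 : 0 < e / 2 by rewrite divr_gt0.
have [s [s1 s2 s3]] := ilen_approx Gq pq e2.
have [t [t1 t2 t3]] := ilen_approx Gr qr e2.
have hc : chain p (s ++ t) by apply: chain_cat; rewrite ?s2.
have := ilen_le_sum hc; rewrite last_cat s2 t2 chain_sum_cat s2.
by move=> h; apply: (le_trans h); lra.
Qed.

(** How much affine length refinement of the chord can remove.  Superadditivity of
    [alen] and subadditivity of [ilen] make it superadditive. *)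
Definition defect p q : R := alen p q - ilen p q.

Definition superadditive (e : C -> C -> R) : Prop :=
  (forall p q, G p -> G q -> cx p <= cx q -> 0 <= e p q) /\
  (forall p q r, G p -> G q -> G r -> cx p <= cx q -> cx q <= cx r ->
     e p q + e q r <= e p r).

Lemma superadditive_alen : superadditive alen.
Proof.
by split=> [p q _ _ _|p q r *]; [exact: alen_ge0 | exact: alen_superadd].
Qed.

Lemma superadditive_width : superadditive (fun p q => cx q - cx p).
Proof. by split=> [p q _ _|p q r *]; [rewrite subr_ge0 | lra]. Qed.

Lemma superadditive_defect : superadditive defect.
Proof.
split=> [p q _ Gq pq|p q r Gp Gq Gr pq qr].
  by rewrite subr_ge0 ilen_le.
have := alen_superadd Gp Gq Gr pq qr; have := ilen_subadd Gq Gr pq qr.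
by rewrite /defect; lra.
Qed.

Lemma defect_ge p q r : G q -> G r -> cx p <= cx q -> cx q <= cx r ->
  alen p r - alen p q - alen q r <= defect p r.
Proof.
move=> Gq Gr pq qr.
have := ilen_subadd Gq Gr pq qr; have := ilen_le Gq pq; have := ilen_le Gr qr.
by rewrite /defect; lra.
Qed.

Lemma chain_sum_defect p s : G p -> chain p s ->
  chain_sum defect p s <= chain_sum alen p s - ilen p (last p s).
Proof.
elim: s p => [|q s IH] p Gp /=.
  move=> _; rewrite sub0r oppr_ge0.
  by have := @ilen_le_sum p [::] I.
case=> Gq pq hc; have := IH _ Gq hc.
have [Gl ql] := chain_last Gq hc; have := ilen_subadd Gq Gl pq ql.
by rewrite /defect; lra.
Qed.

Lemma small_defect_chain p q (e : R) : G p -> G q -> cx p <= cx q -> 0 < e ->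
  exists s, [/\ chain p s, last p s = q & chain_sum defect p s <= e].
Proof.
move=> Gp Gq pq e0; have [s [s1 s2 s3]] := ilen_approx Gq pq e0.
exists s; split => //; have := chain_sum_defect Gp s1; rewrite s2; lra.
Qed.

Section Windows.
Variables (e : C -> C -> R) (z : nat -> C) (J : nat).
Hypothesis ee : superadditive e.
Hypothesis Gz : forall j, (j <= J)%N -> G (z j).
Hypothesis zle : forall j, (j < J)%N -> cx (z j) <= cx (z j.+1).

(** Windows inside an interval are disjoint, so that their total is at most the
    value of the interval. *)
Lemma sum_inside p q (m : nat) : (m <= J)%N -> G p -> G q -> cx p <= cx q ->
  \sum_(j < m | (cx p <= cx (z j)) && (cx (z j.+1) <= cx q)) e (z j) (z j.+1) <= e p q.
Proof.
have [e0 esup] := ee.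
elim: m q => [|m IH] q mJ Gp Gq pq; first by rewrite big_ord0 e0.
rewrite big_mkcond big_ord_recr /= -big_mkcond /=.
case: ifPn => [/andP[h1 h2]|_]; last by rewrite addr0 IH // ltnW.
have Gm : G (z m) by apply: Gz; exact: ltnW.
have Gm1 : G (z m.+1) by apply: Gz.
have zm := zle mJ.
apply: (@le_trans _ _ (e p (z m) + e (z m) (z m.+1))).
  rewrite lerD2r; apply: le_trans (IH (z m) (ltnW mJ) Gp Gm h1).
  rewrite [leLHS]big_mkcond [leRHS]big_mkcond /=; apply: ler_sum => j _.
  have Gj : G (z j) by apply: Gz; rewrite (leq_trans (ltnW (ltn_ord j))) // ltnW.
  have Gj1 : G (z j.+1) by apply: Gz; rewrite (leq_trans (ltn_ord j)) // ltnW.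
  have zj : cx (z j) <= cx (z j.+1) by apply: zle; rewrite (ltn_trans (ltn_ord j)).
  have jm : cx (z j.+1) <= cx (z m).
    have hmono k : (k <= m)%N -> cx (z (m - k)) <= cx (z m).
      elim: k => [|k IHk] km; first by rewrite subn0.
      apply: le_trans (IHk (ltnW km)).
      have -> : (m - k)%N = (m - k.+1).+1 by rewrite subnSK.
      by apply: zle; rewrite (leq_ltn_trans (leq_subr _ _)).
    by have := hmono (m - j.+1)%N (leq_subr _ _); rewrite subKn //; exact: ltn_ord.
  rewrite jm andbT; case: (cx p <= _) => //=.
  by case: ifP => // _; exact: e0.
apply: (@le_trans _ _ (e p (z m.+1))); first by apply: esup.
have := esup p (z m.+1) q Gp Gm1 Gq (le_trans h1 zm) h2.
have := e0 _ _ Gm1 Gq h2; lra.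
Qed.

Definition hit (j : nat) (q : C) : bool := cx (z j) < cx q < cx (z j.+1).

(** A window hit by no point of a chain lies inside one of its intervals. *)
Lemma sum_unhit p s : G p -> chain p s ->
  \sum_(j < J | [&& cx p <= cx (z j), cx (z j.+1) <= cx (last p s)
     & ~~ has (hit j) s]) e (z j) (z j.+1) <= chain_sum e p s.
Proof.
have [e0 esup] := ee.
have en0 (j : 'I_J) : 0 <= e (z j) (z j.+1).
  by apply: e0; [apply: Gz; exact: ltnW | exact: Gz | exact: zle].
elim: s p => [|q s IH] p Gp /=.
  move=> _; apply: (@le_trans _ _ (e p p)).
    apply: le_trans (sum_inside (leqnn J) Gp Gp (lexx _)).
    by rewrite [leLHS](eq_bigl (fun j : 'I_J => (cx p <= cx (z j)) && (cx (z j.+1) <= cx p))) // => j; rewrite andbT.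
  by have := esup p p p Gp Gp Gp (lexx _) (lexx _); lra.
case=> Gq pq hc.
apply: le_trans (lerD (sum_inside (leqnn J) Gp Gq pq) (IH q Gq hc)).
rewrite [leLHS]big_mkcond [X in _ <= X + _]big_mkcond [X in _ <= _ + X]big_mkcond.
rewrite -big_split /=; apply: ler_sum => j _.
have c1 : 0 <= (if (cx p <= cx (z j)) && (cx (z j.+1) <= cx q) then e (z j) (z j.+1) else 0).
  by case: ifP.
have c2 : 0 <= (if [&& cx q <= cx (z j), cx (z j.+1) <= cx (last q s) & ~~ has (hit j) s]
   then e (z j) (z j.+1) else 0) by case: ifP.
case: ifPn => [|_]; last exact: addr_ge0.
rewrite negb_or => /and3P[h1 h2 /andP[h3 h4]].
move: h3; rewrite /hit negb_and -!leNgt => /orP[h3|h3].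
  by rewrite [X in _ <= _ + X]ifT ?h3 ?h2 ?h4 // lerDr.
by rewrite [X in _ <= X + _]ifT ?h1 ?h3 // lerDl.
Qed.
End Windows.

End Contacts.

(** * Windows of a lattice chain *)

Definition turns_right (R : realType) (p q r : contact R) : Prop :=
  (cy r - cy q) * (cx q - cx p) < (cy q - cy p) * (cx r - cx q).

Lemma edge_cross_gt0 (R : realType) (M : nat) (z : nat -> contact R) :
  (forall k, (k < M)%N -> cx (z k) < cx (z k.+1)) ->
  (forall k, (k.+1 < M)%N -> turns_right (z k) (z k.+1) (z k.+2)) ->
  forall i j, (i < j)%N -> (j < M)%N ->
  (cy (z j.+1) - cy (z j)) * (cx (z i.+1) - cx (z i))
   < (cy (z i.+1) - cy (z i)) * (cx (z j.+1) - cx (z j)).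
Proof.
move=> xz tz i j ij jM.
pose mu k := (cy (z k.+1) - cy (z k)) / (cx (z k.+1) - cx (z k)).
have dx k : (k < M)%N -> 0 < cx (z k.+1) - cx (z k) by move=> kM; rewrite subr_gt0 xz.
have muS k : (k.+1 < M)%N -> mu k.+1 < mu k.
  move=> kM; have := tz _ kM; rewrite /turns_right /mu.
  rewrite ltr_pdivrMr ?dx // mulrAC ltr_pdivlMr ?dx //; exact: ltnW.
have mulE : mu j < mu i.
  elim: j ij jM => // j IH; rewrite ltnS leq_eqVlt => /orP[/eqP -> /muS //|ij jM].
  exact: lt_trans (muS _ jM) (IH ij (ltnW jM)).
have di := dx _ (ltn_trans ij jM); have dj := dx _ jM.
by move: mulE; rewrite /mu ltr_pdivrMr // mulrAC ltr_pdivlMr.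
Qed.

Lemma above_ge (R : realType) (G : set (contact R)) (p q r : contact R) :
  concave G -> G p -> G q -> G r -> cx p < cx q -> cx q < cx r ->
  above r q <= above r p.
Proof.
move=> Gc Gp Gq Gr pq qr; have [h _] := Gc; have hs := slope_le Gc Gq Gr qr.
rewrite -subr_ge0.
have -> : above r p - above r q = (cs q - cs r) * (cx q - cx p) + above q p.
  by rewrite /above; ring.
by rewrite addr_ge0 ?h // mulr_ge0 // subr_ge0 // ltW.
Qed.

Lemma strict_triangle (R : realType) (G : set (contact R)) (p q r : contact R) :
  concave G -> G p -> G q -> G r -> cx p < cx q -> cx q < cx r ->
  turns_right p q r -> 0 < above p r /\ 0 < above r p.
Proof.
move=> Gc Gp Gq Gr pq qr; rewrite /turns_right => tr; have [h _] := Gc.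
have x1 : 0 < cx q - cx p by rewrite subr_gt0.
have x2 : 0 < cx r - cx q by rewrite subr_gt0.
have a1 := h _ _ Gp Gq; have a2 := h _ _ Gr Gq.
split.
  have e : above p r = above p q + (cs p * (cx r - cx q) - (cy r - cy q)).
    by rewrite /above; ring.
  rewrite e ltr_wpDl // subr_gt0 -(ltr_pM2r x1); apply: (lt_le_trans tr).
  rewrite mulrAC ler_pM2r //; move: a1; rewrite /above; lra.
have e : above r p = above r q + ((cy q - cy p) - cs r * (cx q - cx p)).
  by rewrite /above; ring.
rewrite e ltr_wpDl // subr_gt0 -(ltr_pM2r x2); apply: le_lt_trans tr.
rewrite mulrAC ler_pM2r //; move: a2; rewrite /above; lra.
Qed.

(** A window of [M] edges in which each division point loses at most the
    proportion [eta] of the affine length is close to the parabola of its tangent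
    triangle.  The basis for [window_rich] consists of the side [p] of the triangle
    and of the axis of the parabola, scaled by [n]; [2 * nu ^+ 2 * alen] bounds the
    cube root [L] of the doubled scaled area since [nu ^+ 3 = n]. *)
Lemma contact_window (R : realType) (C3 C D : R) (M : nat) (delta : R)
    (G : set (contact R)) (B eta nu : R) (n : nat) (z : nat -> contact R)
    (X Y : nat -> int) :
  window_rich C3 C D M delta -> (2 <= M)%N -> 0 <= delta -> concave G -> 1 <= B ->
  (0 < n)%N -> 0 <= nu -> nu ^+ 3 = n%:R ->
  (forall k, (k <= M)%N -> G (z k)) ->
  (forall k, (k < M)%N -> cx (z k) < cx (z k.+1)) ->
  (forall k, (k.+1 < M)%N -> turns_right (z k) (z k.+1) (z k.+2)) ->
  (forall k, (k <= M)%N -> n%:R * cx (z k) = (X k)%:~R /\ n%:R * cy (z k) = (Y k)%:~R) ->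
  `|cs (z 0%N)| <= B -> `|cs (z M)| <= B ->
  2 * nu ^+ 2 * alen (z 0%N) (z M) <= C3 * M%:R ->
  (forall k, (0 < k < M)%N ->
    alen (z 0%N) (z M) - alen (z 0%N) (z k) - alen (z k) (z M)
     <= eta * alen (z 0%N) (z M)) ->
  48 * eta <= (delta / 3) ^+ 2 ->
  forall Lam, Lam = 3 * B * n%:R * (cx (z M) - cx (z 0%N)) ->
  M%:R / 2 <= #|[set i : 'I_M | `[< companion D (C * Lam / M%:R ^+ 2)
     (C * Lam / M%:R) (X i.+1 - X i) (Y i.+1 - Y i) >]]|%:R :> R.
Proof.
move=> rich M2 d0 Gc B1 n0 nu0 nuE Gz xz tz XY sB0 sBM hL hdrop heta Lam LamE.
have xlt i j : (i < j)%N -> (j <= M)%N -> cx (z i) < cx (z j).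
  elim: j => // j IH; rewrite ltnS leq_eqVlt => /orP[/eqP -> /xz //|ij jM].
  exact: lt_trans (IH ij (ltnW jM)) (xz _ jM).
have xle i j : (i <= j)%N -> (j <= M)%N -> cx (z i) <= cx (z j).
  by rewrite leq_eqVlt => /orP[/eqP -> //|ij jM]; apply: ltW; exact: xlt.
have Mp : (0 < M)%N by exact: ltnW.
set p := z 0%N; set r := z M; have Gp : G p by exact: Gz. have Gr : G r by exact: Gz.
have [hG inj] := Gc.
have pr : cx p < cx r by apply: xlt.
pose h := cx r - cx p; have h0 : 0 < h by rewrite subr_gt0.
have a0 : 0 < above p r.
  have G1 : G (z 1%N) by exact: Gz. have G2 : G (z 2%N) by exact: Gz.
  have [+ _] := strict_triangle Gc Gp G1 G2 (xz _ Mp) (xz _ M2) (tz _ M2).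
  move=> /lt_le_trans; apply; apply: (above_le Gc Gp G2 Gr).
    exact: xle.
  exact: xle.
have b0 : 0 < above r p.
  have e1 : M = M.-2.+2 by case: M M2 {rich Gz xz tz XY sBM hL hdrop Lam LamE xlt xle Mp r Gr pr h h0 a0} => [|[|]].
  have m2 : (M.-2.+1 < M)%N by rewrite {2}e1.
  have m1 : (M.-2 < M)%N by exact: ltnW.
  have G1 : G (z M.-2.+1) by apply: Gz; exact: ltnW.
  have G2 : G (z M.-2) by apply: Gz; exact: ltnW.
  have := strict_triangle Gc G2 G1 _ (xz _ m1) (xz _ m2) (tz _ m2).
  rewrite -e1 -/r => /(_ Gr)[_ hpos].
  have [M2z|M2p] := posnP M.-2; first by rewrite /p -M2z.
  apply: (lt_le_trans hpos); apply: (above_ge Gc Gp G2 Gr); apply: xlt => //.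
  exact: ltnW.
have s0 : 0 < cs p - cs r.
  by rewrite -(pmulr_lgt0 _ h0) -above_sum addr_gt0.
pose a := above p r; pose u := above r p / (cs p - cs r).
have u0 : 0 < u by rewrite divr_gt0.
have uh : u <= h.
  by rewrite /u ler_pdivrMr // mulrC -above_sum lerDr ltW.
pose gam k := above p (z k) / a.
have gam0 k : (k <= M)%N -> 0 <= gam k.
  by move=> kM; rewrite divr_ge0 ?(ltW a0) // hG //; exact: Gz.
pose g k := (cx (z k) - cx p - gam k * h) / u + 2 * gam k.
have gamz : gam 0%N = 0 by rewrite /gam above_xx mul0r.
have gamM : gam M = 1 by rewrite /gam -/r divff // gt_eqF.
have nr : 0 < n%:R :> R by rewrite ltr0n.
pose V1 i := X i.+1 - X i; pose V2 i := Y i.+1 - Y i.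
have V1E i : (i < M)%N -> (V1 i)%:~R = n%:R * (cx (z i.+1) - cx (z i)).
  move=> iM; have [e1 _] := XY i (ltnW iM); have [e2 _] := XY i.+1 iM.
  by rewrite /V1 rmorphB /= -e1 -e2 mulrBr.
have V2E i : (i < M)%N -> (V2 i)%:~R = n%:R * (cy (z i.+1) - cy (z i)).
  move=> iM; have [_ e1] := XY i (ltnW iM); have [_ e2] := XY i.+1 iM.
  by rewrite /V2 rmorphB /= -e1 -e2 mulrBr.
have t0 : 0 <= tri p r by apply: (tri_ge0 Gc) => //; exact: ltW.
have n20 : 0 <= 2 * n%:R ^+ 2 * tri p r.
  by apply: mulr_ge0 => //; apply: mulr_ge0 => //; exact: sqr_ge0.
have nh : 0 <= n%:R * h by rewrite mulr_ge0 ?ler0n // ltW.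
have B0 : 0 <= B by exact: le_trans B1.
have nhB : n%:R * h <= Lam.
  rewrite LamE -/h; have -> : 3 * B * n%:R * h = (3 * B) * (n%:R * h) by ring.
  by rewrite ler_peMl //; lra.
have sB : n%:R * (`|cs p| * u) <= B * (n%:R * h).
  rewrite mulrCA; apply: ler_pM => //; last by rewrite ler_pM2l.
  by apply: mulr_ge0; exact: ltW.
have yB : n%:R * `|cy r - cy p| <= B * (n%:R * h).
  rewrite [leRHS]mulrCA ler_pM2l // ler_norml; apply/andP; split.
    apply: (@le_trans _ _ (cs r * h)).
      by have := norm_le_lo sBM; rewrite -/r -mulNr ler_pM2r.
    by move: (ltW b0); rewrite /above /h; lra.
  apply: (@le_trans _ _ (cs p * h)).
    by move: (ltW a0); rewrite /above /h; lra.
  by rewrite ler_pM2r // norm_le_hi.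
apply: (rich V1 V2 (fun k => Num.sqrt (gam k)) g (n%:R * u) (n%:R * (cs p * u))
  (n%:R * (h - 2 * u)) (n%:R * (cy r - cy p - 2 * (cs p * u)))
  (cbrt (2 * n%:R ^+ 2 * tri p r)) Lam).
- move=> i iM; rewrite ler_sqrt ?gam0 //.
  rewrite ler_pM2r ?invr_gt0 //; apply: (above_le Gc) => //; try apply: Gz => //.
  + exact: ltnW.
  + by apply: xle => //; exact: ltnW.
  + exact: ltW (xz _ iM).
- by rewrite gamz sqrtr0.
- by rewrite gamM sqrtr1.
- move=> i; rewrite leq_eqVlt => /orP[/eqP ->|iM].
    by rewrite /g gamM -/r -/h mul1r subrr mul0r add0r sqrtr1 subrr normr0.
  case: i iM => [|i] iM.
    by rewrite /g gamz -/p subrr !mul0r subr0 mul0r mulr0 addr0 sqrtr0 mulr0 subr0 normr0.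
  have d3 : 0 <= delta / 3 by rewrite divr_ge0.
  have Gi : G (z i.+1) by apply: Gz; exact: ltnW.
  have := small_drop_near_parabola Gc Gp Gi Gr (xlt 0%N i.+1 isT (ltnW iM))
    (xlt i.+1 M iM (leqnn _)) s0 a0 b0 (hdrop i.+1 iM) heta d3 (erefl (gam i.+1)) (erefl u).
  by have -> : 3 * (delta / 3) = delta by field.
- exact: cbrt_ge0.
- rewrite cbrtK // /tri /u -/a.
  have -> : cy r - cy p = cs p * h - a by rewrite /a /above /h; ring.
  by field; rewrite gt_eqF.
- apply: le_trans hL; apply: cube_le; rewrite ?cbrt_ge0 //.
    by rewrite !mulr_ge0 ?alen_ge0 ?exprn_ge0.
  have -> : (2 * nu ^+ 2 * alen p r) ^+ 3 = 8 * (nu ^+ 3) ^+ 2 * alen p r ^+ 3 by ring.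
  rewrite cbrtK // (alenK Gc) ?(ltW pr) // nuE.
  by rewrite ler_wpM2r // ler_wpM2r ?sqr_ge0 // ler_nat.
- split.
  + rewrite ger0_norm; last by rewrite mulr_ge0 // ltW.
    by apply: le_trans nhB; rewrite ler_pM2l.
  + rewrite normrM normrM (ger0_norm (ltW nr)) (ger0_norm (ltW u0)).
    apply: (le_trans sB); rewrite LamE -/h.
    have := mulr_ge0 B0 nh; lra.
  + rewrite normrM (ger0_norm (ltW nr)); apply: le_trans nhB.
    rewrite ler_pM2l // ler_norml; apply/andP; split; lra.
  + rewrite normrM (ger0_norm (ltW nr)).
    apply: (@le_trans _ _ (n%:R * (`|cy r - cy p| + 2 * (`|cs p| * u)))).
      rewrite ler_pM2l //; apply: (le_trans (ler_normB _ _)).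
      by rewrite lerD2l [ `|2 * _| ]normrM [ `|cs p * u| ]normrM (ger0_norm (ltW u0)) ger0_norm.
    rewrite LamE -/h mulrDr; move: yB sB.
    have -> : n%:R * (2 * (`|cs p| * u)) = 2 * (n%:R * (`|cs p| * u)) by ring.
    have -> : 3 * B * n%:R * h = 3 * (B * (n%:R * h)) by ring.
    by move: (n%:R * _) (n%:R * (_ * u)) (B * _) => t1 t2 t3; clear; lra.
- move=> i iM; have iM' := ltnW iM.
  rewrite !sqr_sqrtr ?gam0 // V1E // V2E //; split.
    by rewrite /g; field; rewrite gt_eqF.
  have gE k : cy (z k) = cy p + cs p * (cx (z k) - cx p) - a * gam k.
    by rewrite /gam mulrCA divff ?mulr1 ?gt_eqF // /above; ring.
  have -> : cy r - cy p = cs p * h - a by rewrite /a /above /h; ring.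
  by rewrite (gE i) (gE i.+1) /g; field; rewrite gt_eqF.
- move=> i j ij jM; have hc := edge_cross_gt0 xz tz ij jM.
  have iM := ltn_trans ij jM.
  suff : 0 < V2 i * V1 j - V1 i * V2 j by [].
  rewrite -(ltr_int R) rmorphB !rmorphM /= !V1E ?V2E //.
  have -> : n%:R * (cy (z i.+1) - cy (z i)) * (n%:R * (cx (z j.+1) - cx (z j))) -
    n%:R * (cx (z i.+1) - cx (z i)) * (n%:R * (cy (z j.+1) - cy (z j))) =
    n%:R ^+ 2 * ((cy (z i.+1) - cy (z i)) * (cx (z j.+1) - cx (z j))
     - (cy (z j.+1) - cy (z j)) * (cx (z i.+1) - cx (z i))) by ring.
  by rewrite mulr_gt0 ?exprn_gt0 // subr_gt0.
Qed.

(** The triangle spanned by a point of an arc and its end points lies in the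
    tangent triangle of the arc. *)
Lemma cross_le_tri (R : realType) (G : set (contact R)) (p q r : contact R) :
  concave G -> G p -> G q -> G r -> cx p < cx q -> cx q < cx r ->
  turns_right p q r ->
  (cy q - cy p) * (cx r - cx q) - (cy r - cy q) * (cx q - cx p) <= tri p r.
Proof.
move=> Gc Gp Gq Gr pq qr tr.
have [a0 b0] := strict_triangle Gc Gp Gq Gr pq qr tr.
have pr := lt_trans pq qr.
have s0 : 0 < cs p - cs r.
  by rewrite -(@pmulr_lgt0 _ (cx r - cx p)) ?subr_gt0 // -above_sum addr_gt0.
have [s [t [k [[hs ht hk] [_ _ f3 f4]]]]] := tri_split Gc Gp Gq Gr pq qr s0 a0 b0.
set beta := _ + k * (1 - t) in f4.
have -> : (cy q - cy p) * (cx r - cx q) - (cy r - cy q) * (cx q - cx p) =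
   above p r * (cx q - cx p) - above p q * (cx r - cx p) by rewrite /above; ring.
rewrite f3.
have -> : above p r * (cx q - cx p) - k * t * above p r * (cx r - cx p) =
   above p r * (cx q - cx p - k * t * (cx r - cx p)) by ring.
have -> : cx q - cx p - k * t * (cx r - cx p) = beta * (above r p / (cs p - cs r)).
  by rewrite {1}f4 addrK.
have -> : above p r * (beta * (above r p / (cs p - cs r))) = beta * tri p r.
  by rewrite /tri; ring.
rewrite ler_piMl //; first by rewrite (tri_ge0 Gc) // ltW.
case/andP: hs => s1 s2; case/andP: ht => t1 t2; case/andP: hk => k1 k2.
have h1 : (1 - k) * s <= (1 - k) * 1 by rewrite ler_wpM2l // subr_ge0.
have h2 : k * (1 - t) <= k * 1 by rewrite ler_wpM2l // gerBl.
by rewrite /beta; lra.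
Qed.

Lemma normz_le_truncn (R : realType) (x : int) (k : R) :
  (`|x|)%:~R <= k -> `|x| <= (Num.truncn k)%:Z.
Proof.
move=> h; have k0 : 0 <= k by apply: le_trans h; rewrite ler0z.
by rewrite -abszE in h *; rewrite lez_nat truncn_ge_nat.
Qed.

Lemma card_companions (R : realType) (T : finType) (A : {set T}) (V1 V2 : T -> int)
   (D r K : R) : 0 <= D -> 1 <= r -> 1 <= K ->
  {in A &, injective (fun t => (V1 t, V2 t))} ->
  {in A, forall t, companion D r K (V1 t) (V2 t)} ->
  #|A|%:R <= 18 * (2 * D + 1) ^+ 2 * (K * r).
Proof.
move=> D0 r1 K1 inj hA.
have /choice[w hw] : forall t, exists w : int * int, t \in A ->
   [/\ 0 < `|V1 t * w.2 - V2 t * w.1|,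
    (`|V1 t * w.2 - V2 t * w.1|)%:~R <= D,
    (`|w.1|)%:~R <= r /\ (`|w.2|)%:~R <= r & (`|V1 t|)%:~R <= K /\ (`|V2 t|)%:~R <= K].
  move=> t; case: (boolP (t \in A)) => [/hA[w1 [w2 h]]|_]; last by exists (0, 0).
  by exists (w1, w2).
have := @card_pairs T A V1 V2 (fun t => (w t).1) (fun t => (w t).2)
  (Num.truncn K) (Num.truncn r) (Num.truncn D) inj.
have hin : {in A, forall t, [/\ `|V1 t| <= (Num.truncn K)%:Z, `|V2 t| <= (Num.truncn K)%:Z,
    `|(w t).1| <= (Num.truncn r)%:Z, `|(w t).2| <= (Num.truncn r)%:Z
    & 0 < `|V1 t * (w t).2 - V2 t * (w t).1| <= (Num.truncn D)%:Z]}.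
  move=> t /hw[h1 h2 [h3 h4] [h5 h6]].
  by split; rewrite ?h1 /=; apply: normz_le_truncn; rewrite ?normr_id.
move=> /(_ hin) h.
apply: (@le_trans _ _ _ _ _ (_ : (#|A|%:R <= _%:R)%R)); first by rewrite ler_nat; exact: h.
rewrite !natrM.
have tr (k : R) : 0 <= k -> (2 * Num.truncn k).+1%:R <= 2 * k + 1.
  by move=> k0; rewrite mulrS natrM addrC lerD2r ler_pM2l // truncn_le.
have K0 : 0 <= K by exact: le_trans K1.
have r0 : 0 <= r by exact: le_trans r1.
have hK : (2 * Num.truncn K).+1%:R <= 3 * K by apply: (le_trans (tr K K0)); lra.
have hr : (2 * Num.truncn r).+1%:R <= 3 * r by apply: (le_trans (tr r r0)); lra.
have hD := tr D D0.
rewrite (_ : 18 * (2 * D + 1) ^+ 2 * (K * r) =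
  2 * (3 * K * (3 * r) * ((2 * D + 1) * (2 * D + 1)))); last by ring.
by rewrite ler_pM2l //; apply: ler_pM; [exact: mulr_ge0|exact: mulr_ge0|exact: ler_pM|exact: ler_pM].
Qed.

Lemma card_pair_sets (I J : finType) (P : I -> J -> bool) (W : {set I}) (m : nat) :
  (forall i, i \in W -> (m <= #|[set k | P i k]|)%N) ->
  (#|W| * m <= #|[set t : I * J | P t.1 t.2]|)%N.
Proof.
move=> hW; rewrite -[leqRHS]sum1_card [leqRHS]big_mkcond /=.
rewrite [leqRHS](eq_bigr (fun t : I * J => (if P t.1 t.2 then 1 else 0)%N)); last first.
  by move=> t _; rewrite inE.
rewrite -(pair_bigA _ (fun i k => (if P i k then 1 else 0)%N)) /=.
rewrite -sum_nat_const [leqLHS]big_mkcond /=; apply: leq_sum => i _.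
case: ifP => // iW; apply: (leq_trans (hW i iW)).
by rewrite -[leqLHS]sum1_card [leqLHS]big_mkcond /=; apply: leq_sum => k _; rewrite inE.
Qed.

Lemma markov_eighth (R : realType) (J : nat) (f : 'I_J -> R) (S : R) :
  (0 < J)%N -> 0 < S -> (forall j, 0 <= f j) -> \sum_j f j <= S ->
  #|[set j | 8 * S / J%:R < f j]|%:R <= J%:R / 8 :> R.
Proof.
move=> J0 S0 f0 hS; have Jp : 0 < J%:R :> R by rewrite ltr0n.
have := markov_card (8 * S / J%:R) f0 hS.
set c := #|_|%:R => h.
rewrite -(ler_pM2r S0).
have -> : c * S = (8 * S / J%:R * c) * (J%:R / 8) by field; rewrite gt_eqF.
by rewrite [leRHS]mulrC ler_wpM2r // divr_ge0.
Qed.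

Section GoodWindows.
Variables (R : realType) (G : set (contact R)) (lo hi : contact R).
Hypothesis Gc : concave G.
Hypothesis Glo : G lo.
Hypothesis Ghi : G hi.
Hypothesis Gin : forall p, G p -> cx lo <= cx p <= cx hi.
Variables (z : nat -> contact R) (J : nat).
Hypothesis Gz : forall j, (j <= J)%N -> G (z j).
Hypothesis zlt : forall j, (j < J)%N -> cx (z j) < cx (z j.+1).

Lemma windows_monotone i j : (i <= j <= J)%N -> cx (z i) <= cx (z j).
Proof.
elim: j => [|j IH]; first by case/andP; rewrite leqn0 => /eqP ->.
case/andP; rewrite leq_eqVlt => /orP[/eqP -> //|]; rewrite ltnS => ij jM.
by apply: (le_trans (IH _)); [rewrite ij ltnW | apply: ltW; exact: zlt].
Qed.

Lemma sum_windows (e : contact R -> contact R -> R) : superadditive G e ->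
  \sum_(j < J) e (z j) (z j.+1) <= e lo hi.
Proof.
move=> es; have lohi : cx lo <= cx hi by have /andP[] := Gin Ghi.
apply: le_trans (sum_inside es Gz (fun j h => ltW (zlt h)) (leqnn J) Glo Ghi lohi).
rewrite [leRHS](eq_bigl xpredT) // => j.
have /andP[h1 _] := Gin (Gz (ltnW (ltn_ord j))).
by have /andP[_ h2] := Gin (Gz (ltn_ord j)); rewrite h1 h2.
Qed.

Lemma card_hit1 (q : contact R) : (#|[set j : 'I_J | hit z j q]| <= 1)%N.
Proof.
apply/card_le1P => i; rewrite inE => /andP[i1 i2] j; rewrite !inE.
apply/idP/eqP => [/andP[j1 j2]|-> //]; last by rewrite /hit i1 i2.
apply/val_inj; case: (ltngtP j i) => // ij.
  have := @windows_monotone j.+1 i; rewrite ij ltnW // => /(_ isT) h.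
  by have := lt_trans j2 (le_lt_trans h i1); rewrite ltxx.
have := @windows_monotone i.+1 j; rewrite ij ltnW // => /(_ isT) h.
by have := lt_trans i2 (le_lt_trans h j1); rewrite ltxx.
Qed.

Lemma card_hit (s : seq (contact R)) :
  (#|[set j : 'I_J | has (hit z j) s]| <= size s)%N.
Proof.
elim: s => [|q s IH] /=.
  by rewrite leqn0 cards_eq0; apply/eqP/setP => j; rewrite !inE.
have -> : [set j : 'I_J | hit z j q || has (hit z j) s] =
   [set j : 'I_J | hit z j q] :|: [set j : 'I_J | has (hit z j) s].
  by apply/setP => j; rewrite !inE.
apply: (leq_trans _ (leq_add (card_hit1 q) IH)).
by rewrite cardsU leq_subr.
Qed.

(** The widths, affine lengths and defects of the windows have bounded sums; by
    Markov's inequality each exceeds eight times its average for at most an eighth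
    of the windows.  The defects are summed over windows not hit by the chain [s],
    which hits at most [size s] of them. *)
Lemma many_good_windows (s : seq (contact R)) (w F eta : R) :
  (0 < J)%N -> (8 * size s <= J)%N ->
  chain G lo s -> last lo s = hi -> chain_sum (defect G) lo s <= eta ->
  0 < eta -> 0 < w -> cx hi - cx lo <= w -> 0 < F -> alen lo hi <= F ->
  J%:R / 2 <= #|[set j : 'I_J | [&& cx (z j.+1) - cx (z j) <= 8 * w / J%:R,
     alen (z j) (z j.+1) <= 8 * F / J%:R
   & defect G (z j) (z j.+1) <= 8 * eta / J%:R]]|%:R :> R.
Proof.
move=> J0 sJ cs ls hs eta0 w0 hw F0 hF.
set W := [set j | _].
have [ew _] := superadditive_width G; have [ea _] := superadditive_alen Gc.
have [ed _] := superadditive_defect Gc.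
pose f1 (j : 'I_J) := cx (z j.+1) - cx (z j).
pose f2 (j : 'I_J) := alen (z j) (z j.+1).
pose f3 (j : 'I_J) := if has (hit z j) s then 0 else defect G (z j) (z j.+1).
have b1 := @markov_eighth R J f1 w J0 w0 _ (le_trans (sum_windows (superadditive_width G)) hw).
have b2 := @markov_eighth R J f2 F J0 F0 _ (le_trans (sum_windows (superadditive_alen Gc)) hF).
have G0 (j : 'I_J) : G (z j) by apply: Gz; exact: ltnW.
have G1 (j : 'I_J) : G (z j.+1) by exact: Gz.
have zj (j : 'I_J) : cx (z j) <= cx (z j.+1) by apply: ltW; exact: zlt.
have {}b1 := b1 (fun j => ew _ _ (G0 j) (G1 j) (zj j)).
have {}b2 := b2 (fun j => ea _ _ (G0 j) (G1 j) (zj j)).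
have f30 j : 0 <= f3 j by rewrite /f3; case: ifP => // _; exact: ed.
have hf3 : \sum_j f3 j <= eta.
  apply: le_trans hs.
  apply: le_trans (sum_unhit (superadditive_defect Gc) Gz (fun j h => ltW (zlt h)) Glo cs).
  rewrite [leRHS]big_mkcond /=; apply: ler_sum => j _; rewrite /f3.
  have /andP[h1 _] := Gin (G0 j); have /andP[_ h2] := Gin (G1 j).
  by rewrite ls h1 h2 /=; case: (has _ s).
have b3 := markov_eighth J0 eta0 f30 hf3.
have b4 := card_hit s.
set B1 := [set j | _ < f1 j] in b1; set B2 := [set j | _ < f2 j] in b2.
set B3 := [set j | _ < f3 j] in b3; set B4 := [set j : 'I_J | has _ s] in b4.
have cover j : j \in W :|: (B1 :|: (B2 :|: (B3 :|: B4))).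
  rewrite !inE !leNgt -/(f1 j) -/(f2 j) /f3.
  by do 2 (case: (_ < _) => //=); case: (has _ s); rewrite ?orbT //=; case: (_ < _).
have hc : (J <= #|W :|: (B1 :|: (B2 :|: (B3 :|: B4)))|)%N.
  by rewrite -[leqLHS]card_ord; apply: subset_leq_card; apply/fintype.subsetP.
have hU : (J <= #|W| + (#|B1| + (#|B2| + (#|B3| + #|B4|))))%N.
  apply: (leq_trans hc); rewrite !cardsU.
  do 3 (apply: (leq_trans (leq_subr _ _)); rewrite leq_add2l).
  exact: leq_subr.
have hU' : J%:R <= #|W|%:R + (#|B1|%:R + (#|B2|%:R + (#|B3|%:R + #|B4|%:R))) :> R.
  by rewrite -!natrD ler_nat.
have b4' : 8 * #|B4|%:R <= J%:R :> R.
  by rewrite -natrM ler_nat; apply: leq_trans sJ; rewrite leq_mul2l.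
by clear -b1 b2 b3 b4' hU'; lra.
Qed.
End GoodWindows.

Lemma companion_weaken (R : realType) (D r K r' K' : R) (v1 v2 : int) :
  r <= r' -> K <= K' -> companion D r K v1 v2 -> companion D r' K' v1 v2.
Proof.
move=> hr hK [w1 [w2 [h1 h2 [h3 h4] [h5 h6]]]]; exists w1, w2; split => //.
  by split; apply: le_trans hr.
by split; apply: le_trans hK.
Qed.

Record lattice_chain (R : realType) (G : set (contact R)) (n N : nat)
  (z : nat -> contact R) (X Y : nat -> int) : Prop := LatticeChain {
  lc_in : forall k, (k < N)%N -> G (z k);
  lc_lt : forall k, (k.+1 < N)%N -> cx (z k) < cx (z k.+1);
  lc_turn : forall k, (k.+2 < N)%N -> turns_right (z k) (z k.+1) (z k.+2);
  lc_int : forall k, (k < N)%N ->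
    n%:R * cx (z k) = (X k)%:~R /\ n%:R * cy (z k) = (Y k)%:~R }.

Section LatticeChain.
Variables (R : realType) (G : set (contact R)) (n N : nat).
Variables (z : nat -> contact R) (X Y : nat -> int).
Hypothesis lc : lattice_chain G n N z X Y.

Lemma lc_ltn i j : (i < j)%N -> (j < N)%N -> cx (z i) < cx (z j).
Proof.
elim: j => // j IH; rewrite ltnS leq_eqVlt => /orP[/eqP -> /(lc_lt lc) //|ij jM].
exact: lt_trans (IH ij (ltnW jM)) (lc_lt lc jM).
Qed.

(** The edges of a strictly convex chain have different directions. *)
Lemma lc_edges_inj i j : (0 < n)%N -> (i.+1 < N)%N -> (j.+1 < N)%N ->
  X i.+1 - X i = X j.+1 - X j -> Y i.+1 - Y i = Y j.+1 - Y j -> i = j.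
Proof.
move=> n0.
have key a b : (a < b)%N -> (b.+1 < N)%N ->
   X a.+1 - X a = X b.+1 - X b -> Y a.+1 - Y a = Y b.+1 - Y b -> False.
  move=> ab bN eX eY.
  have N1 : N.-1.+1 = N by rewrite prednK // (leq_ltn_trans _ bN).
  have ltE k : (k < N.-1)%N = (k.+1 < N)%N by rewrite -ltnS N1.
  have z1 k : (k < N.-1)%N -> cx (z k) < cx (z k.+1) by rewrite ltE; exact: (lc_lt lc).
  have z2 k : (k.+1 < N.-1)%N -> turns_right (z k) (z k.+1) (z k.+2).
    by rewrite ltE; exact: (lc_turn lc).
  have := edge_cross_gt0 z1 z2 ab; rewrite ltE => /(_ bN).
  have np : 0 < n%:R :> R by rewrite ltr0n.
  have e k : (k.+1 < N)%N -> (X k.+1 - X k)%:~R = n%:R * (cx (z k.+1) - cx (z k)) /\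
     (Y k.+1 - Y k)%:~R = n%:R * (cy (z k.+1) - cy (z k)).
    move=> kN; have [x1 y1] := lc_int lc (ltnW kN); have [x2 y2] := lc_int lc kN.
    by rewrite !rmorphB /= -x1 -x2 -y1 -y2 !mulrBr.
  have [xa ya] := e a (leq_ltn_trans ab (ltnW bN)).
  have [xb yb] := e b bN.
  have ex : cx (z a.+1) - cx (z a) = cx (z b.+1) - cx (z b).
    by apply: (mulfI (lt0r_neq0 np)); rewrite -xa -xb eX.
  have ey : cy (z a.+1) - cy (z a) = cy (z b.+1) - cy (z b).
    by apply: (mulfI (lt0r_neq0 np)); rewrite -ya -yb eY.
  by rewrite ex ey ltxx.
move=> iN jN eX eY; case: (ltngtP i j) => // ij; exfalso.
  exact: (key i j).
exact: (key j i).
Qed.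

(** The doubled area of a lattice triangle is at least [n ^- 2], and
    [nu ^+ 2 * alen] is the cube root of [n ^+ 2 * tri]. *)
Lemma lc_alen_lb (nu : R) i j : concave G -> (0 < n)%N -> 0 <= nu -> nu ^+ 3 = n%:R ->
  (i.+2 <= j)%N -> (j < N)%N -> 1 <= nu ^+ 2 * alen (z i) (z j).
Proof.
move=> Gc n0 nu0 nuE ij jN.
have iN2 : (i.+2 < N)%N by exact: leq_ltn_trans jN.
have iN1 : (i.+1 < N)%N by exact: ltnW.
have iN : (i < N)%N by exact: ltnW.
have [G0 G1 G2 Gj] : [/\ G (z i), G (z i.+1), G (z i.+2) & G (z j)].
  by split; exact: (lc_in lc).
have x01 := lc_lt lc iN1; have x12 := lc_lt lc iN2.
have x02 := lt_trans x01 x12.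
have tr := lc_turn lc iN2.
have hc := cross_le_tri Gc G0 G1 G2 x01 x12 tr.
have h1 : 1 <= nu ^+ 2 * alen (z i) (z i.+2).
  apply: cube_le => //; first by rewrite mulr_ge0 ?alen_ge0 ?sqr_ge0.
  have -> : (nu ^+ 2 * alen (z i) (z i.+2)) ^+ 3 =
    (nu ^+ 3) ^+ 2 * alen (z i) (z i.+2) ^+ 3 by ring.
  rewrite expr1n (alenK Gc G0 G2 (ltW x02)) nuE.
  apply: (@le_trans _ _ (n%:R ^+ 2 * ((cy (z i.+1) - cy (z i)) * (cx (z i.+2) - cx (z i.+1)) -
     (cy (z i.+2) - cy (z i.+1)) * (cx (z i.+1) - cx (z i))))); last first.
    by rewrite ler_wpM2l ?sqr_ge0.
  have [x1 y1] := lc_int lc iN; have [x2 y2] := lc_int lc iN1; have [x3 y3] := lc_int lc iN2.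
  set q := (_ * _ - _ * _).
  have qE : n%:R ^+ 2 * q = ((Y i.+1 - Y i) * (X i.+2 - X i.+1) - (Y i.+2 - Y i.+1) * (X i.+1 - X i))%:~R.
    by rewrite !(rmorphB, rmorphM) /= -x1 -x2 -x3 -y1 -y2 -y3 /q; ring.
  have q0 : 0 < n%:R ^+ 2 * q.
    by rewrite mulr_gt0 ?exprn_gt0 ?ltr0n // subr_gt0.
  by move: q0; rewrite qE (ltr_int R 0) (ler_int R 1).
apply: (le_trans h1); rewrite ler_wpM2l ?sqr_ge0 //.
case: (ltngtP i.+2 j) ij => // [ij _|-> _] //.
have xj : cx (z i.+2) <= cx (z j) by apply: ltW; exact: lc_ltn.
have := alen_superadd Gc G0 G2 Gj (ltW x02) xj; have := alen_ge0 (z i.+2) (z j).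
by lra.
Qed.
End LatticeChain.

(** The theorem for concave graphs.  If the bound fails, there are about
    [eps nu^2 / M] windows of [M] edges; half of them are good, and half of the
    edges of a good window have companions, of size at most [kap * nu / M] against
    [kap * nu] for the edges.  The count of [card_companions] gives at most
    [18 (2 D + 1)^2 kap^2 nu^2 / M] such edges, which is less than the lower bound
    [eps nu^2 / 8] for their number because [M] exceeds [Q].  Only then is [delta]
    chosen, and with it the tolerated loss [eta] and the chain [s]; the terms of
    [nu0] make the number of windows large compared to [size s], the number of
    lattice points large compared to [M], and [kap * nu / M] at least 1. *)
Lemma lattice_chain_small (R : realType) (G : set (contact R)) (lo hi : contact R)
    (B eps : R) :
  concave G -> G lo -> G hi -> (forall p, G p -> cx lo <= cx p <= cx hi) ->
  cx hi - cx lo <= B -> (forall p, G p -> `|cs p| <= B) -> 1 <= B -> 0 < eps ->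
  exists nu0 : R, forall (n N : nat) (nu : R) (z : nat -> contact R) (X Y : nat -> int),
    nu0 <= nu -> nu ^+ 3 = n%:R -> lattice_chain G n N z X Y ->
    N%:R <= eps * nu ^+ 2.
Proof.
move=> Gc Glo Ghi Gin Bw Bs B1 eps0.
have lohi : cx lo <= cx hi by have /andP[] := Gin _ Ghi.
pose F0 := alen lo hi + 1.
have F00 : 0 < F0 by rewrite ltr_wpDl ?alen_ge0.
have B0 : 0 < B by exact: lt_le_trans B1.
pose C3 := 32 * F0 / eps + 1.
have C31 : 1 <= C3 by rewrite lerDr divr_ge0 ?(ltW eps0) // mulr_ge0 // ltW.
have [C [D [C1 D1 [M0 [M00 hM0]]]]] := parabolic_window C31.
have C0 : 0 < C by exact: lt_le_trans C1.
have D0 : 0 <= D by exact: le_trans D1.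
pose kap := 48 * C * B ^+ 2 / eps.
have kap0 : 0 < kap.
  by apply: divr_gt0 => //; apply: mulr_gt0; [exact: mulr_gt0 | exact: exprn_gt0].
pose Q := 144 * (2 * D + 1) ^+ 2 * kap ^+ 2 / eps.
pose m := maxn M0 (Num.truncn Q).+1.
pose M := m.*2.
have m0 : (0 < m)%N by rewrite /m leq_max orbT.
have M2 : (2 <= M)%N by rewrite /M -(doubleS 0) leq_double.
have mM : (m <= M)%N by rewrite /M -addnn leq_addr.
have MM0 : (M0 <= M)%N by exact: leq_trans (leq_maxl _ _) mM.
have MQ : Q < M%:R.
  apply: (lt_le_trans (truncnS_gt Q)); rewrite ler_nat.
  exact: leq_trans (leq_maxr _ _) mM.
have M0' : (0 < M)%N by exact: ltnW.
have Mp : 0 < M%:R :> R by rewrite ltr0n.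
have ME : M%:R = 2 * m%:R :> R by rewrite /M -muln2 natrM mulrC.
have [delta d0 rich] := hM0 M MM0.
pose eta := (delta / 3) ^+ 2 / 48.
have eta0 : 0 < eta.
  by apply: divr_gt0 => //; apply: exprn_gt0; exact: divr_gt0.
pose eta' := eta * eps / (16 * M%:R).
have eta'0 : 0 < eta' by apply: divr_gt0; exact: mulr_gt0.
have [s [cs ls hs]] := small_defect_chain Glo Ghi lohi eta'0.
exists (1 + 2 * M%:R / eps + 16 * M%:R * (size s)%:R / eps + M%:R / kap).
move=> n N nu z X Y hnu nuE lc; rewrite leNgt; apply/negP => hN.
have q1 : 0 <= 2 * M%:R / eps by apply: divr_ge0; [apply: mulr_ge0|exact: ltW].
have q2 : 0 <= 16 * M%:R * (size s)%:R / eps.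
  by apply: divr_ge0; [apply: mulr_ge0 => //; apply: mulr_ge0|exact: ltW].
have q3 : 0 <= M%:R / kap by apply: divr_ge0 => //; exact: ltW.
have nu1 : 1 <= nu by clear -hnu q1 q2 q3; lra.
have nup : 0 < nu by exact: lt_le_trans nu1.
have nu2 : nu <= nu ^+ 2 by rewrite expr2 ler_peMl // ltW.
have nu2p : 0 < nu ^+ 2 by exact: exprn_gt0.
have n0 : (0 < n)%N by rewrite -(ltr0n R) -nuE exprn_gt0.
have a1 : 2 * M%:R <= eps * nu ^+ 2.
  rewrite [leRHS]mulrC -ler_pdivrMr //; apply: le_trans nu2; clear -hnu q1 q2 q3; lra.
have a2 : 16 * M%:R * (size s)%:R <= eps * nu ^+ 2.
  rewrite [leRHS]mulrC -ler_pdivrMr //; apply: le_trans nu2; clear -hnu q1 q2 q3; lra.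
have a3 : M%:R <= kap * nu.
  rewrite [leRHS]mulrC -ler_pdivrMr //; clear -hnu q1 q2 q3; lra.
have N0 : (0 < N)%N.
  by rewrite -(ltr0n R); apply: lt_trans hN; exact: mulr_gt0.
pose J := (N.-1 %/ M)%N.
have JMN : (J * M < N)%N by rewrite -[N in (_ < N)%N]prednK // ltnS leq_trunc_div.
have NJ : (N <= J * M + M)%N.
  by rewrite -[leqLHS]prednK // addnC -mulSn; exact: ltn_ceil.
have JM : eps * nu ^+ 2 / 2 <= J%:R * M%:R.
  have : N%:R <= J%:R * M%:R + M%:R :> R by rewrite -natrM -natrD ler_nat.
  clear -hN a1; lra.
have Jp : 0 < J%:R :> R.
  by rewrite -(pmulr_lgt0 _ Mp); apply: lt_le_trans JM; apply: divr_gt0 => //; exact: mulr_gt0.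
have J0 : (0 < J)%N by rewrite -(ltr0n R).
have Jinv (t : R) : 0 <= t -> 8 * t / J%:R <= 16 * t * M%:R / (eps * nu ^+ 2).
  move=> t0; rewrite ler_pdivrMr // mulrAC ler_pdivlMr ?mulr_gt0 //.
  have : t * (eps * nu ^+ 2 / 2) <= t * (J%:R * M%:R) by exact: ler_wpM2l.
  clear; lra.
have sJ : (8 * size s <= J)%N.
  rewrite -(ler_nat R) natrM -(ler_pM2r Mp); apply: le_trans JM.
  clear -a2; lra.
pose zz j := z (j * M)%N.
have jM j : (j <= J)%N -> (j * M < N)%N.
  by move=> jJ; apply: leq_ltn_trans JMN; rewrite leq_mul2r jJ orbT.
have jkM j k : (j < J)%N -> (k <= M)%N -> (j * M + k < N)%N.
  by move=> jJ kM; apply: leq_ltn_trans (jM j.+1 jJ); rewrite mulSn addnC leq_add2r.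
have Gzz j : (j <= J)%N -> G (zz j) by move=> /jM; exact: (lc_in lc).
have zzlt j : (j < J)%N -> cx (zz j) < cx (zz j.+1).
  by move=> jJ; apply: (lc_ltn lc); rewrite ?jM // mulSn -[ltnLHS]add0n ltn_add2r.
have F0le : alen lo hi <= F0 by rewrite lerDl.
have hW := many_good_windows Gc Glo Ghi Gin Gzz zzlt J0 sJ cs ls hs eta'0 B0 Bw F00 F0le.
set W := [set j | _] in hW.
pose V1 i := X i.+1 - X i; pose V2 i := Y i.+1 - Y i.
pose P (j : 'I_J) (k : 'I_M) := `[< companion D (kap * nu / M%:R) (kap * nu)
   (V1 (j * M + k)%N) (V2 (j * M + k)%N) >].
have hP j : j \in W -> (m <= #|[set k | P j k]|)%N.
  rewrite inE => /and3P[w1 w2 w3].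
  have jJ := ltn_ord j.
  have wend : zz j.+1 = z (j * M + M)%N by rewrite /zz mulSn addnC.
  have w1' := le_trans w1 (Jinv _ (ltW B0)).
  have w2' := le_trans w2 (Jinv _ (ltW F00)).
  have w3' := le_trans w3 (Jinv _ (ltW eta'0)).
  have lb : 1 <= nu ^+ 2 * alen (zz j) (zz j.+1).
    apply: (lc_alen_lb lc Gc n0 (ltW nup) nuE); last exact: jM.
    by rewrite mulSn addnC -addn2 leq_add2l.
  have e3 : 16 * eta' * M%:R / (eps * nu ^+ 2) = eta * (1 / nu ^+ 2).
    by rewrite /eta'; field; rewrite !gt_eqF.
  have e3' : defect G (zz j) (zz j.+1) <= eta * alen (zz j) (zz j.+1).
    apply: (le_trans w3'); rewrite e3 ler_pM2l // ler_pdivrMr // mulrC //.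
  have h := @contact_window R C3 C D M delta G B eta nu n
    (fun k => z (j * M + k)%N) (fun k => X (j * M + k)%N) (fun k => Y (j * M + k)%N)
    rich M2 (ltW d0) Gc B1 n0 (ltW nup) nuE.
  have {}h := h (fun k hk => lc_in lc (jkM j k jJ hk)).
  have hlt k (hk : (k < M)%N) : cx (z (j * M + k)%N) < cx (z (j * M + k.+1)%N).
    by rewrite addnS; apply: (lc_lt lc); rewrite -addnS; exact: jkM.
  have hturn k (hk : (k.+1 < M)%N) :
      turns_right (z (j * M + k)%N) (z (j * M + k.+1)%N) (z (j * M + k.+2)%N).
    by have := jkM j k.+2 jJ hk; rewrite !addnS; exact: (lc_turn lc).
  have {}h := h hlt hturn (fun k hk => lc_int lc (jkM j k jJ hk)).
  rewrite /= addn0 -wend -/(zz j) in h.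
  have {}h := h (Bs _ (Gzz _ (ltnW jJ))) (Bs _ (Gzz _ jJ)).
  have len : 2 * nu ^+ 2 * alen (zz j) (zz j.+1) <= C3 * M%:R.
    apply: (@le_trans _ _ (2 * nu ^+ 2 * (16 * F0 * M%:R / (eps * nu ^+ 2)))).
      by rewrite ler_wpM2l // mulr_ge0 // ltW.
    have -> : 2 * nu ^+ 2 * (16 * F0 * M%:R / (eps * nu ^+ 2)) = 32 * F0 / eps * M%:R.
      by field; rewrite !gt_eqF.
    by rewrite ler_pM2r // lerDl.
  have hdrop k : (0 < k < M)%N ->
      alen (zz j) (zz j.+1) - alen (zz j) (z (j * M + k)%N) -
      alen (z (j * M + k)%N) (zz j.+1) <= eta * alen (zz j) (zz j.+1).
    move=> /andP[k0 kM]; apply: le_trans e3'.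
    have kN := jkM j k jJ (ltnW kM).
    apply: defect_ge.
    - exact: (lc_in lc).
    - exact: Gzz.
    - by apply/ltW/(lc_ltn lc) => //; rewrite -[ltnLHS]addn0 ltn_add2l.
    - rewrite wend; apply/ltW/(lc_ltn lc); first by rewrite ltn_add2l.
      exact: jkM.
  have e48 : 48 * eta <= (delta / 3) ^+ 2.
    by rewrite /eta mulrC divfK // pnatr_eq0.
  have {}h := h len hdrop e48 _ erefl.
  set Lam := _ * (_ - _) in h.
  have LamLe : C * Lam <= kap * nu * M%:R.
    have h1 : n%:R * (cx (zz j.+1) - cx (zz j)) <= n%:R * (16 * B * M%:R / (eps * nu ^+ 2)).
      by rewrite ler_wpM2l.
    have h2 : n%:R * (16 * B * M%:R / (eps * nu ^+ 2)) = 16 * B * M%:R * nu / eps.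
      by rewrite -nuE; field; rewrite !gt_eqF.
    rewrite h2 in h1.
    have -> : kap * nu * M%:R = C * (3 * B * (16 * B * M%:R * nu / eps)).
      by rewrite /kap; field; rewrite gt_eqF.
    rewrite ler_pM2l // (_ : Lam = 3 * B * (n%:R * (cx (zz j.+1) - cx (zz j)))); last by rewrite /Lam; ring.
    by rewrite ler_pM2l // mulr_gt0.
  have cK : C * Lam / M%:R <= kap * nu by rewrite ler_pdivrMr.
  have cr : C * Lam / M%:R ^+ 2 <= kap * nu / M%:R.
    have -> : C * Lam / M%:R ^+ 2 = C * Lam / M%:R / M%:R by field; rewrite gt_eqF.
    by rewrite ler_pM2r ?invr_gt0.
  have h1 : m%:R <= #|[set k | P j k]|%:R :> R.
    apply: (@le_trans _ _ (M%:R / 2)); first by rewrite ME; clear; lra.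
    apply: (le_trans h); rewrite ler_nat; apply: subset_leq_card.
    apply/fintype.subsetP => k; rewrite !inE => hk.
    rewrite !addnS in hk; exact: companion_weaken cr cK hk.
  by rewrite ler_nat in h1.
have hA := card_pair_sets hP.
set A := [set t | _] in hA.
have inj : {in A &, injective (fun t : 'I_J * 'I_M =>
    (V1 (t.1 * M + t.2)%N, V2 (t.1 * M + t.2)%N))}.
  move=> [j k] [j' k'] _ _ /= [e1 e2].
  have b1 : ((j * M + k).+1 < N)%N by rewrite -addnS; exact: jkM.
  have b2 : ((j' * M + k').+1 < N)%N by rewrite -addnS; exact: jkM.
  have e := lc_edges_inj lc n0 b1 b2 e1 e2.
  congr (_, _); apply: val_inj => /=.
    by have := congr1 (divn^~ M) e; rewrite !divnMDl // !divn_small // !addn0.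
  by have := congr1 (modn^~ M) e; rewrite !modnMDl !modn_small.
have comp : {in A, forall t : 'I_J * 'I_M, companion D (kap * nu / M%:R) (kap * nu)
    (V1 (t.1 * M + t.2)%N) (V2 (t.1 * M + t.2)%N)}.
  by move=> t; rewrite inE => /asboolP.
have r1 : 1 <= kap * nu / M%:R by rewrite ler_pdivlMr // mul1r.
have K1 : 1 <= kap * nu.
  by apply: le_trans a3; rewrite ler1n.
have hB := card_companions D0 r1 K1 inj comp.
have hA' : #|W|%:R * m%:R <= #|A|%:R :> R by rewrite -natrM ler_nat.
have hAB := le_trans hA' hB.
have h1 : J%:R / 2 * m%:R <= #|W|%:R * m%:R :> R by rewrite ler_wpM2r.
have h2 : eps * nu ^+ 2 / 8 <= J%:R / 2 * m%:R by clear -JM ME; nra.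
have h3 := le_trans h2 (le_trans h1 hAB).
have h4 : 18 * (2 * D + 1) ^+ 2 * (kap * nu * (kap * nu / M%:R)) =
   Q * eps / 8 * nu ^+ 2 / M%:R.
  by rewrite /Q; field; rewrite !gt_eqF.
rewrite h4 ler_pdivlMr // in h3.
have h5 : M%:R * (eps * nu ^+ 2 / 8) <= Q * (eps * nu ^+ 2 / 8).
  by apply: (le_trans _ (le_trans h3 _)); rewrite le_eqVlt; apply/orP; left; apply/eqP; ring.
have h6 : 0 < eps * nu ^+ 2 / 8 by apply: divr_gt0 => //; exact: mulr_gt0.
by rewrite ler_pM2r // leNgt MQ in h5.
Qed.

(** * Supporting lines of a planar convex set *)

Local Open Scope classical_set_scope.

Section PlanarSupport.
Variables (R : realType) (S : R -> R -> Prop).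
Hypothesis cS : forall x y x' y' t, S x y -> S x' y' -> 0 <= t <= 1 ->
  S (t * x + (1 - t) * x') (t * y + (1 - t) * y').

(** The segment from [e] to a negative multiple of [e]. *)
Lemma planar_line e1 e2 k s : S e1 e2 -> S (- k * e1) (- k * e2) -> 0 < k ->
  - k <= s <= 1 -> S (s * e1) (s * e2).
Proof.
move=> Se Sz k0 /andP[s1 s2]; have k1 : 0 < 1 + k by rewrite addr_gt0.
have ht : 0 <= (s + k) / (1 + k) <= 1.
  rewrite divr_ge0 ?(ltW k1) //=; last lra.
  by rewrite ler_pdivrMr // mul1r; lra.
have := cS Se Sz ht; set t := _ / _ in ht *.
have tE : t * (1 + k) = s + k by rewrite /t divfK // gt_eqF.
have -> : t * e1 + (1 - t) * (- k * e1) = (t * (1 + k) - k) * e1 by ring.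
have -> : t * e2 + (1 - t) * (- k * e2) = (t * (1 + k) - k) * e2 by ring.
by rewrite tE addrK.
Qed.

Lemma planar_half e1 e2 k y1 y2 : S e1 e2 -> S (- k * e1) (- k * e2) -> 0 < k ->
  S y1 y2 -> exists2 rho : R, 0 < rho & forall a th, `|a| <= rho -> 0 <= th <= rho ->
    S (a * e1 + th * y1) (a * e2 + th * y2).
Proof.
move=> Se Sz k0 Sy; exists (Num.min (1 / 2) (k / 2)).
  by rewrite lt_min; apply/andP; split; rewrite divr_gt0.
move=> a th; rewrite !le_min => /andP[a1 a2] /andP[t0 /andP[t1 t2]].
have ot : 0 < 1 - th by lra.
have hs : - k <= a / (1 - th) <= 1.
  move: a1 a2; rewrite !ler_norml => /andP[a1 a3] /andP[a2 a4].
  rewrite ler_pdivrMr // mul1r ler_pdivlMr //; apply/andP; split; last lra.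
  have : k * (1 / 2) <= k * (1 - th) by rewrite ler_pM2l //; lra.
  lra.
have Sv := planar_line Se Sz k0 hs.
have := @cS _ _ _ _ th Sy Sv; rewrite t0 (_ : th <= 1); last lra.
move=> /(_ isT); congr S; field; rewrite gt_eqF //.
Qed.

(** If [S] contains [e], a point opposite to [e], and points on both sides of the
    line through them, then the origin is interior to [S]. *)
Lemma planar_interior e1 e2 k y1 y2 w1 w2 : S e1 e2 -> S (- k * e1) (- k * e2) -> 0 < k ->
  S y1 y2 -> S w1 w2 -> 0 < e1 * y2 - e2 * y1 -> e1 * w2 - e2 * w1 < 0 ->
  exists2 r : R, 0 < r & forall x y, `|x| <= r -> `|y| <= r -> S x y.
Proof.
move=> Se Sz k0 Sy Sw dy dw.
have [r1 r10 h1] := planar_half Se Sz k0 Sy.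
have [r2 r20 h2] := planar_half Se Sz k0 Sw.
set d1 := e1 * y2 - e2 * y1 in dy; set d2 := e1 * w2 - e2 * w1 in dw.
pose E := `|e1| + `|e2| + `|y1| + `|y2| + `|w1| + `|w2| + 1.
have E0 : 0 < E by rewrite /E ltr_wpDl // !addr_ge0.
pose m := Num.min (r1 * d1) (r2 * - d2).
have m0 : 0 < m by rewrite lt_min !mulr_gt0 // oppr_gt0.
exists (m / E); first exact: divr_gt0.
move=> x y hx hy.
have det (a b : R) : `|a| + `|b| <= E -> `|a * y - b * x| <= m.
  move=> hab; apply: (le_trans (ler_normB _ _)); rewrite !normrM.
  apply: (@le_trans _ _ ((`|a| + `|b|) * (m / E))).
    by rewrite mulrDl lerD // ler_wpM2l.
  by rewrite mulrCA ler_piMr ?(ltW m0) // ler_pdivrMr // mul1r.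
have m1 : m <= r1 * d1 by rewrite ge_min lexx.
have m2 : m <= r2 * - d2 by rewrite ge_min lexx orbT.
have n1 := normr_ge0 e1; have n2 := normr_ge0 e2; have n3 := normr_ge0 y1.
have n4 := normr_ge0 y2; have n5 := normr_ge0 w1; have n6 := normr_ge0 w2.
have he : `|e1 * y - e2 * x| <= m by apply: det; rewrite /E; lra.
have hyy : `|y1 * y - y2 * x| <= m by apply: det; rewrite /E; lra.
have hww : `|w1 * y - w2 * x| <= m by apply: det; rewrite /E; lra.
have [c0|c0] := lerP 0 (e1 * y - e2 * x).
  have := h1 (- (y1 * y - y2 * x) / d1) ((e1 * y - e2 * x) / d1).
  rewrite normrM normrN normfV (gtr0_norm dy) ler_pdivrMr // (le_trans hyy m1).
  rewrite divr_ge0 ?(ltW dy) // ler_pdivrMr // (le_trans (ler_norm _) (le_trans he m1)).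
  move=> /(_ isT isT); congr S; rewrite /d1; field; rewrite -/d1 gt_eqF //.
have dn : 0 < - d2 by rewrite oppr_gt0.
have := h2 (- (w1 * y - w2 * x) / d2) ((e1 * y - e2 * x) / d2).
rewrite normrM normrN normfV (ltr0_norm dw) ler_pdivrMr // (le_trans hww m2).
rewrite -[(e1 * y - e2 * x) / d2]mulrNN -invrN.
rewrite divr_ge0 ?(ltW dn) ?oppr_ge0 ?(ltW c0) // ler_pdivrMr //.
rewrite -normrN in he; rewrite (le_trans (ler_norm _) (le_trans he m2)).
move=> /(_ isT isT); congr S; rewrite /d2; field; rewrite -/d2 lt_eqF //.
Qed.

(** Take [e] in [S] different from the origin.  If all of [S] is on one side of the
    line of [e], that line supports [S].  Otherwise no point of [S] is opposite to
    [e], so that by convexity the ratios [a / c] on one side of the line are below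
    those on the other, and a real number between them is the slope of a
    supporting line. *)
Lemma planar_support :
  (forall r : R, 0 < r -> exists x y, [/\ `|x| <= r, `|y| <= r & ~ S x y]) ->
  exists u1 u2 : R, (u1 != 0 \/ u2 != 0) /\ forall x y, S x y -> u1 * x + u2 * y <= 0.
Proof.
move=> hni.
have [[e1 [e2 [Se e0]]]|hS] := pselect (exists e1 e2, S e1 e2 /\ (e1 != 0 \/ e2 != 0)); last first.
  exists 1, 0; split; first by left; rewrite oner_neq0.
  move=> x y Sxy; rewrite mul1r mul0r addr0 leNgt; apply/negP => x0.
  by apply: hS; exists x, y; split => //; left; rewrite gt_eqF.
pose a x y : R := e1 * x + e2 * y; pose c x y : R := e1 * y - e2 * x.
have N0 : 0 < e1 ^+ 2 + e2 ^+ 2.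
  case: e0 => e0; [apply: ltr_pwDl|apply: ltr_wpDl]; rewrite ?sqr_ge0 //;
    by rewrite lt_neqAle sqr_ge0 eq_sym sqrf_eq0 e0.
have [[y1 [y2 [Sy cy]]]|hp] := pselect (exists x y, S x y /\ 0 < c x y); last first.
  exists (- e2), e1; split; first by case: e0; [right|left; rewrite oppr_eq0].
  move=> x y Sxy; rewrite leNgt; apply/negP => h; apply: hp; exists x, y; split => //.
  by rewrite /c; lra.
have [[w1 [w2 [Sw cw]]]|hn] := pselect (exists x y, S x y /\ c x y < 0); last first.
  exists e2, (- e1); split; first by case: e0; [right; rewrite oppr_eq0|left].
  move=> x y Sxy; rewrite leNgt; apply/negP => h; apply: hn; exists x, y; split => //.
  by rewrite /c; lra.
have noint k : 0 < k -> ~ S (- k * e1) (- k * e2).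
  move=> k0 Sz; have [r r0 hr] := planar_interior Se Sz k0 Sy Sw cy cw.
  by have [x [y [hx hy]]] := hni r r0; apply; exact: hr.
have axis x y : c x y = 0 -> S x y -> 0 <= a x y.
  move=> c0 Sxy; rewrite leNgt; apply/negP => a0.
  apply: (noint (- a x y / (e1 ^+ 2 + e2 ^+ 2))).
    by rewrite divr_gt0 // oppr_gt0.
  have ex : x = (a x y * e1 - c x y * e2) / (e1 ^+ 2 + e2 ^+ 2).
    by rewrite /a /c; field; rewrite gt_eqF.
  have ey : y = (a x y * e2 + c x y * e1) / (e1 ^+ 2 + e2 ^+ 2).
    by rewrite /a /c; field; rewrite gt_eqF.
  rewrite c0 in ex ey.
  by have := Sxy; rewrite [X in S X _]ex [X in S _ X]ey; congr S; field; rewrite gt_eqF.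
have cross x y x' y' : S x y -> S x' y' -> 0 < c x y -> c x' y' < 0 ->
    a x' y' / c x' y' <= a x y / c x y.
  move=> Sxy Sxy' cp cn.
  have dp : 0 < c x y - c x' y' by rewrite subr_gt0 (lt_trans cn).
  pose t := - c x' y' / (c x y - c x' y').
  have ht : 0 <= t <= 1.
    rewrite divr_ge0 ?(ltW dp) //=; last by rewrite oppr_ge0 ltW.
    by rewrite ler_pdivrMr // mul1r lerDr ltW.
  have := axis _ _ _ (cS Sxy Sxy' ht).
  have -> : c (t * x + (1 - t) * x') (t * y + (1 - t) * y') = t * c x y + (1 - t) * c x' y'.
    by rewrite /c; ring.
  have -> : a (t * x + (1 - t) * x') (t * y + (1 - t) * y') = t * a x y + (1 - t) * a x' y'.
    by rewrite /a; ring.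
  have -> : t * c x y + (1 - t) * c x' y' = 0 by rewrite /t; field; rewrite gt_eqF.
  move=> /(_ erefl).
  have -> : t * a x y + (1 - t) * a x' y' =
    (a x' y' * c x y - a x y * c x' y') / (c x y - c x' y') by rewrite /t; field; rewrite gt_eqF.
  rewrite pmulr_lge0 ?invr_gt0 // subr_ge0 => h.
  by rewrite ler_pdivlMr // mulrAC ler_ndivrMr.
pose L : set R := [set v | exists x y, [/\ S x y, c x y < 0 & v = a x y / c x y]].
have hL : has_sup L.
  split; first by exists (a w1 w2 / c w1 w2), w1, w2.
  by exists (a y1 y2 / c y1 y2) => v [x [y [Sxy cn ->]]]; exact: cross.
pose lam := sup L.
exists (- e1 - lam * e2), (- e2 + lam * e1); split.
  apply/orP; rewrite -negb_and; apply/negP => /andP[/eqP u1 /eqP u2].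
  have : (- e1 - lam * e2) * e1 + (- e2 + lam * e1) * e2 = 0 by rewrite u1 u2 !mul0r addr0.
  have -> : (- e1 - lam * e2) * e1 + (- e2 + lam * e1) * e2 = - (e1 ^+ 2 + e2 ^+ 2) by ring.
  by move/eqP; rewrite oppr_eq0 gt_eqF.
move=> x y Sxy.
have -> : (- e1 - lam * e2) * x + (- e2 + lam * e1) * y = lam * c x y - a x y.
  by rewrite /a /c; ring.
rewrite subr_le0; have [cp|cn|c0] := ltrgtP (c x y) 0.
- rewrite -ler_ndivrMr //; apply: (ub_le_sup (proj2 hL)); by exists x, y.
- rewrite -ler_pdivlMr //; apply: ge_sup => [|v [x' [y' [S' c' ->]]]]; first exact: (proj1 hL).
  exact: cross.
- by rewrite c0 mulr0; exact: axis.
Qed.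
End PlanarSupport.

Section Plane.
Variable R : realType.
Implicit Types p q x : 'rV[R]_2.

Definition coord1 p : R := p ord0 ord0.
Definition coord2 p : R := p ord0 ord_max.

Lemma plane_eq p q : coord1 p = coord1 q -> coord2 p = coord2 q -> p = q.
Proof.
move=> e1 e2; apply/rowP => i; case: i => [[|[|//]] hi].
  by have := e1; rewrite /coord1; congr (p _ _ = q _ _); apply: val_inj.
by have := e2; rewrite /coord2; congr (p _ _ = q _ _); apply: val_inj.
Qed.

Definition pt (a b : R) : 'rV[R]_2 := \row_i if i == ord0 then a else b.

Lemma coord1_pt a b : coord1 (pt a b) = a. Proof. by rewrite /coord1 mxE. Qed.
Lemma coord2_pt a b : coord2 (pt a b) = b. Proof. by rewrite /coord2 mxE. Qed.

Lemma coord1_comb a b p q : coord1 (a *: p + b *: q) = a * coord1 p + b * coord1 q.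
Proof. by rewrite /coord1 !mxE. Qed.
Lemma coord2_comb a b p q : coord2 (a *: p + b *: q) = a * coord2 p + b * coord2 q.
Proof. by rewrite /coord2 !mxE. Qed.

Lemma coord_le_norm p : `|coord1 p| <= `|p| /\ `|coord2 p| <= `|p|.
Proof.
have h i : `|p ord0 i| <= `|p|.
  rewrite [leRHS]/Num.norm /= mx_normrE.
  exact: (le_bigmax _ (fun ij => `|p ij.1 ij.2|) (ord0, i)).
by split; exact: h.
Qed.

Lemma lin_continuous (a b c : R) : continuous (fun x => a * coord1 x + b * coord2 x + c).
Proof.
move=> x.
apply: (@continuousD _ _ _ (fun x => a * coord1 x + b * coord2 x) (fun=> c));
  last exact: cst_continuous.
apply: (@continuousD _ _ _ (fun x => a * coord1 x) (fun x => b * coord2 x)).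
  apply: (@continuousM _ _ (fun=> a) coord1); first exact: cst_continuous.
  exact: coord_continuous.
apply: (@continuousM _ _ (fun=> b) coord2); first exact: cst_continuous.
exact: coord_continuous.
Qed.

Lemma closed_lin (a b c : R) : closed [set x | a * coord1 x + b * coord2 x + c <= 0].
Proof.
apply: (@closed_comp _ _ (fun x => a * coord1 x + b * coord2 x + c) [set y | y <= 0]).
  by move=> x _; exact: lin_continuous.
exact: closed_le.
Qed.

Lemma open_lin (a b c : R) : open [set x | a * coord1 x + b * coord2 x + c < 0].
Proof.
apply: (@open_comp _ _ (fun x => a * coord1 x + b * coord2 x + c) [set y | y < 0]).
  by move=> x _; exact: lin_continuous.
exact: open_lt.
Qed.

Definition normal_at (gamma : set 'rV[R]_2) p (u1 u2 : R) : Prop :=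
  (u1 != 0 \/ u2 != 0) /\
  forall x, gamma x -> u1 * (coord1 x - coord1 p) + u2 * (coord2 x - coord2 p) <= 0.

Lemma boundary_support (K : set 'rV[R]_2) p : convex_set K -> boundary K p ->
  exists u1 u2 : R, (u1 != 0 \/ u2 != 0) /\
   forall x, closure K x -> u1 * (coord1 x - coord1 p) + u2 * (coord2 x - coord2 p) <= 0.
Proof.
move=> cK [_ nint].
pose S (x y : R) := K (pt (coord1 p + x) (coord2 p + y)).
have cS (x y x' y' t : R) : S x y -> S x' y' -> 0 <= t <= 1 ->
    S (t * x + (1 - t) * x') (t * y + (1 - t) * y').
  move=> Sx Sx' /andP[t0 t1].
  have := cK _ _ (Itv01 t0 t1) (mem_set Sx) (mem_set Sx').
  move=> /set_mem; rewrite /S; congr K.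
  apply: plane_eq; rewrite ?coord1_pt ?coord2_pt /conv /= ?coord1_comb ?coord2_comb ?coord1_pt ?coord2_pt /=.
    by rewrite /unstable.onem; ring.
  by rewrite /unstable.onem; ring.
have hni (r : R) : 0 < r -> exists x y : R, [/\ `|x| <= r, `|y| <= r & ~ S x y].
  move=> r0; apply: contrapT => h; apply: nint.
  apply/(@nbhs_normP R _ p); exists r => // x /= hx.
  have [h1 h2] := coord_le_norm (x - p).
  have e1 : coord1 (x - p) = coord1 x - coord1 p by rewrite /coord1 !mxE.
  have e2 : coord2 (x - p) = coord2 x - coord2 p by rewrite /coord2 !mxE.
  rewrite distrC in hx; rewrite e1 in h1; rewrite e2 in h2.
  apply: contrapT => nK; apply: h; exists (coord1 x - coord1 p), (coord2 x - coord2 p).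
  split; [exact: le_trans h1 (ltW hx) | exact: le_trans h2 (ltW hx)|].
  rewrite /S => hK; apply: nK.
  by move: hK; congr K; apply: plane_eq; rewrite ?coord1_pt ?coord2_pt; ring.
have [u1 [u2 [u0 hu]]] := planar_support cS hni.
exists u1, u2; split => // x.
have cl := @closed_lin u1 u2 (- (u1 * coord1 p + u2 * coord2 p)).
suff : closure K `<=` [set x | u1 * coord1 x + u2 * coord2 x - (u1 * coord1 p + u2 * coord2 p) <= 0].
  by move=> h /h /=; congr (_ <= _); ring.
rewrite [X in _ `<=` X](closure_id _).1 //; apply: closureS => y Ky /=.
have := hu (coord1 y - coord1 p) (coord2 y - coord2 p).
have -> : S (coord1 y - coord1 p) (coord2 y - coord2 p) = K y.
  by rewrite /S; congr K; apply: plane_eq; rewrite ?coord1_pt ?coord2_pt; ring.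
by move=> /(_ Ky); congr (_ <= _); ring.
Qed.

Definition det2 (a b c d : R) : R := a * d - b * c.

(** The ray starts at the centroid [o] of three noncollinear points of [gamma] and
    passes through a point [c] of the chord from [p] to [r], on the supporting line
    [u] along that chord.  A point of [gamma] on the ray cannot be beyond [c], which
    is on the line [u]; it is not [c], which is outside [gamma]; and it cannot be
    between [o] and [c], because its own supporting line has [o] strictly on one
    side. *)
Lemma ray_avoids (p r o' c x : 'rV[R]_2) (gamma : set 'rV[R]_2) (u1 u2 v1 v2 al sg : R) :
  let o1 := (coord1 p + coord1 r + coord1 o') / 3 in
  let o2 := (coord2 p + coord2 r + coord2 o') / 3 in
  gamma p -> gamma r -> gamma o' -> gamma x -> ~ gamma c ->
  det2 (coord1 r - coord1 p) (coord2 r - coord2 p) (coord1 o' - coord1 p) (coord2 o' - coord2 p) != 0 ->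
  u1 * (coord1 r - coord1 p) + u2 * (coord2 r - coord2 p) = 0 ->
  (u1 != 0 \/ u2 != 0) ->
  (forall y, gamma y -> u1 * (coord1 y - coord1 p) + u2 * (coord2 y - coord2 p) <= 0) ->
  normal_at gamma x v1 v2 -> 0 <= al <= 1 ->
  coord1 c = coord1 p + al * (coord1 r - coord1 p) -> coord2 c = coord2 p + al * (coord2 r - coord2 p) ->
  0 <= sg -> coord1 x = o1 + sg * (coord1 c - o1) -> coord2 x = o2 + sg * (coord2 c - o2) ->
  False.
Proof.
move=> o1 o2 Gp Gr Go Gx nGc D0 ud u0 hu [v0 hv] /andP[al0 al1] c1 c2 s0 x1 x2.
have e1 : 3 * o1 = coord1 p + coord1 r + coord1 o' by rewrite /o1; field.
have e2 : 3 * o2 = coord2 p + coord2 r + coord2 o' by rewrite /o2; field.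
(* a functional vanishing on both independent vectors vanishes *)
have indep w1 w2 : w1 * (coord1 r - coord1 p) + w2 * (coord2 r - coord2 p) = 0 ->
    w1 * (coord1 o' - coord1 p) + w2 * (coord2 o' - coord2 p) = 0 -> (w1 != 0 \/ w2 != 0) -> False.
  move=> h1 h2; set D := det2 _ _ _ _ in D0.
  have z1 : w1 * D = 0.
    have -> : w1 * D = (w1 * (coord1 r - coord1 p) + w2 * (coord2 r - coord2 p)) * (coord2 o' - coord2 p)
      - (w1 * (coord1 o' - coord1 p) + w2 * (coord2 o' - coord2 p)) * (coord2 r - coord2 p).
      by rewrite /D /det2; ring.
    by rewrite h1 h2 !mul0r subrr.
  have z2 : w2 * D = 0.
    have -> : w2 * D = (w1 * (coord1 o' - coord1 p) + w2 * (coord2 o' - coord2 p)) * (coord1 r - coord1 p)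
      - (w1 * (coord1 r - coord1 p) + w2 * (coord2 r - coord2 p)) * (coord1 o' - coord1 p).
      by rewrite /D /det2; ring.
    by rewrite h1 h2 !mul0r subrr.
  move/eqP: z1; move/eqP: z2; rewrite !mulf_eq0 (negPf D0) !orbF => /eqP -> /eqP ->.
  by rewrite eqxx; case.
have lo : u1 * (o1 - coord1 p) + u2 * (o2 - coord2 p) < 0.
  have h1 := hu _ Go.
  have h : 3 * (u1 * (o1 - coord1 p) + u2 * (o2 - coord2 p)) =
    (u1 * (coord1 r - coord1 p) + u2 * (coord2 r - coord2 p))
    + (u1 * (coord1 o' - coord1 p) + u2 * (coord2 o' - coord2 p)).
    have -> : 3 * (u1 * (o1 - coord1 p) + u2 * (o2 - coord2 p)) =
      u1 * (3 * o1 - 3 * coord1 p) + u2 * (3 * o2 - 3 * coord2 p) by ring.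
    by rewrite e1 e2; ring.
  rewrite ud add0r in h.
  rewrite -(pmulr_rlt0 _ (ltr0n R 3 : 0 < 3 :> R)) h lt_neqAle h1 andbT.
  by apply/eqP => h2; exact: (indep u1 u2).
have uc : u1 * (coord1 c - coord1 p) + u2 * (coord2 c - coord2 p) = 0.
  have -> : u1 * (coord1 c - coord1 p) + u2 * (coord2 c - coord2 p) =
    al * (u1 * (coord1 r - coord1 p) + u2 * (coord2 r - coord2 p)) by rewrite c1 c2; ring.
  by rewrite ud mulr0.
have s1 : sg <= 1.
  have := hu _ Gx.
  have -> : u1 * (coord1 x - coord1 p) + u2 * (coord2 x - coord2 p) =
    (1 - sg) * (u1 * (o1 - coord1 p) + u2 * (o2 - coord2 p))
    + sg * (u1 * (coord1 c - coord1 p) + u2 * (coord2 c - coord2 p)) by rewrite x1 x2; ring.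
  by rewrite uc mulr0 addr0 nmulr_lle0 // subr_ge0.
move: s1; rewrite le_eqVlt => /orP[/eqP s1|s1].
  apply: nGc; suff -> : c = x by [].
  by apply: plane_eq; rewrite ?x1 ?x2 s1; ring.
have vp := hv _ Gp; have vr := hv _ Gr; have vo := hv _ Go.
have vc : v1 * (coord1 c - coord1 x) + v2 * (coord2 c - coord2 x) <= 0.
  have -> : v1 * (coord1 c - coord1 x) + v2 * (coord2 c - coord2 x) =
    (1 - al) * (v1 * (coord1 p - coord1 x) + v2 * (coord2 p - coord2 x))
    + al * (v1 * (coord1 r - coord1 x) + v2 * (coord2 r - coord2 x)) by rewrite c1 c2; ring.
  by rewrite -oppr_ge0 opprD -!mulrN addr_ge0 // mulr_ge0 ?oppr_ge0 // subr_ge0.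
have vo0 : v1 * (o1 - coord1 x) + v2 * (o2 - coord2 x) < 0.
  have h : 3 * (v1 * (o1 - coord1 x) + v2 * (o2 - coord2 x)) =
    (v1 * (coord1 p - coord1 x) + v2 * (coord2 p - coord2 x))
    + (v1 * (coord1 r - coord1 x) + v2 * (coord2 r - coord2 x))
    + (v1 * (coord1 o' - coord1 x) + v2 * (coord2 o' - coord2 x)).
    have -> : 3 * (v1 * (o1 - coord1 x) + v2 * (o2 - coord2 x)) =
      v1 * (3 * o1 - 3 * coord1 x) + v2 * (3 * o2 - 3 * coord2 x) by ring.
    by rewrite e1 e2; ring.
  set A := v1 * (coord1 p - _) + _ in h vp; set B := v1 * (coord1 r - _) + _ in h vr.
  set E := v1 * (coord1 o' - _) + _ in h vo.
  have [] := ltrP (v1 * (o1 - coord1 x) + v2 * (o2 - coord2 x)) 0 => // ge0; exfalso.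
  have A0 : A = 0 by clear -h vp vr vo ge0; lra.
  have B0 : B = 0 by clear -h vp vr vo ge0; lra.
  have E0 : E = 0 by clear -h vp vr vo ge0; lra.
  apply: (indep v1 v2) => //.
    have -> : v1 * (coord1 r - coord1 p) + v2 * (coord2 r - coord2 p) = B - A by rewrite /A /B; ring.
    by rewrite A0 B0 subrr.
  have -> : v1 * (coord1 o' - coord1 p) + v2 * (coord2 o' - coord2 p) = E - A by rewrite /A /E; ring.
  by rewrite A0 E0 subrr.
have : (1 - sg) * (v1 * (o1 - coord1 x) + v2 * (o2 - coord2 x)) +
  sg * (v1 * (coord1 c - coord1 x) + v2 * (coord2 c - coord2 x)) = 0 by rewrite x1 x2; ring.
have : (1 - sg) * (v1 * (o1 - coord1 x) + v2 * (o2 - coord2 x)) < 0.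
  by rewrite nmulr_llt0 // subr_gt0.
have : sg * (v1 * (coord1 c - coord1 x) + v2 * (coord2 c - coord2 x)) <= 0 by exact: mulr_ge0_le0.
move: (_ * _) ((1 - sg) * _) => A B; clear; lra.
Qed.
End Plane.

(** * A strictly convex curve has no three collinear points *)

Lemma parallel_scale (R : realType) (a b c d : R) : (a != 0) || (b != 0) ->
  a * d - b * c = 0 -> exists k, c = k * a /\ d = k * b.
Proof.
move=> ab h; have N0 : a ^+ 2 + b ^+ 2 != 0.
  by rewrite paddr_eq0 ?sqr_ge0 // !sqrf_eq0 negb_and.
exists ((a * c + b * d) / (a ^+ 2 + b ^+ 2)); split.
  apply: (mulIf N0); rewrite mulrAC divfK //.
  have -> : c * (a ^+ 2 + b ^+ 2) = (a * c + b * d) * a - b * (a * d - b * c) by ring.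
  by rewrite h mulr0 subr0.
apply: (mulIf N0); rewrite mulrAC divfK //.
have -> : d * (a ^+ 2 + b ^+ 2) = (a * c + b * d) * b + a * (a * d - b * c) by ring.
by rewrite h mulr0 addr0.
Qed.

Section NoThreeCollinear.
Variables (R : realType) (gamma : set 'rV[R]_2).
Hypothesis gconn : connected gamma.
Hypothesis gsupp : forall p, gamma p -> exists u1 u2, normal_at gamma p u1 u2.
Hypothesis gseg : forall a b : 'rV[R]_2, a != b -> ~ (segment a b `<=` gamma).

(** [L] and [L'] have the same trace on [gamma], which is therefore open and closed
    in [gamma]. *)
Lemma connected_not_separated (L : set 'rV[R]_2) (L' : set 'rV[R]_2) (p q : 'rV[R]_2) :
  open L -> closed L' -> L `<=` L' -> (forall x, gamma x -> L' x -> L x) ->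
  gamma p -> gamma q -> L q -> ~ L p -> False.
Proof.
move=> oL cL LL' LL Gp Gq Lq nLp.
have e : gamma `&` L = gamma `&` L'.
  by apply/seteqP; split => x [Gx Lx]; split => //; [exact: LL' | exact: LL].
have := gconn (B := gamma `&` L) (ex_intro _ q (conj Gq Lq))
  (ex_intro2 _ _ L oL erefl) (ex_intro2 _ _ L' cL e).
by move=> eG; have : gamma p by []; rewrite -eG => -[].
Qed.

Lemma chord_gap (p q : 'rV[R]_2) : p != q -> gamma p -> gamma q ->
  exists c s, [/\ ~ gamma c, 0 < s < 1,
    coord1 c = (1 - s) * coord1 p + s * coord1 q & coord2 c = (1 - s) * coord2 p + s * coord2 q].
Proof.
move=> pq Gp Gq; have /existsNP[c /not_implyP[[s hs sc] nc]] := gseg pq.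
exists c, s; split => //; rewrite -?sc ?coord1_comb ?coord2_comb //.
move: hs; rewrite /= in_itv /= => /andP[s0 s1].
rewrite !lt_neqAle s0 s1 !andbT; apply/andP; split; apply/eqP => e; apply: nc; rewrite -sc.
  by rewrite -e subr0 scale1r scale0r addr0.
by rewrite e subrr scale0r scale1r add0r.
Qed.

(** Between [p] and [q] and between [q] and [r] there are points [a] and [b] outside
    [gamma].  If [gamma] is contained in a line, [a] disconnects it.  Otherwise
    [gamma] avoids the rays through [a] and [b] from an interior point [o] of its
    hull, and these rays bound a cone that separates [q] from [p]. *)
Lemma no_three_collinear (p q r : 'rV[R]_2) (t : R) :
  gamma p -> gamma q -> gamma r -> p != r -> 0 < t < 1 ->
  coord1 q = coord1 p + t * (coord1 r - coord1 p) ->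
  coord2 q = coord2 p + t * (coord2 r - coord2 p) -> False.
Proof.
move=> Gp Gq Gr pr /andP[t0 t1] q1 q2.
pose d1 := coord1 r - coord1 p; pose d2 := coord2 r - coord2 p.
have d0 : (d1 != 0) || (d2 != 0).
  rewrite -negb_and; apply/negP => /andP[/eqP h1 /eqP h2]; move/eqP: pr; apply.
  by apply: plane_eq; apply/esym/eqP; rewrite -subr_eq0; apply/eqP.
have N0 : 0 < d1 ^+ 2 + d2 ^+ 2.
  by rewrite lt_neqAle addr_ge0 ?sqr_ge0 // andbT eq_sym paddr_eq0 ?sqr_ge0 // !sqrf_eq0 negb_and.
have pq : p != q.
  apply/eqP => e; move: q1 q2; rewrite -e -/d1 -/d2 => h1 h2.
  have z1 : t * d1 = 0 by clear -h1; lra. have z2 : t * d2 = 0 by clear -h2; lra.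
  by move: d0; move/eqP: z1; move/eqP: z2; rewrite !mulf_eq0 gt_eqF //= => -> ->.
have qr : q != r.
  apply/eqP => e; move: q1 q2; rewrite e -/d1 -/d2 => h1 h2.
  have z1 : (1 - t) * d1 = 0 by rewrite mulrBl mul1r {1}/d1; clear -h1; lra.
  have z2 : (1 - t) * d2 = 0 by rewrite mulrBl mul1r {1}/d2; clear -h2; lra.
  by move: d0; move/eqP: z1; move/eqP: z2; rewrite !mulf_eq0 subr_eq0 gt_eqF //= => -> ->.
have [a [s [nGa /andP[s0 s1] a1 a2]]] := chord_gap pq Gp Gq.
have [b [s' [nGb /andP[s0' s1'] b1 b2]]] := chord_gap qr Gq Gr.
pose al := s * t; pose be := t + s' * (1 - t).
have al0 : 0 < al by rewrite mulr_gt0.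
have alt : al < t by rewrite gtr_pMl.
have tbe : t < be by rewrite ltrDl mulr_gt0 // subr_gt0.
have be1 : be < 1.
  have : s' * (1 - t) < 1 * (1 - t) by rewrite ltr_pM2r // subr_gt0.
  by rewrite /be; lra.
have a1' : coord1 a = coord1 p + al * d1 by rewrite a1 q1 /al /d1; ring.
have a2' : coord2 a = coord2 p + al * d2 by rewrite a2 q2 /al /d2; ring.
have b1' : coord1 b = coord1 p + be * d1 by rewrite b1 q1 /be /d1; ring.
have b2' : coord2 b = coord2 p + be * d2 by rewrite b2 q2 /be /d2; ring.
have [hA|[ o' [Go D0] ] ] : (forall x, gamma x -> det2 d1 d2 (coord1 x - coord1 p) (coord2 x - coord2 p) = 0)
   \/ exists o', gamma o' /\ det2 d1 d2 (coord1 o' - coord1 p) (coord2 o' - coord2 p) != 0.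
  have [h|h] := pselect (exists o', gamma o' /\ det2 d1 d2 (coord1 o' - coord1 p) (coord2 o' - coord2 p) != 0).
    by right.
  left => x Gx; apply/eqP/negPn/negP => hx; apply: h; by exists x.
- pose c := - (d1 * coord1 p + d2 * coord2 p + al * (d1 ^+ 2 + d2 ^+ 2)).
  refine (connected_not_separated (@open_lin R d1 d2 c) (@closed_lin R d1 d2 c) _ _ Gq Gp _ _).
  + by move=> x /= /ltW.
  + move=> x Gx /=; rewrite le_eqVlt => /orP[/eqP h|//]; exfalso.
    have [k [k1 k2]] := parallel_scale d0 (hA x Gx).
    have ek : k = al.
      apply: (mulIf (lt0r_neq0 N0)); move: h.
      have -> : coord1 x = coord1 p + k * d1 by rewrite -k1; ring.
      have -> : coord2 x = coord2 p + k * d2 by rewrite -k2; ring.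
      rewrite /c => h; apply/eqP; rewrite -subr_eq0; apply/eqP; rewrite -h; ring.
    apply: nGa; suff -> : a = x by [].
    by apply: plane_eq; rewrite ?a1' ?a2' -ek -?k1 -?k2; ring.
  + rewrite /= (_ : _ + c = - al * (d1 ^+ 2 + d2 ^+ 2)); last by rewrite /c; ring.
    by rewrite mulNr oppr_lt0 mulr_gt0.
  + rewrite /= (_ : _ + c = (t - al) * (d1 ^+ 2 + d2 ^+ 2)); last first.
      by rewrite q1 q2 -/d1 -/d2 /c; ring.
    by apply/negP; rewrite -leNgt mulr_ge0 ?ltW // subr_gt0.
set D := det2 _ _ _ _ in D0.
have [u1 [u2 [u0 hu']]] := gsupp Gq.
have ud : u1 * d1 + u2 * d2 = 0.
  have := hu' _ Gp; have := hu' _ Gr.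
  have -> : coord1 r = coord1 p + d1 by rewrite /d1; ring.
  have -> : coord2 r = coord2 p + d2 by rewrite /d2; ring.
  rewrite q1 q2 -/d1 -/d2.
  have -> : u1 * (coord1 p + d1 - (coord1 p + t * d1)) + u2 * (coord2 p + d2 - (coord2 p + t * d2))
    = (1 - t) * (u1 * d1 + u2 * d2) by ring.
  have -> : u1 * (coord1 p - (coord1 p + t * d1)) + u2 * (coord2 p - (coord2 p + t * d2))
    = - (t * (u1 * d1 + u2 * d2)) by ring.
  rewrite pmulr_rle0 ?subr_gt0 // oppr_le0 pmulr_rge0 // => h1 h2.
  by apply/eqP; rewrite eq_le h1 h2.
have hu y : gamma y -> u1 * (coord1 y - coord1 p) + u2 * (coord2 y - coord2 p) <= 0.
  move=> Gy; have := hu' y Gy; rewrite q1 q2 -/d1 -/d2.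
  have -> : u1 * (coord1 y - (coord1 p + t * d1)) + u2 * (coord2 y - (coord2 p + t * d2)) =
   u1 * (coord1 y - coord1 p) + u2 * (coord2 y - coord2 p) - t * (u1 * d1 + u2 * d2) by ring.
  by rewrite ud mulr0 subr0.
pose o1 := (coord1 p + coord1 r + coord1 o') / 3; pose o2 := (coord2 p + coord2 r + coord2 o') / 3.
have detE k l : det2 (coord1 p + k * d1 - o1) (coord2 p + k * d2 - o2)
   (coord1 p + l * d1 - o1) (coord2 p + l * d2 - o2) = (l - k) * (D / 3).
  by rewrite /D /det2 /o1 /o2 /d1 /d2; field.
have detpp l : det2 (coord1 a - o1) (coord2 a - o2) (coord1 p + l * d1 - o1) (coord2 p + l * d2 - o2)
   = (l - al) * (D / 3) by rewrite a1' a2' detE.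
have detqq l : det2 (coord1 b - o1) (coord2 b - o2) (coord1 p + l * d1 - o1) (coord2 p + l * d2 - o2)
   = (l - be) * (D / 3) by rewrite b1' b2' detE.
have D2 : 0 < D * D by rewrite -expr2 lt_neqAle sqr_ge0 eq_sym sqrf_eq0 D0.
(* the two sides of the cone with apex o over the chord piece from a to b *)
pose fa x := D * det2 (coord1 a - o1) (coord2 a - o2) (coord1 x - o1) (coord2 x - o2).
pose fb x := D * det2 (coord1 b - o1) (coord2 b - o2) (coord1 x - o1) (coord2 x - o2).
have onray c ga x : gamma x -> ~ gamma c -> 0 <= ga <= 1 ->
   coord1 c = coord1 p + ga * d1 -> coord2 c = coord2 p + ga * d2 ->
   det2 (coord1 c - o1) (coord2 c - o2) (coord1 x - o1) (coord2 x - o2) = 0 ->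
   exists sg, [/\ sg < 0, coord1 x - o1 = sg * (coord1 c - o1) & coord2 x - o2 = sg * (coord2 c - o2)].
  move=> Gx nGc hga c1 c2 hdet.
  have c0 : (coord1 c - o1 != 0) || (coord2 c - o2 != 0).
    rewrite -negb_and; apply/negP => /andP[/eqP h1 /eqP h2].
    have := detE ga (ga + 1); rewrite -c1 -c2 h1 h2 /det2 !mul0r subrr => /esym/eqP.
    by rewrite addrAC subrr add0r mul1r mulf_eq0 (negPf D0) invr_eq0 pnatr_eq0.
  have [k [k1 k2]] := parallel_scale c0 hdet.
  exists k; split => //; rewrite ltNge; apply/negP => k0.
  have [v1 [v2 nx]] := gsupp Gx.
  apply: (@ray_avoids R p r o' c x gamma u1 u2 v1 v2 ga k) => //.
    by rewrite -k1 addrC subrK.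
  by rewrite -k2 addrC subrK.
pose La := [set x | fa x > 0]; pose Lb := [set x | fb x < 0].
pose La' := [set x | fa x >= 0]; pose Lb' := [set x | fb x <= 0].
have faE x : - fa x = D * (coord2 a - o2) * coord1 x + - (D * (coord1 a - o1)) * coord2 x
   + D * ((coord1 a - o1) * o2 - (coord2 a - o2) * o1) by rewrite /fa /det2; ring.
have fbE x : fb x = - (D * (coord2 b - o2)) * coord1 x + D * (coord1 b - o1) * coord2 x
   + D * ((coord2 b - o2) * o1 - (coord1 b - o1) * o2) by rewrite /fb /det2; ring.
have oLa : open La.
  rewrite (_ : La = [set x | - fa x < 0]); last by apply/seteqP; split => x; rewrite /= oppr_lt0.
  by under eq_set do rewrite faE; exact: open_lin.
have cLa : closed La'.
  rewrite (_ : La' = [set x | - fa x <= 0]); last by apply/seteqP; split => x; rewrite /= oppr_le0.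
  by under eq_set do rewrite faE; exact: closed_lin.
have oLb : open Lb by rewrite /Lb; under eq_set do rewrite fbE; exact: open_lin.
have cLb : closed Lb' by rewrite /Lb'; under eq_set do rewrite fbE; exact: closed_lin.
refine (connected_not_separated (openI oLa oLb) (closedI cLa cLb) _ _ Gp Gq _ _).
- by move=> x [h1 h2]; split; exact: ltW.
- move=> x Gx [h1 h2]; split.
    move: h1; rewrite /La /La' /= le_eqVlt => /orP[/eqP h|//]; exfalso.
    have al01 : 0 <= al <= 1 by rewrite ltW //= ltW // (lt_trans alt).
    have hdet : det2 (coord1 a - o1) (coord2 a - o2) (coord1 x - o1) (coord2 x - o2) = 0.
      by apply: (mulfI D0); rewrite mulr0; exact: esym.
    have [sg [sg0 x1 x2]] := onray a al x Gx nGa al01 a1' a2' hdet.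
    move: h2; rewrite /Lb' /= /fb x1 x2.
    have -> : D * det2 (coord1 b - o1) (coord2 b - o2) (sg * (coord1 a - o1)) (sg * (coord2 a - o2))
      = sg * (al - be) * (D * D / 3).
      have := detqq al; rewrite -a1' -a2' /det2 => e.
      transitivity (D * sg * ((coord1 b - o1) * (coord2 a - o2) - (coord2 b - o2) * (coord1 a - o1))); first by rewrite /det2; ring.
      by rewrite e; ring.
    apply/negP; rewrite -ltNge mulr_gt0 ?divr_gt0 // nmulr_rgt0 // subr_lt0.
    exact: lt_trans alt tbe.
  move: h2; rewrite /Lb /Lb' /= le_eqVlt => /orP[/eqP h|//]; exfalso.
  have be01 : 0 <= be <= 1 by rewrite !ltW // (lt_trans t0).
  have hdet : det2 (coord1 b - o1) (coord2 b - o2) (coord1 x - o1) (coord2 x - o2) = 0.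
    by apply: (mulfI D0); rewrite mulr0.
  have [sg [sg0 x1 x2]] := onray b be x Gx nGb be01 b1' b2' hdet.
  move: h1; rewrite /La' /= /fa x1 x2.
  have -> : D * det2 (coord1 a - o1) (coord2 a - o2) (sg * (coord1 b - o1)) (sg * (coord2 b - o2))
    = sg * (be - al) * (D * D / 3).
    have := detpp be; rewrite -b1' -b2' /det2 => e.
    transitivity (D * sg * ((coord1 a - o1) * (coord2 b - o2) - (coord2 a - o2) * (coord1 b - o1))); first by rewrite /det2; ring.
    by rewrite e; ring.
  apply/negP; rewrite -ltNge nmulr_rlt0; last by rewrite nmulr_rlt0 // subr_gt0 (lt_trans alt).
  exact: divr_gt0.
- split.
    rewrite /La /= /fa q1 q2 -/d1 -/d2 detpp.
    have -> : D * ((t - al) * (D / 3)) = (t - al) * (D * D / 3) by ring.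
    by rewrite mulr_gt0 ?divr_gt0 // subr_gt0.
  rewrite /Lb /= /fb q1 q2 -/d1 -/d2 detqq.
  have -> : D * ((t - be) * (D / 3)) = (t - be) * (D * D / 3) by ring.
  by rewrite nmulr_rlt0 ?divr_gt0 // subr_lt0.
- move=> [h _]; move: h; rewrite /La /= /fa.
  have -> : D * det2 (coord1 a - o1) (coord2 a - o2) (coord1 p - o1) (coord2 p - o2) = - al * (D * D / 3).
    have := detpp 0; rewrite !mul0r !addr0 => ->; ring.
  by apply/negP; rewrite -leNgt mulNr oppr_le0 mulr_ge0 ?ltW // divr_gt0.
Qed.
End NoThreeCollinear.

(** * The four quadrants of normals *)

Section Quadrant.
Variables (R : realType) (gamma : set 'rV[R]_2) (e1 e2 : int).
Hypothesis e1E : e1 = 1 \/ e1 = -1.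
Hypothesis e2E : e2 = 1 \/ e2 = -1.
Hypothesis gconn : connected gamma.
Hypothesis gsupp : forall p, gamma p -> exists u1 u2, normal_at gamma p u1 u2.
Hypothesis gseg : forall a b : 'rV[R]_2, a != b -> ~ (segment a b `<=` gamma).

Definition quadrant (p : 'rV[R]_2) : Prop :=
  gamma p /\ exists u1 u2, [/\ normal_at gamma p u1 u2, 0 <= e1%:~R * u1 & 0 <= e2%:~R * u2].

(** Up to a factor, coordinates with respect to axes turned by 45 degrees, after a
    reflection that moves the quadrant to the first one; a normal there becomes a
    supporting line of slope in [[-1, 1]].  The coordinates of a lattice point are
    still integers divided by [n]. *)
Definition rot1 (p : 'rV[R]_2) : R := e1%:~R * coord1 p - e2%:~R * coord2 p.
Definition rot2 (p : 'rV[R]_2) : R := e1%:~R * coord1 p + e2%:~R * coord2 p.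

Lemma sqr_sign (e : int) : e = 1 \/ e = -1 -> (e%:~R * e%:~R = 1 :> R).
Proof. by case=> ->; rewrite ?rmorphN ?mulrNN mulr1. Qed.

Lemma rotK1 p : coord1 p = e1%:~R * ((rot1 p + rot2 p) / 2).
Proof.
rewrite /rot1 /rot2; have h := sqr_sign e1E.
have -> : e1%:~R * ((e1%:~R * coord1 p - e2%:~R * coord2 p + (e1%:~R * coord1 p + e2%:~R * coord2 p)) / 2)
  = e1%:~R * e1%:~R * coord1 p by field.
by rewrite h mul1r.
Qed.

Lemma rotK2 p : coord2 p = e2%:~R * ((rot2 p - rot1 p) / 2).
Proof.
rewrite /rot1 /rot2; have h := sqr_sign e2E.
have -> : e2%:~R * ((e1%:~R * coord1 p + e2%:~R * coord2 p - (e1%:~R * coord1 p - e2%:~R * coord2 p)) / 2)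
  = e2%:~R * e2%:~R * coord2 p by field.
by rewrite h mul1r.
Qed.

Lemma quadrant_slope p : quadrant p -> exists s : R, `|s| <= 1 /\
  forall x, gamma x -> rot2 x <= rot2 p + s * (rot1 x - rot1 p).
Proof.
move=> [_ [u1 [u2 [[u0 hu] h1 h2]]]].
pose w1 := e1%:~R * u1; pose w2 := e2%:~R * u2; rewrite -/w1 in h1; rewrite -/w2 in h2.
have s1 := sqr_sign e1E; have s2 := sqr_sign e2E.
have u1E : u1 = e1%:~R * w1 by rewrite /w1 mulrA s1 mul1r.
have u2E : u2 = e2%:~R * w2 by rewrite /w2 mulrA s2 mul1r.
have W0 : 0 < w1 + w2.
  rewrite lt_neqAle addr_ge0 // andbT eq_sym paddr_eq0 //; apply/negP => /andP[/eqP z1 /eqP z2].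
  by move: u0; rewrite u1E u2E z1 z2 !mulr0 eqxx; case.
exists ((w2 - w1) / (w1 + w2)); split.
  rewrite normrM normfV (gtr0_norm W0) ler_pdivrMr // mul1r ler_norml.
  by apply/andP; split; lra.
move=> x Gx; have := hu x Gx.
have -> : u1 * (coord1 x - coord1 p) + u2 * (coord2 x - coord2 p) =
  ((w1 + w2) * (rot2 x - rot2 p) - (w2 - w1) * (rot1 x - rot1 p)) / 2.
  by rewrite u1E u2E /rot1 /rot2; field.
rewrite pmulr_lle0 ?invr_gt0 // subr_le0 => h.
rewrite -lerBlDl -(ler_pM2l W0); apply: (le_trans h).
by rewrite le_eqVlt; apply/orP; left; apply/eqP; field; rewrite gt_eqF.
Qed.

(** The two extra contact elements [lo] and [hi], beyond the bounded set and so
    steep that concavity is preserved, serve as the end points of the chains. *)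
Lemma quadrant_small (b eps : R) :
  (forall p, gamma p -> `|coord1 p| <= b /\ `|coord2 p| <= b) -> 0 <= b -> 0 < eps ->
  exists nu0 : R, forall (n : nat) (nu : R) (s : seq 'rV[R]_2),
    nu0 <= nu -> nu ^+ 3 = n%:R -> (0 < n)%N -> uniq s ->
    (forall p, p \in s -> quadrant p /\ lattice R n p) ->
    (size s)%:R <= eps * nu ^+ 2.
Proof.
move=> hb b0 eps0.
have /choice[sl hsl] : forall p, exists s : R, quadrant p -> `|s| <= 1 /\
  forall x, gamma x -> rot2 x <= rot2 p + s * (rot1 x - rot1 p).
  move=> p; have [/quadrant_slope[s hs]|h] := pselect (quadrant p); first by exists s.
  by exists 0.
pose ct p := Contact (rot1 p) (rot2 p) (sl p).
pose c := 2 * b.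
have c0 : 0 <= c by rewrite mulr_ge0.
have norme (e : int) : e = 1 \/ e = -1 -> `|e%:~R : R| = 1.
  by case=> ->; rewrite ?rmorphN ?normrN normr1.
have rc p : gamma p -> (- c <= rot1 p <= c) /\ (- c <= rot2 p <= c).
  move=> Gp; have [h1 h2] := hb p Gp.
  have n1 : `|e1%:~R * coord1 p| <= b by rewrite normrM norme // mul1r.
  have n2 : `|e2%:~R * coord2 p| <= b by rewrite normrM norme // mul1r.
  rewrite -!ler_norml; split; rewrite /c mulr2n mulrDl mul1r.
    by apply: (le_trans (ler_normB _ _)); exact: lerD.
  by apply: (le_trans (ler_normD _ _)); exact: lerD.
pose lo : contact R := Contact (- c - 1) (- (3 * c) - 2) (4 * c + 3).
pose hi : contact R := Contact (c + 1) (- (3 * c) - 2) (- (4 * c + 3)).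
pose G : set (contact R) := [set t | (exists2 p, quadrant p & t = ct p) \/ (t = lo \/ t = hi)].
have slb p (d : R) : quadrant p -> `|d| <= 2 * c + 1 -> - (2 * c + 1) <= sl p * d.
  move=> qp hd; have [h _] := hsl p qp.
  rewrite lerNl -mulNr; apply: (le_trans (ler_norm _)); rewrite normrM normrN.
  apply: le_trans hd; exact: ler_piMl.
have ctlo p : quadrant p -> 0 <= above (ct p) lo.
  move=> qp; have [/andP[x1 x2] /andP[y1 y2]] := rc p (proj1 qp).
  have hd : `|- c - 1 - rot1 p| <= 2 * c + 1.
    by rewrite ler_norml; apply/andP; split; lra.
  have := slb p _ qp hd; rewrite /above /= ; lra.
have cthi p : quadrant p -> 0 <= above (ct p) hi.
  move=> qp; have [/andP[x1 x2] /andP[y1 y2]] := rc p (proj1 qp).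
  have hd : `|c + 1 - rot1 p| <= 2 * c + 1.
    by rewrite ler_norml; apply/andP; split; lra.
  have := slb p _ qp hd; rewrite /above /= ; lra.
have c43 : 0 <= 4 * c + 3 by lra.
have loct p : quadrant p -> 0 <= above lo (ct p).
  move=> qp; have [/andP[x1 x2] /andP[y1 y2]] := rc p (proj1 qp).
  have : (4 * c + 3) * 1 <= (4 * c + 3) * (rot1 p - (- c - 1)).
    by apply: ler_wpM2l => //; lra.
  by rewrite /above /=; lra.
have hict p : quadrant p -> 0 <= above hi (ct p).
  move=> qp; have [/andP[x1 x2] /andP[y1 y2]] := rc p (proj1 qp).
  have : (4 * c + 3) * 1 <= (4 * c + 3) * (c + 1 - rot1 p).
    by apply: ler_wpM2l => //; lra.
  rewrite /above /= => h; have -> : - (4 * c + 3) * (rot1 p - (c + 1)) = (4 * c + 3) * (c + 1 - rot1 p) by ring.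
  by lra.
have pp : 0 <= (4 * c + 3) * (2 * c + 2) by rewrite mulr_ge0 //; lra.
have lohi : 0 <= above lo hi by rewrite /above /=; lra.
have hilo : 0 <= above hi lo by rewrite /above /=; lra.
have ctct p q : quadrant p -> quadrant q -> 0 <= above (ct p) (ct q).
  by move=> qp [Gq _]; rewrite /above /= subr_ge0; exact: (proj2 (hsl p qp)).
have ctinj p q : quadrant p -> quadrant q -> rot1 p = rot1 q -> p = q.
  move=> qp qq e; have := ctct _ _ qp qq; have := ctct _ _ qq qp.
  rewrite /above /= e subrr !mulr0 !addr0 !subr_ge0 => h1 h2.
  have e' : rot2 p = rot2 q by apply/eqP; rewrite eq_le h1 h2.
  by apply: plane_eq; rewrite ?rotK1 ?rotK2 e e'.
have Gc : concave G.
  split.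
    move=> t t' [[p qp ->]|[->|->]] [[q qq ->]|[->|->]] //;
      rewrite ?above_xx //; [exact: ctct|exact: ctlo|exact: cthi|exact: loct|exact: hict].
  have ctx p : quadrant p -> - c - 1 < rot1 p < c + 1.
    by move=> [/rc[/andP[h1 h2] _] _]; apply/andP; split; lra.
  move=> t t' [[p qp ->]|[->|->]] [[q qq ->]|[->|->]] //= e.
  - by rewrite (ctinj p q).
  - by have := ctx p qp; rewrite e ltxx.
  - by have := ctx p qp; rewrite e ltxx andbF.
  - by have := ctx q qq; rewrite -e ltxx.
  - by exfalso; lra.
  - by have := ctx q qq; rewrite -e ltxx andbF.
  - by exfalso; lra.
have Glo : G lo by right; left. have Ghi : G hi by right; right.
have Gin t : G t -> cx lo <= cx t <= cx hi.
  case=> [[p [Gp _] ->]|[->|->]] /=.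
  - by have [/andP[h1 h2] _] := rc p Gp; apply/andP; split; lra.
  - by rewrite lexx /=; lra.
  - by rewrite lexx andbT; lra.
have Bw : cx hi - cx lo <= 4 * c + 3 by rewrite /=; lra.
have Bs t : G t -> `|cs t| <= 4 * c + 3.
  case=> [[p qp ->]|[->|->]] /=.
  - by have [h _] := hsl p qp; apply: (le_trans h); lra.
  - by rewrite ger0_norm.
  - by rewrite normrN ger0_norm.
have B1 : 1 <= 4 * c + 3 by lra.
have [nu0 hnu0] := lattice_chain_small Gc Glo Ghi Gin Bw Bs B1 eps0.
exists nu0 => n nu s hnu nuE n0 us hs.
pose le : rel 'rV[R]_2 := fun p q => rot1 p <= rot1 q.
pose t := sort le s.
have sort_t : sorted le t by apply: sort_sorted => p q; exact: le_total.
have mem_t p : p \in t -> quadrant p /\ lattice R n p by rewrite mem_sort; exact: hs.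
have ut : uniq t by rewrite sort_uniq.
have st : size t = size s by rewrite size_sort.
have /choice[XY hXY] : forall p, exists XY : int * int, lattice R n p ->
   n%:R * rot1 p = XY.1%:~R /\ n%:R * rot2 p = XY.2%:~R.
  move=> p; have [Lp|nL] := pselect (lattice R n p); last by exists (0, 0).
  have [m1 h1] := Lp ord0; have [m2 h2] := Lp ord_max.
  exists (e1 * m1 - e2 * m2, e1 * m1 + e2 * m2) => _ /=.
  have nn : n%:R != 0 :> R by rewrite pnatr_eq0 -lt0n.
  have f1 : coord1 p = m1%:~R / n%:R := h1. have f2 : coord2 p = m2%:~R / n%:R := h2.
  by rewrite /rot1 /rot2 rmorphB rmorphD !rmorphM /= f1 f2; split; field.
pose z k := ct (nth 0 t k).
rewrite -st; apply: (hnu0 n (size t) nu z (fun k => (XY (nth 0 t k)).1) (fun k => (XY (nth 0 t k)).2)) => //.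
have qz k : (k < size t)%N -> quadrant (nth 0 t k).
  by move=> kt; apply: (proj1 (mem_t _ (mem_nth 0 kt))).
have zlt k : (k.+1 < size t)%N -> rot1 (nth 0 t k) < rot1 (nth 0 t k.+1).
  move=> kt; rewrite lt_neqAle; apply/andP; split; last exact: (sortedP 0 sort_t).
  apply/eqP => /(ctinj _ _ (qz _ (ltnW kt)) (qz _ kt)) /eqP.
  by rewrite (nth_uniq 0 (ltnW kt) kt ut) eqn_leq ltnn andbF.
split => //.
- by move=> k kt; left; exists (nth 0 t k) => //; exact: qz.
- move=> k kt; have k1 := ltnW kt; have k0 := ltnW k1.
  set p := nth 0 t k; set q := nth 0 t k.+1; set r := nth 0 t k.+2.
  have qp : quadrant p by exact: qz. have qq : quadrant q by exact: qz.
  have qr : quadrant r by exact: qz.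
  have pq : rot1 p < rot1 q by exact: zlt. have qr' : rot1 q < rot1 r by exact: zlt.
  rewrite /turns_right /=.
  have hp := ctct q p qq qp; have hr := ctct q r qq qr.
  rewrite /above /= subr_ge0 in hp hr.
  have x1 : 0 < rot1 q - rot1 p by rewrite subr_gt0.
  have x2 : 0 < rot1 r - rot1 q by rewrite subr_gt0.
  rewrite lt_neqAle; apply/andP; split; last first.
    apply: (@le_trans _ _ (sl q * (rot1 r - rot1 q) * (rot1 q - rot1 p))).
      by rewrite ler_pM2r //; lra.
    rewrite mulrAC ler_pM2r //.
    have -> : sl q * (rot1 q - rot1 p) = - (sl q * (rot1 p - rot1 q)) by ring.
    by lra.
  apply/eqP => h.
  pose tt := (rot1 q - rot1 p) / (rot1 r - rot1 p).
  have x3 : 0 < rot1 r - rot1 p by rewrite subr_gt0 (lt_trans pq).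
  have tt01 : 0 < tt < 1.
    by rewrite divr_gt0 //= ltr_pdivrMr // mul1r ltrD2r.
  have x3n : rot1 r - rot1 p != 0 by rewrite gt_eqF.
  have r1 : rot1 q = rot1 p + tt * (rot1 r - rot1 p) by rewrite /tt divfK // addrC subrK.
  have r2 : rot2 q = rot2 p + tt * (rot2 r - rot2 p).
    have h' : (rot1 q - rot1 p) * (rot2 r - rot2 p) = (rot2 q - rot2 p) * (rot1 r - rot1 p).
      apply/eqP; rewrite -subr_eq0; apply/eqP.
      have -> : (rot1 q - rot1 p) * (rot2 r - rot2 p) - (rot2 q - rot2 p) * (rot1 r - rot1 p)
        = (rot2 r - rot2 q) * (rot1 q - rot1 p) - (rot2 q - rot2 p) * (rot1 r - rot1 q) by ring.
      by rewrite h subrr.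
    by rewrite /tt mulrAC h' mulfK // addrC subrK.
  apply: (@no_three_collinear R gamma gconn gsupp gseg p q r tt) => //.
  + by case: qp. + by case: qq. + by case: qr.
  + by apply/eqP => e; move: x3; rewrite e subrr ltxx.
  + by rewrite !rotK1 {1}r1 {1}r2; ring.
  + by rewrite !rotK2 {1}r1 {1}r2; ring.
- by move=> k kt; exact: (hXY _ (proj2 (mem_t _ (mem_nth 0 kt)))).
Qed.
End Quadrant.

Lemma size_cover4 (T : Type) (a b c d : pred T) (s : seq T) :
  (forall x, [|| a x, b x, c x | d x]) ->
  (size s <= size (seq.filter a s) + size (seq.filter b s) + size (seq.filter c s) + size (seq.filter d s))%N.
Proof.
move=> h; rewrite !size_filter; elim: s => //= x s IH; have := h x.
move: IH; case: (a x); case: (b x); case: (c x); case: (d x) => //= ; lia.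
Qed.

Unset Implicit Arguments.
Set Strict Implicit.

Theorem mainTheorem1 (R : realType) (gamma : set 'rV[R]_2) :
  bounded_set gamma -> strictly_convex_curve gamma ->
  (fun n : nat => (lattice_count gamma n)%:R : R^o) =o_\oo
  (fun n : nat => (n%:R `^ (2%:R / 3%:R)) : R^o).
Proof.
move=> gB [[gconn [K Kc gK]] gseg].
have gsupp p : gamma p -> exists u1 u2, normal_at gamma p u1 u2.
  move=> Gp; have [u1 [u2 [u0 hu]]] := boundary_support Kc (gK p Gp).
  by exists u1, u2; split => // x Gx; apply: hu; case: (gK x Gx).
have [b b0 hb] : exists2 b : R, 0 <= b & forall p, gamma p -> `|coord1 p| <= b /\ `|coord2 p| <= b.
  case: gB => M [_ hM]; exists (`|M| + 1); first by rewrite addr_ge0.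
  have lt : M < `|M| + 1 by rewrite (le_lt_trans (ler_norm M)) // ltrDl.
  move=> p Gp; have hp := hM _ lt p Gp; have [h1 h2] := coord_le_norm p.
  by split; [exact: le_trans h1 hp | exact: le_trans h2 hp].
apply/eqoP => eps eps0.
have e4 : 0 < eps / 4 by rewrite divr_gt0.
have p1 : (1 : int) = 1 \/ (1 : int) = -1 by left.
have m1 : (-1 : int) = 1 \/ (-1 : int) = -1 by right.
have [n1 h1] := @quadrant_small R gamma 1 1 p1 p1 gconn gsupp gseg b (eps / 4) hb b0 e4.
have [n2 h2] := @quadrant_small R gamma 1 (-1) p1 m1 gconn gsupp gseg b (eps / 4) hb b0 e4.
have [n3 h3] := @quadrant_small R gamma (-1) 1 m1 p1 gconn gsupp gseg b (eps / 4) hb b0 e4.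
have [n4 h4] := @quadrant_small R gamma (-1) (-1) m1 m1 gconn gsupp gseg b (eps / 4) hb b0 e4.
pose nu0 : R := `|n1| + `|n2| + `|n3| + `|n4| + 1.
have nu01 : 1 <= nu0 by rewrite lerDr !addr_ge0.
exists (Num.truncn (nu0 ^+ 3)).+1 => // n /= hn.
have n3n : nu0 ^+ 3 <= n%:R.
  by apply: (le_trans (ltW (truncnS_gt _))); rewrite ler_nat.
have n0 : (0 < n)%N by exact: leq_trans hn.
pose nu := cbrt (n%:R : R).
have nuE : nu ^+ 3 = n%:R by exact: cbrtK.
have nu0le : nu0 <= nu.
  by apply: cube_le; rewrite ?cbrt_ge0 ?nuE // (le_trans ler01).
have nu2 : n%:R `^ (2%:R / 3%:R) = nu ^+ 2.
  by rewrite mulrC powRrM -/(cbrt _) powR_mulrn // cbrt_ge0.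
rewrite nu2 ger0_norm // ger0_norm ?sqr_ge0 //.
have fin := finite_bounded_lattice n0 gB.
rewrite /lattice_count; set A := fset_set _.
pose s : seq 'rV[R]_2 := A.
have us : uniq s by exact: fset_uniq.
have sA p : p \in s -> gamma p /\ lattice R n p.
  by rewrite /s /A in_fset_set // => /set_mem.
have nn (k : R) : k <= `|k| by exact: ler_norm.
have le1 : n1 <= nu by apply: le_trans nu0le; have := nn n1; rewrite /nu0; have := normr_ge0 n2; have := normr_ge0 n3; have := normr_ge0 n4; lra.
have le2 : n2 <= nu by apply: le_trans nu0le; have := nn n2; rewrite /nu0; have := normr_ge0 n1; have := normr_ge0 n3; have := normr_ge0 n4; lra.
have le3 : n3 <= nu by apply: le_trans nu0le; have := nn n3; rewrite /nu0; have := normr_ge0 n2; have := normr_ge0 n1; have := normr_ge0 n4; lra.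
have le4 : n4 <= nu by apply: le_trans nu0le; have := nn n4; rewrite /nu0; have := normr_ge0 n2; have := normr_ge0 n3; have := normr_ge0 n1; lra.
pose Q e1 e2 p := `[< gamma p -> quadrant gamma e1 e2 p >].
have hQ e1 e2 p : p \in seq.filter (Q e1 e2) s -> quadrant gamma e1 e2 p /\ lattice R n p.
  by rewrite mem_filter => /andP[/asboolP h /sA[Gp Lp]]; split => //; exact: h.
have cover p : [|| Q 1 1 p, Q 1 (-1) p, Q (-1) 1 p | Q (-1) (-1) p].
  have [Gp|nG] := pselect (gamma p); last by apply/or4P; apply: Or41; apply/asboolP.
  have [u1 [u2 hu]] := gsupp p Gp; apply/or4P.
  have [c1|c1] := lerP 0 u1; have [c2|c2] := lerP 0 u2.
  - apply: Or41; apply/asboolP => _; split => //; exists u1, u2; split; rewrite ?mul1r //.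
  - apply: Or42; apply/asboolP => _; split => //; exists u1, u2; split; rewrite ?mul1r //.
    by rewrite rmorphN mulN1r oppr_ge0 ltW.
  - apply: Or43; apply/asboolP => _; split => //; exists u1, u2; split; rewrite ?mul1r //.
    by rewrite rmorphN mulN1r oppr_ge0 ltW.
  - apply: Or44; apply/asboolP => _; split => //; exists u1, u2; split => //.
      by rewrite rmorphN mulN1r oppr_ge0 ltW.
    by rewrite rmorphN mulN1r oppr_ge0 ltW.
have sz := size_cover4 s cover.
have {}h1 := h1 n nu _ le1 nuE n0 (filter_uniq (Q 1 1) us) (hQ 1 1).
have {}h2 := h2 n nu _ le2 nuE n0 (filter_uniq (Q 1 (-1)) us) (hQ 1 (-1)).
have {}h3 := h3 n nu _ le3 nuE n0 (filter_uniq (Q (-1) 1) us) (hQ (-1) 1).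
have {}h4 := h4 n nu _ le4 nuE n0 (filter_uniq (Q (-1) (-1)) us) (hQ (-1) (-1)).
have -> : (#|` A| = size s)%N by [].
have : (size s)%:R <= (size (seq.filter (Q 1 1) s))%:R + (size (seq.filter (Q 1 (-1)) s))%:R
   + (size (seq.filter (Q (-1) 1) s))%:R + (size (seq.filter (Q (-1) (-1)) s))%:R :> R.
  by rewrite -!natrD ler_nat.
by clear -h1 h2 h3 h4; lra.
Qed.
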